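(* Let $G$ be a finite group. Assume that every composition factor of $G$ is either of prime order or isomorphic to $\mathrm{PSL}(2,p)$ for some prime $p\geq 5$. Then the prime graph question has a positive answer for $\mathbb{Z}G$, i.e. $\Pi(V(\mathbb{Z}G)) = \Pi(G)$.
   Context: For a group $H$ (not necessarily finite), the prime graph $\Pi(H)$ is the graph whose vertices are the primes $p$ for which $H$ has an element of order $p$; two different vertices $p$ and $q$ are joined by an edge if and only if $H$ has an element of order $p\cdot q$. For a finite group $G$, $\mathbb{Z}G$ is the integral group ring and $V(\mathbb{Z}G)$ is the group of normalised units, i.e. the subgroup of the unit group of $\mathbb{Z}G$ consisting of all units of augmentation $1$ (it contains $G$). *)

(* Defs.v *)
From HB Require Import structures.
From mathcomp Require Import all_boot all_order all_algebra.
From mathcomp Require Import all_fingroup all_solvable.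

Set Implicit Arguments.
Unset Strict Implicit.
Unset Printing Implicit Defensive.

Import GRing.Theory.

Local Open Scope group_scope.

Record graph := Graph {
  vertex : nat -> Prop;
  edge : nat -> nat -> Prop
}.

Definition same_graph (A B : graph) : Prop :=
  (forall p, vertex A p <-> vertex B p) /\
  (forall p q, edge A p q <-> edge B p q).

(* [#[x]] is only available in finite groups. *)
Definition has_order (H : groupType) (x : H) (n : nat) : Prop :=
  [/\ 0 < n, x ^+ n = 1 & forall m, 0 < m < n -> x ^+ m <> 1].

Definition pg_vertex (H : groupType) (p : nat) : Prop :=
  prime p /\ exists x : H, has_order x p.

Definition pg_edge (H : groupType) (p q : nat) : Prop :=
  [/\ pg_vertex H p, pg_vertex H q, p <> q
    & exists x : H, has_order x (p * q)].

Definition prime_graph (H : groupType) : graph :=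
  Graph (pg_vertex H) (pg_edge H).

Section GroupRing.

Local Open Scope ring_scope.

Variables (R : nzRingType) (gT : finGroupType).

(* [a : group_algebra] is the formal sum of the [a g *: g]; the alias hides
   the pointwise product of [{ffun gT -> R}]. *)
Definition group_algebra := {ffun gT -> R}.

HB.instance Definition _ := GRing.Zmodule.on group_algebra.

Implicit Types a b c : group_algebra.

Definition gr_one : group_algebra := [ffun g => (g == 1%g)%:R].

Definition gr_mul a b : group_algebra :=
  [ffun g => \sum_(h : gT) a h * b (h^-1 * g)%g].

Fact gr_mulA : associative gr_mul.
Proof.
move=> a b c; apply/ffunP=> g; rewrite !ffunE.
under eq_bigr do rewrite ffunE mulr_sumr.
under [RHS]eq_bigr do rewrite ffunE mulr_suml.
rewrite [RHS]exchange_big; apply: eq_bigr => h _.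
rewrite (reindex_inj (mulgI h^-1)%g); apply: eq_bigr => k _.
by rewrite mulrA invMg invgK -mulgA mulKVg.
Qed.

Fact gr_mul1 : left_id gr_one gr_mul.
Proof.
move=> a; apply/ffunP=> g; rewrite !ffunE (bigD1 1%g) //= ffunE eqxx mul1r.
by rewrite invg1 mul1g big1 ?addr0 // => h /negPf h1; rewrite ffunE h1 mul0r.
Qed.

Fact gr_mulr1 : right_id gr_one gr_mul.
Proof.
move=> a; apply/ffunP=> g; rewrite !ffunE (bigD1 g) //= ffunE mulVg eqxx mulr1.
rewrite big1 ?addr0 // => h hg; rewrite ffunE -eq_mulVg1 (negPf hg).
by rewrite mulr0.
Qed.

Fact gr_mulDl : left_distributive gr_mul +%R.
Proof.
move=> a b c; apply/ffunP=> g; rewrite !ffunE -big_split.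
by apply: eq_bigr => h _; rewrite ffunE mulrDl.
Qed.

Fact gr_mulDr : right_distributive gr_mul +%R.
Proof.
move=> a b c; apply/ffunP=> g; rewrite !ffunE -big_split.
by apply: eq_bigr => h _; rewrite ffunE mulrDr.
Qed.

Fact gr_oner_neq0 : gr_one != 0.
Proof.
by apply/eqP=> /ffunP/(_ 1%g)/eqP; rewrite !ffunE eqxx oner_eq0.
Qed.

HB.instance Definition _ := GRing.Zmodule_isNzRing.Build group_algebra
  gr_mulA gr_mul1 gr_mulr1 gr_mulDl gr_mulDr gr_oner_neq0.

Definition aug a : R := \sum_(g : gT) a g.

Fact aug_is_zmod_morphism : zmod_morphism aug.
Proof.
by move=> a b; rewrite /aug -sumrB; apply: eq_bigr => g _; rewrite !ffunE.
Qed.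

Fact aug_is_monoid_morphism : monoid_morphism aug.
Proof.
split=> [|a b]; rewrite /aug.
  rewrite (bigD1 1%g) //= ffunE eqxx big1 ?addr0 // => g /negPf g1.
  by rewrite ffunE g1.
under eq_bigr do rewrite ffunE.
rewrite exchange_big mulr_suml; apply: eq_bigr => h _.
rewrite mulr_sumr (reindex_inj (mulgI h)); apply: eq_bigr => g _.
by rewrite mulKg.
Qed.

HB.instance Definition _ :=
  GRing.isZmodMorphism.Build group_algebra R aug aug_is_zmod_morphism.
HB.instance Definition _ :=
  GRing.isMonoidMorphism.Build group_algebra R aug aug_is_monoid_morphism.

End GroupRing.

Notation integral_group_ring := (group_algebra int).

Section UnitGroup.

Local Open Scope ring_scope.

Variable R : nzRingType.

(* A unit is stored together with its two-sided inverse, which it determines, so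
   that invertibility in [R] need not be decidable. *)
Definition inverse_pair : pred (R * R) :=
  [pred u | (u.1 * u.2 == 1) && (u.2 * u.1 == 1)].

Record unit_group := UnitGroup {
  unit_pair :> R * R;
  unit_pairP : inverse_pair unit_pair
}.

HB.instance Definition _ := [isSub for unit_pair].
HB.instance Definition _ := [Choice of unit_group by <:].

Definition unit_val (u : unit_group) : R := u.1.

Fact unit_mulV (u : unit_group) : u.1 * u.2 = 1.
Proof. by case/andP: (unit_pairP u) => /eqP. Qed.

Fact unit_Vmul (u : unit_group) : u.2 * u.1 = 1.
Proof. by case/andP: (unit_pairP u) => _ /eqP. Qed.

Fact unit_val_inj : injective unit_val.
Proof.
move=> u v uv1; apply: val_inj.
have uv2: u.2 = v.2.
  rewrite -[LHS]mulr1 -(unit_mulV v) -[v.1]/(unit_val v) -uv1 mulrA unit_Vmul.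
  by rewrite mul1r.
by rewrite /= [unit_pair u]surjective_pairing [unit_pair v]surjective_pairing
   -[u.1]/(unit_val u) uv1 uv2.
Qed.

Fact unit_oneP : inverse_pair (1, 1).
Proof. by apply/andP; split; rewrite mulr1. Qed.

Fact unit_invP (u : unit_group) : inverse_pair (u.2, u.1).
Proof. by apply/andP; split; rewrite ?unit_mulV ?unit_Vmul. Qed.

Fact unit_mulP (u v : unit_group) : inverse_pair (u.1 * v.1, v.2 * u.2).
Proof.
apply/andP; split; apply/eqP; rewrite /= mulrA.
  by rewrite -[_ * v.2]mulrA unit_mulV mulr1 unit_mulV.
by rewrite -[_ * u.1]mulrA unit_Vmul mulr1 unit_Vmul.
Qed.

Definition unit_one := UnitGroup unit_oneP.
Definition unit_inv u := UnitGroup (unit_invP u).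
Definition unit_mul u v := UnitGroup (unit_mulP u v).

Fact unit_mulA : associative unit_mul.
Proof. by move=> u v w; apply: unit_val_inj; rewrite /unit_val /= mulrA. Qed.

Fact unit_mul1 : left_id unit_one unit_mul.
Proof. by move=> u; apply: unit_val_inj; rewrite /unit_val /= mul1r. Qed.

Fact unit_mulr1 : right_id unit_one unit_mul.
Proof. by move=> u; apply: unit_val_inj; rewrite /unit_val /= mulr1. Qed.

Fact unit_mulVg : left_inverse unit_one unit_inv unit_mul.
Proof. by move=> u; apply: unit_val_inj; rewrite /unit_val /= unit_Vmul. Qed.

Fact unit_mulgV : right_inverse unit_one unit_inv unit_mul.
Proof. by move=> u; apply: unit_val_inj; rewrite /unit_val /= unit_mulV. Qed.

HB.instance Definition _ := isGroup.Build unit_group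
  unit_mulA unit_mul1 unit_mulr1 unit_mulVg unit_mulgV.

End UnitGroup.

Section NormalisedUnits.

Variable gT : finGroupType.

Definition aug_one : pred (unit_group (integral_group_ring gT)) :=
  [pred u | aug (unit_val u) == 1%R].

Record normalised_units := NormalisedUnit {
  normalised_val :> unit_group (integral_group_ring gT);
  normalised_valP : aug_one normalised_val
}.

HB.instance Definition _ := [isSub for normalised_val].
HB.instance Definition _ := [Choice of normalised_units by <:].

Fact normalised_group_closed : group_closed aug_one.
Proof.
split=> [|u v]; rewrite !unfold_in ?rmorph1 // => /eqP u1 /eqP v1.
have uvM: unit_val (u * v^-1) = (unit_val u * unit_val v^-1%g)%R by [].
have vV: (aug (unit_val v) * aug (unit_val v^-1%g) = 1)%R.
  by rewrite -rmorphM -[(_ * _)%R]/(v.1 * v.2)%R unit_mulV rmorph1.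
by apply/eqP; rewrite uvM rmorphM -vV; congr (_ * _)%R; rewrite [LHS]u1 v1.
Qed.

HB.instance Definition _ := SubChoice_isSubGroup.Build
  (unit_group (integral_group_ring gT)) aug_one normalised_units
  normalised_group_closed.

End NormalisedUnits.

Section ProjectiveSpecialLinear.

Variables (n : nat) (R : finComUnitRingType).

Definition SL : {set {'GL_n[R]}} := [set u | (\det (GLval u) == 1)%R].

Fact SL_group_set : group_set SL.
Proof.
apply/group_setP; split=> [|u v]; rewrite !inE ?det1 // => /eqP u1 /eqP v1.
by rewrite GL_MxE det_mulmx u1 v1 mulr1.
Qed.

Canonical SL_group := Group SL_group_set.

Definition PSL : {set coset_of 'Z(SL)} := SL / 'Z(SL).

Canonical PSL_group := [group of PSL].

End ProjectiveSpecialLinear.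

Definition composition_factor (gT : finGroupType) (G : {group gT})
    (X : section gT) : Prop :=
  exists2 s : seq {group gT}, comps G s & X \in mkfactors G s.

(* Main.v *)
Require Import Defs.
From mathcomp Require Import all_boot all_order all_algebra.
From mathcomp Require Import all_fingroup all_solvable all_field.
From mathcomp Require Import zify ring.

(** The vertices agree, and an edge of the prime graph of [V(ZG)] comes from two commuting
    normalised units [v] and [w] of distinct prime orders [p] and [q]. A homomorphism from
    [G] to a ring extends to [ZG]; on a class function it is determined by the partial
    augmentations of the unit, up to a factor the integers [csum a x]. For a torsion unit
    these are restricted as follows.
    - They vanish at the identity ([berman_higman]).
    - They vanish at elements whose order is divisible by a prime not dividing the order
      of the unit ([csum_new_prime]), and, for the units at hand, at elements of order
      [p ^ j] with [j > 1] ([csum_large_order], [mixed_unit_support]).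
    - They are Galois invariant ([csum_coprime_pow], [gr_lift_coprime_pow]).
    As a first consequence, if a unit of order [p] becomes trivial modulo a normal subgroup
    [N], then [p] divides the order of [N] ([torsion_kernel]); with [N = G] this settles
    the vertices.

    For the edges the argument is an induction on the order of [G] ([unit_edge]). If both
    units survive in the integral group ring of [G / N], for some non-trivial normal
    subgroup [N], the quotient has an element of order [pq] and so has [G]. Otherwise [N]
    may be taken to be a [p]-group or to contain a simple normal factor [L] isomorphic to
    PSL(2, r) of order divisible by [p], up to exchanging [p] and [q]. The case of a
    [p]-group is a Frobenius group argument ([normal_pgroup_edge]). If [L] is not normal
    in [G], there are commuting conjugates of [L], and an element of order [pq] is found in
    or over a product of such conjugates. If [L] is normal, one reduces to the case where
    its centraliser is trivial.

    It remains to treat almost simple groups [G] with socle PSL(2, r)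
    ([almost_simple_edge]). Such a [G] acts faithfully by projective matrices of size two
    over the field with [r] elements ([PSL_action]), and the prime divisors of the order
    of the socle are [r] and the prime divisors of [r - 1] and [r + 1].
    - If [p = r], the permutation character on the projective line is evaluated at the
      units: the multiplicities of their joint eigenvalues cannot all be natural numbers
      ([no_edge_at_r]).
    - If [p] and [q] are odd and divide [r - 1] and [r + 1] respectively, the eigenvalues
      of [vw] on the three-dimensional representation over the algebraic closure of the
      prime field form a multiset that is closed under inversion and the Frobenius, and
      three is too small a dimension ([no_edge_opposite]).
    - If [p = 2], the eigenvalues on the representations of dimensions three and five are
      incompatible modulo [r] unless [G] has an element of order [2q]
      ([no_edge_involution]).
    - If [p] and [q] are odd divisors of the same number [r - 1] or [r + 1], a cyclic
      torus of the socle has an element of order [pq]. *)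

Set Implicit Arguments.
Unset Strict Implicit.
Unset Printing Implicit Defensive.

Import Order.TTheory GRing.Theory Num.Theory.

(** * Matrices of finite multiplicative order *)

Section Spectral.

Local Open Scope ring_scope.

(** The polynomial [X^n - 1] is a product of distinct linear factors. *)
Lemma finite_order_diag (F : fieldType) (n d : nat) (z : F) (A : 'M[F]_d) :
    n.-primitive_root z -> A ^+ n = 1 ->
  exists (P : 'M[F]_d) (D : 'rV[F]_d),
    [/\ P \in unitmx, A = invmx P *m diag_mx D *m P
       & forall k, D 0 k ^+ n = 1].
Proof.
move=> zP; case: d A => [|d] A An.
  exists 1%:M, 0; split; first exact: unitmx1.
    by apply/matrixP=> [[]].
  by case.
have ngt0 := prim_order_gt0 zP.
have dA : exists2 P, P \in unitmx & is_diag_mx (mxpoly.conjmx P A).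
  apply/mxpoly.diagonalizableP; exists [seq z ^+ i | i <- index_iota 0 n].
    rewrite map_inj_in_uniq ?iota_uniq // => i j; rewrite !mem_index_iota /=.
    move=> ltin ltjn /eqP; rewrite (eq_prim_root_expr zP).
    by rewrite !modn_small // => /eqP.
  rewrite big_map factor_Xn_sub_1 //; apply: mxminpoly_min.
  by rewrite rmorphB rmorphXn /= horner_mx_X rmorph1 An subrr.
case: dA => P Pu /(mxpoly.diagonalizable_forLR Pu)[D AE].
have AE' : A = invmx P *m diag_mx D *m P.
  by rewrite AE mxpoly.conjumx ?unitmx_inv // invmxK.
exists P, D; split=> // k.
have pow m : A ^+ m = invmx P *m diag_mx D ^+ m *m P.
  elim: m => [|m IHm]; first by rewrite !expr0 mulmx1 mulVmx.
  rewrite !exprS IHm {1}AE' -[LHS]/(_ *m _) !mulmxA mulmxK //.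
have : diag_mx D ^+ n = 1.
  have /(congr1 (fun M => P *m M *m invmx P)) := esym (pow n).
  by rewrite An !mulmxA mulmxV // mul1mx mulmxK // mulmx1 mulmxV.
have -> m : diag_mx D ^+ m = diag_mx (\row_i D 0 i ^+ m).
  elim: m => [|m IHm].
    rewrite expr0; apply/matrixP=> i j; rewrite !mxE expr0.
    by [].
  rewrite exprS IHm -[LHS]/(_ *m _) mulmx_diag; congr diag_mx.
  by apply/rowP=> i; rewrite !mxE exprS.
by move/matrixP/(_ k k); rewrite !mxE eqxx !mulr1n.
Qed.

(** Over a field with enough roots of unity, the traces of the powers of a
    matrix of finite order are the power sums of a family of roots of unity:
    this is all that is used of a representation of a cyclic group. *)
Lemma finite_order_trace (F : fieldType) (n d : nat) (z : F) (A : 'M[F]_d) :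
    n.-primitive_root z -> A ^+ n = 1 ->
  exists2 c : 'I_d -> F, (forall k, c k ^+ n = 1)
    & forall m, \tr (A ^+ m) = \sum_k c k ^+ m.
Proof.
move=> zP An; have [P [D [Pu AE Dn]]] := finite_order_diag zP An.
exists (D 0) => // m.
have -> : A ^+ m = invmx P *m diag_mx (\row_i D 0 i ^+ m) *m P.
  elim: m => [|m IHm].
    rewrite expr0 (_ : diag_mx _ = 1%:M) ?mulmx1 ?mulVmx //.
    by apply/matrixP=> i j; rewrite !mxE expr0.
  rewrite exprSr IHm {1}AE -[LHS]/(_ *m _) !mulmxA mulmxK //.
  rewrite -[X in X *m P]mulmxA mulmx_diag; congr (_ *m diag_mx _ *m _).
  by apply/rowP=> i; rewrite !mxE exprSr.
rewrite mxtrace_mulC mulmxA mulmxV // mul1mx mxtrace_diag.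
by apply: eq_bigr => i _; rewrite mxE.
Qed.

Definition mxC d (A : 'M[int]_d) : 'M[algC]_d := map_mx intr A.

Lemma mxC_X d (A : 'M[int]_d) m : mxC (A ^+ m) = mxC A ^+ m.
Proof.
rewrite /mxC; elim: m => [|m IHm]; first by rewrite !expr0 map_mx1.
by rewrite !exprS -IHm -[LHS]/(map_mx _ (_ *m _)) map_mxM.
Qed.

Lemma trace_mxC d (A : 'M[int]_d) : \tr (mxC A) = (\tr A)%:~R.
Proof. by rewrite /mxC trace_map_mx. Qed.

(** The trace is a sum of [n]-th roots of unity; the automorphism of the cyclotomic field
    that raises these to the power [k] fixes the integers. *)
Lemma trace_coprime_pow (n d k : nat) (A : 'M[int]_d) :
  A ^+ n = 1 -> (0 < n)%N -> coprime k n -> \tr (A ^+ k) = \tr A.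
Proof.
move=> An n_gt0 co_kn; have [z zP] := C_prim_root_exists n_gt0.
have An' : mxC A ^+ n = 1 by rewrite -mxC_X An /mxC map_mx1.
have [c cn trE] := finite_order_trace zP An'.
have [u uP] := Qn_aut_exists co_kn.
apply/eqP; rewrite -(eqr_int algC) -!trace_mxC mxC_X trE; apply/eqP.
transitivity (u (\tr (mxC A))); last by rewrite trace_mxC rmorph_int.
rewrite -[mxC A in RHS]expr1 trE rmorph_sum; apply: eq_bigr => i _ /=.
by rewrite expr1 uP.
Qed.

(** Factor [E = X Y] through its image: then [Y X = 1]. *)
Lemma trace_idem (F : fieldType) d (E : 'M[F]_d) :
  E *m E = E -> \tr E = (\rank E)%:R.
Proof.
move=> EE; have := mulmx_base E; set X := col_base E; set Y := row_base E.
move=> XY; rewrite -{1}XY mxtrace_mulC.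
suff -> : Y *m X = 1%:M by rewrite mxtrace1.
have [Y' YY'] : exists Y', Y *m Y' = 1%:M by apply/row_freeP/row_base_free.
have [X' XX'] : exists X', X' *m X = 1%:M by apply/row_fullP/col_base_full.
have : (X *m Y) *m (X *m Y) = X *m Y by rewrite XY.
move=> /(congr1 (fun M => X' *m M *m Y')).
by clearbody X Y; rewrite !mulmxA XX' mul1mx -!mulmxA YY' mulmx1.
Qed.

Lemma trace_idem_scale (F : numFieldType) (d c : nat) (A : 'M[F]_d) :
  A *m A = A *+ c -> (0 < c)%N -> \tr A = (c * \rank A)%:R.
Proof.
move=> AA c0; have cn0 : c%:R != 0 :> F by rewrite pnatr_eq0 -lt0n.
have := @trace_idem F d (c%:R^-1 *: A).
rewrite -scalemxAl -scalemxAr AA -scaler_nat !scalerA -mulrA mulVf // mulr1.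
move=> /(_ erefl); rewrite linearZ /= mxrank_scale_nz ?invr_eq0 //.
by move=> /(congr1 (fun z => c%:R * z)); rewrite mulVKf // -natrM.
Qed.

Lemma sum_powers_mul (A : pzRingType) (x : A) n :
  x ^+ n = 1 -> x * (\sum_(i < n) x ^+ i) = \sum_(i < n) x ^+ i.
Proof.
case: n => [|n] xn; first by rewrite !big_ord0 mulr0.
rewrite mulr_sumr big_ord_recr [RHS]big_ord_recl /= -exprS xn expr0 addrC.
by congr (_ + _); apply: eq_bigr => k _; rewrite -exprS.
Qed.

Lemma sum_powers_idem (A : pzRingType) (x : A) n :
  x ^+ n = 1 ->
  (\sum_(i < n) x ^+ i) * (\sum_(i < n) x ^+ i) = (\sum_(i < n) x ^+ i) *+ n.
Proof.
move=> xn; rewrite {1}mulr_suml (eq_bigr (fun=> \sum_(i < n) x ^+ i)).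
  by rewrite sumr_const card_ord.
move=> k _; elim: (val k) => [|i IHi]; first by rewrite mul1r.
by rewrite exprSr -mulrA sum_powers_mul.
Qed.

Lemma expr_coprime_eq1 (A : pzRingType) (x : A) m n :
  (0 < m)%N -> coprime m n -> x ^+ m = 1 -> x ^+ n = 1 -> x = 1.
Proof.
move=> m0 /eqP co xm xn; case: (egcdnP n m0) => km kn e _.
rewrite co in e; have : x ^+ (km * m) = 1 by rewrite mulnC exprM xm expr1n.
by rewrite e exprD mulnC exprM xn expr1n mul1r expr1.
Qed.

End Spectral.

(** * Linear extension to the group ring and class sums *)

Section Lift.

Local Open Scope ring_scope.

Variable gT : finGroupType.
Implicit Types (a b : integral_group_ring gT) (g h x y : gT).

Definition gr_lift (V : zmodType) (f : gT -> V) a : V := \sum_g f g *~ a g.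

Definition gr_of g : integral_group_ring gT := [ffun h => (h == g)%:R].

Lemma gr_liftB (V : zmodType) (f : gT -> V) a b :
  gr_lift f (a - b) = gr_lift f a - gr_lift f b.
Proof. by rewrite -sumrB; apply: eq_bigr => g _; rewrite !ffunE mulrzBr. Qed.

Lemma gr_lift_comp (V W : zmodType) (u : {additive V -> W}) (f : gT -> V) a :
  u (gr_lift f a) = gr_lift (u \o f) a.
Proof. by rewrite raddf_sum; apply: eq_bigr => g _; rewrite raddfMz. Qed.

Lemma gr_lift_of (V : zmodType) (f : gT -> V) g : gr_lift f (gr_of g) = f g.
Proof.
rewrite /gr_lift (bigD1 g) //= ffunE eqxx big1 ?addr0 // => h /negPf hg.
by rewrite ffunE hg mulr0z.
Qed.

Lemma eq_gr_lift (V : zmodType) (f f' : gT -> V) a :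
  f =1 f' -> gr_lift f a = gr_lift f' a.
Proof. by move=> ff'; apply: eq_bigr => g _; rewrite ff'. Qed.

Lemma gr_of1 : gr_of 1%g = 1.
Proof. by apply/ffunP=> g; rewrite !ffunE. Qed.

Lemma gr_ofM g h : gr_of (g * h)%g = gr_of g * gr_of h.
Proof.
apply/ffunP=> k; rewrite !ffunE (bigD1 g) //= !ffunE eqxx mul1r big1 ?addr0.
  by rewrite -(inj_eq (mulgI g^-1%g)) mulKg.
by move=> i /negPf ig; rewrite ffunE ig mul0r.
Qed.

Lemma gr_lift1 (A : pzRingType) (f : gT -> A) :
  f 1%g = 1 -> gr_lift f 1 = 1.
Proof. by rewrite -gr_of1 gr_lift_of. Qed.

Lemma gr_liftM (A : pzRingType) (f : gT -> A) a b :
    {morph f : x y / (x * y)%g >-> x * y} ->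
  gr_lift f (a * b) = gr_lift f a * gr_lift f b.
Proof.
move=> fM; rewrite mulr_suml.
transitivity (\sum_g \sum_h f g *~ (a h * b (h^-1 * g)%g)).
  by apply: eq_bigr => g _; rewrite ffunE mulrz_sumr.
rewrite exchange_big; apply: eq_bigr => h _; rewrite mulr_sumr.
rewrite (reindex_inj (mulgI h)); apply: eq_bigr => g _ /=.
by rewrite mulKg fM mulrzAr mulrzAl -mulrzA mulrC.
Qed.

Lemma gr_liftX (A : pzRingType) (f : gT -> A) a n :
    f 1%g = 1 -> {morph f : x y / (x * y)%g >-> x * y} ->
  gr_lift f (a ^+ n) = gr_lift f a ^+ n.
Proof.
move=> f1 fM; elim: n => [|n IHn]; first by rewrite !expr0 gr_lift1.
by rewrite !exprS gr_liftM // IHn.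
Qed.

Lemma augE a : aug a = gr_lift (fun=> 1) a.
Proof. by apply: eq_bigr => g _; rewrite intz. Qed.

(** [csum a x] is the partial augmentation of [a] at the class of [x] times the
    order of the centraliser of [x]; it is the trace of the map
    [m |-> a m x^-1] of the group ring. *)
Definition csum a x : int := \sum_m a (x ^ m)%g.

Lemma csumJ a x y : csum a (x ^ y)%g = csum a x.
Proof.
rewrite /csum [RHS](reindex_inj (mulgI y)); apply: eq_bigr => m _.
by rewrite conjgM.
Qed.

Lemma csum1 a : csum a 1%g = a 1%g *+ #|gT|.
Proof.
rewrite /csum; under eq_bigr do rewrite conj1g.
by rewrite sumr_const cardT.
Qed.

Lemma csumD a b x : csum (a + b) x = csum a x + csum b x.
Proof. by rewrite -big_split; apply: eq_bigr => m _; rewrite ffunE. Qed.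

Lemma csumB a b x : csum (a - b) x = csum a x - csum b x.
Proof. by rewrite -sumrB; apply: eq_bigr => m _; rewrite !ffunE. Qed.

Lemma csum_sum I (r : seq I) P (F : I -> integral_group_ring gT) x :
  csum (\sum_(i <- r | P i) F i) x = \sum_(i <- r | P i) csum (F i) x.
Proof.
elim/big_rec2: _ => [|i u v _ <-]; last by rewrite csumD.
by rewrite /csum big1 // => m _; rewrite ffunE.
Qed.

Lemma csum_lift a x : csum a x = gr_lift (fun g => #|[set m | x ^ m == g]|%g%:R : int) a.
Proof.
rewrite /csum /gr_lift (partition_big (fun m => x ^ m)%g xpredT) //=.
apply: eq_bigr => g _.
rewrite (eq_bigr (fun=> a g)) => [|m /eqP -> //].
rewrite sumr_const -mulrzl intz mulr_natr; congr (_ *+ _).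
by apply: eq_card => m; rewrite !inE.
Qed.

(** A class function is constant on classes, and the sum of the coefficients of [a] over
    the class of [x] is a divisor of [csum a x]. *)
Lemma gr_lift_class0 (V : zmodType) (f : gT -> V) a :
    (forall x y, f (x ^ y)%g = f x) -> (forall x, csum a x = 0) ->
  gr_lift f a = 0.
Proof.
move=> fJ a0; rewrite /gr_lift (partition_big (fun g => g ^: [set: gT])%g xpredT) //=.
apply: big1 => C _.
have [g0 /eqP Cg0|noC] := pickP (fun g => g ^: [set: gT] == C)%g; last first.
  by rewrite big_pred0.
have cl g : (g ^: [set: gT] == C)%g = (g \in g0 ^: [set: gT])%g.
  by rewrite -Cg0 eq_sym; apply/eqP/idP=> [->|/class_eqP -> //]; apply: class_refl.
rewrite (eq_bigl _ _ cl).
rewrite (eq_bigr (fun g => f g0 *~ a g)) => [|g /imsetP[y _ ->]]; last first.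
  by rewrite fJ.
rewrite -mulrz_sumr; suff -> : \sum_(g in (g0 ^: [set: gT])%g) a g = 0 by rewrite mulr0z.
have := a0 g0; rewrite csum_lift /gr_lift (bigID [in (g0 ^: [set: gT])%g]) /=.
rewrite [X in _ + X]big1 ?addr0 => [|g]; last first.
  move=> /negP gC; rewrite (_ : [set m | _] = set0) ?cards0 ?mul0rz //.
  apply/setP=> m; rewrite !inE; apply/negP=> /eqP xm; case: gC.
  by rewrite -xm memJ_class ?inE.
rewrite (eq_bigr (fun g => a g *+ #|[set m | (g0 ^ m)%g == g0]|)); last first.
  move=> _ /imsetP[y _ ->]; rewrite -mulrzl intz mulr_natr; congr (_ *+ _).
  rewrite -(card_imset (mem [set m | (g0 ^ m)%g == g0]) (mulIg y)).
  apply: eq_card => m; rewrite !inE; apply/idP/imsetP=> [/eqP gm|[m']].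
    by exists (m * y^-1)%g; rewrite ?mulgKV // inE conjgM gm conjgK.
  by rewrite inE => /eqP gm -> ; rewrite conjgM gm.
rewrite sumrMnl => /eqP; rewrite mulrn_eq0 cards_eq0 => /orP[/eqP/setP/(_ 1%g)|].
  by rewrite !inE conjg1 eqxx.
by move/eqP.
Qed.

(** The columns are indexed by the arguments of [f], so composition becomes the product of
    matrices in the same order. *)
Definition fun_mx (R : pzSemiRingType) (T : finType) (f : T -> T) : 'M[R]_#|T| :=
  \matrix_(i, j) (enum_val i == f (enum_val j))%:R.

Lemma fun_mx_id (R : pzSemiRingType) (T : finType) : fun_mx R (@id T) = 1%:M.
Proof. by apply/matrixP=> i j; rewrite !mxE (inj_eq enum_val_inj). Qed.

Lemma fun_mx_comp (R : pzSemiRingType) (T : finType) (f f' : T -> T) :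
  fun_mx R (f \o f') = fun_mx R f *m fun_mx R f'.
Proof.
apply/matrixP=> i j; rewrite !mxE (bigD1 (enum_rank (f' (enum_val j)))) //=.
rewrite !mxE !enum_rankK eqxx mulr1 big1 ?addr0 // => k.
rewrite -(inj_eq enum_val_inj) enum_rankK mxE mxE => /negPf ->.
by rewrite mulr0.
Qed.

Lemma eq_fun_mx (R : pzSemiRingType) (T : finType) (f f' : T -> T) :
  f =1 f' -> fun_mx R f = fun_mx R f'.
Proof. by move=> ff'; apply/matrixP=> i j; rewrite !mxE ff'. Qed.

Lemma trace_fun_mx (R : pzSemiRingType) (T : finType) (f : T -> T) :
  \tr (fun_mx R f) = #|[set t | f t == t]|%:R.
Proof.
rewrite /mxtrace (reindex enum_rank) /=; last first.
  by apply: onW_bij; apply: enum_rank_bij.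
rewrite (eq_bigr (fun t => (f t == t)%:R)) => [|t _]; last first.
  by rewrite mxE enum_rankK eq_sym.
rewrite -natr_sum -sum1_card [in RHS]big_mkcond; congr _%:R.
by apply: eq_bigr => t _; rewrite inE; case: (_ == _).
Qed.

(** The two regular representations: left multiplication by [a] and right multiplication
    by [x^-1], on the basis of group elements. *)
Definition lmx (R : pzRingType) a : 'M[R]_#|gT| :=
  gr_lift (fun g => fun_mx R (mulg g)) a.

Definition rmx (R : pzRingType) x : 'M[R]_#|gT| :=
  fun_mx R (fun m => m * x^-1)%g.

Lemma lmxM (R : pzRingType) a b : lmx R (a * b) = lmx R a *m lmx R b.
Proof.
apply: gr_liftM => g h; rewrite -[RHS]/(_ *m _) -fun_mx_comp.
by apply: eq_fun_mx => m /=; rewrite mulgA.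
Qed.

Lemma lmx1 (R : pzRingType) : lmx R 1 = 1%:M.
Proof.
apply: gr_lift1; rewrite -[RHS]/(1%:M) -fun_mx_id.
by apply: eq_fun_mx => m /=; rewrite mul1g.
Qed.

Lemma lmxX (R : pzRingType) a n : lmx R (a ^+ n) = lmx R a ^+ n.
Proof. by elim: n => [|n IHn]; rewrite ?lmx1 // !exprS lmxM IHn. Qed.

Lemma mulmzE (V : zmodType) m n (M : 'M[V]_(m, n)) (k : int) i j :
  (M *~ k) i j = M i j *~ k.
Proof.
case: k => k; first by rewrite -!pmulrn mulmxnE.
by rewrite NegzE !mulrNz -!pmulrn mxE mulmxnE.
Qed.

Lemma lmxE (R : pzRingType) a i j :
  lmx R a i j = (a (enum_val i * (enum_val j)^-1)%g)%:~R.
Proof.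
pose c := (enum_val i * (enum_val j)^-1)%g.
rewrite /lmx /gr_lift summxE (bigD1 c) //= big1 ?addr0.
  by rewrite mulmzE mxE /c mulgKV eqxx.
move=> g gc.
rewrite mulmzE mxE (_ : _ == _ = false) ?mul0rz //; apply/eqP=> ij; case/eqP: gc.
by rewrite /c ij mulgK.
Qed.

Lemma rmxM (R : pzRingType) x y : rmx R (x * y)%g = rmx R x *m rmx R y.
Proof.
rewrite -fun_mx_comp; apply: eq_fun_mx => m /=.
by rewrite invMg mulgA.
Qed.

Lemma rmx1 (R : pzRingType) : rmx R 1%g = 1%:M.
Proof. by rewrite -fun_mx_id; apply: eq_fun_mx => m /=; rewrite invg1 mulg1. Qed.

Lemma rmxX (R : pzRingType) x n : rmx R (x ^+ n)%g = rmx R x ^+ n.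
Proof. by elim: n => [|n IHn]; rewrite ?rmx1 // expgS exprS rmxM IHn. Qed.

Lemma lrmxC (R : pzRingType) a x : lmx R a *m rmx R x = rmx R x *m lmx R a.
Proof.
rewrite mulmx_suml mulmx_sumr; apply: eq_bigr => g _.
rewrite -[LHS]/(_ * _) -[RHS]/(_ * _) mulrzAl mulrzAr; congr (_ *~ _).
by rewrite -[LHS]/(_ *m _) -[RHS]/(_ *m _) -!fun_mx_comp; apply: eq_fun_mx => m /=;
   rewrite mulgA.
Qed.

Lemma trace_lrmx a x : \tr (lmx int a *m rmx int x) = csum a x.
Proof.
rewrite /lmx csum_lift mulmx_suml raddf_sum; apply: eq_bigr => g _ /=.
rewrite -[_ *m _]/(_ * _) mulrzAl raddfMz -[_ * _]/(_ *m _) -fun_mx_comp.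
rewrite /= trace_fun_mx; congr (_%:R *~ _).
rewrite -[RHS](card_imset _ invg_inj).
apply: eq_card => m; rewrite !inE /=.
rewrite (can2_imset_pre _ invgK invgK) !inE conjgE invgK.
apply/eqP/eqP=> [gm|<-]; last by rewrite !mulgA mulgKV mulgK.
by apply: (mulIg (m * x^-1)%g); rewrite gm !mulgA mulgKV mulgK.
Qed.

Lemma lrmxX (R : pzRingType) a x n :
  (lmx R a *m rmx R x) ^+ n = lmx R (a ^+ n) *m rmx R (x ^+ n)%g.
Proof.
by rewrite -[lmx R a *m _]/(_ * _) exprMn_comm ?lmxX ?rmxX //; apply: lrmxC.
Qed.

Lemma lmx_map (R : comPzRingType) a : lmx R a = map_mx intr (lmx int a).
Proof. by apply/matrixP=> i j; rewrite mxE !lmxE intz. Qed.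

Lemma rmx_map (R : comPzRingType) x : rmx R x = map_mx intr (rmx int x).
Proof. by apply/matrixP=> i j; rewrite !mxE rmorph_nat. Qed.

(** The two-sided action [m |-> a m x^-1] has integer matrices of finite order,
    so its trace is Galois invariant. *)
Lemma csum_coprime_pow a x n k :
    a ^+ n = 1 -> (x ^+ n = 1)%g -> (0 < n)%N -> coprime k n ->
  csum (a ^+ k) (x ^+ k)%g = csum a x.
Proof.
move=> an xn n0 co; rewrite -!trace_lrmx -lrmxX (trace_coprime_pow _ n0) //.
by rewrite lrmxX an xn lmx1 rmx1 mulmx1.
Qed.

(** The coefficient at the identity of a torsion unit is, up to the order of
    the group, a sum of that many roots of unity; if it does not vanish they
    are all equal. *)
Theorem berman_higman a n :
  a ^+ n = 1 -> (0 < n)%N -> aug a = 1 -> a != 1 -> a 1%g = 0.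
Proof.
move=> an n0 auga; apply: contraNeq => a1.
have [z zP] := C_prim_root_exists n0.
have An : lmx algC a ^+ n = 1 by rewrite -lmxX an lmx1.
have [P [D [Pu AE Dn]]] := finite_order_diag zP An.
have nD k : `|D 0 k| = 1.
  apply/eqP; rewrite -(@pexpr_eq1 _ _ n) ?normr_ge0 // -normrX Dn normr1.
  by [].
have trA : \tr (lmx algC a) = \sum_k D 0 k.
  by rewrite AE mxtrace_mulC mulmxA mulmxV // mul1mx mxtrace_diag.
have trE : \tr (lmx algC a) = (a 1%g *+ #|gT|)%:~R.
  rewrite -csum1 -trace_lrmx rmx1 mulmx1 lmx_map.
  by rewrite trace_map_mx.
have [|k _|t _ Dt] := @normC_sum_eq1 _ _ xpredT (fun k => D 0 k).
- apply/eqP; rewrite eq_le ler_norm_sum /= -trA trE.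
  rewrite (eq_bigr _ (fun k _ => nD k)) sumr_const card_ord.
  rewrite rmorphMn normrMn lerMn2r -intr_norm ler1z; apply/orP; right.
  by rewrite -gtz0_ge1 normr_gt0.
- exact: nD.
have At : lmx algC a = t%:M.
  rewrite AE (_ : D = const_mx t) ?diag_const_mx.
    by rewrite -mulmxA mul_scalar_mx -scalemxAr mulVmx // scalemx1.
  by apply/rowP=> k; rewrite mxE Dt.
have a0 g : g != 1%g -> a g = 0.
  move=> g1; have := congr1 (fun M : 'M_ _ => M (enum_rank g) (enum_rank 1%g)) At.
  rewrite lmxE !enum_rankK invg1 mulg1 mxE (inj_eq enum_rank_inj) (negPf g1).
  by move/eqP; rewrite intr_eq0 => /eqP.
have a11 : a 1%g = 1.
  rewrite -auga /aug (bigD1 1%g) //= big1 ?addr0 //.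
apply/eqP/ffunP=> g; rewrite ffunE; case: eqP => [->|/eqP/a0 //].
by rewrite a11.
Qed.

End Lift.

(** * Partial augmentations at elements whose order has a new prime divisor *)

Section CyclicWords.

Local Open Scope ring_scope.

(** Orbits of a permutation of order a power of [l] have [l]-power lengths, so
    the orbits of length at least [l ^ b.+1] contribute multiples of it. *)
Lemma perm_invariant_sum_dvd (T : finType) (s : {perm T}) (W : T -> int)
    (l k b : nat) :
    prime l -> (s ^+ (l ^ k) = 1)%g -> (forall t, W (s t) = W t) ->
    (forall t, (s ^+ (l ^ b))%g t = t -> W t = 0) ->
  ((l ^ b.+1)%:Z %| \sum_t W t)%Z.
Proof.
move=> l_pr sk Ws W0; rewrite (partition_big (porbit s) xpredT) //=.
apply: rpred_sum => C _.
have [t0 /eqP Ct0|noC] := pickP (fun t => porbit s t == C); last first.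
  by rewrite big_pred0 // dvdz0.
have Wt t : t \in porbit s t0 -> W t = W t0.
  case/porbitP=> i ->; elim: i => [|i IHi]; first by rewrite expg0 perm1.
  by rewrite expgSr permM Ws.
rewrite (eq_bigl (mem (porbit s t0))) => [|t]; last first.
  by rewrite -Ct0 eq_porbit_mem.
rewrite (eq_bigr _ Wt) sumr_const.
have dvl : (#|porbit s t0| %| l ^ k)%N.
  rewrite porbitE (dvdn_trans (dvdn_orbit _ _ _)) // -orderE.
  by rewrite order_dvdn sk.
case/(dvdn_pfactor _ _ l_pr): dvl => i _ ci.
have [leib|ltbi] := leqP i b.
  rewrite (W0 t0) ?mul0rn ?dvdz0 //.
  rewrite permX -(subnK leib) expnD -ci iterM.
  by elim: (l ^ _)%N => //= m ->; apply: iter_porbit.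
rewrite ci -(subnK ltbi) expnD -mulr_natr natrM mulrA !natz.
by rewrite dvdz_mull.
Qed.

Section Words.

Variable gT : finGroupType.
Implicit Types (a : integral_group_ring gT) (s : seq gT).

Lemma sum_tupleS (V : nmodType) n (F : seq gT -> V) :
  \sum_(t : n.+1.-tuple gT) F t = \sum_x \sum_(t : n.-tuple gT) F (x :: t).
Proof.
rewrite pair_bigA (reindex (fun p : gT * n.-tuple gT => [tuple of p.1 :: p.2])).
  by [].
exists (fun t => (thead t, [tuple of behead t])) => [[x t] _|t _] /=.
  by rewrite theadE; congr (_, _); apply: val_inj.
by rewrite [RHS]tuple_eta; apply: val_inj.
Qed.

Lemma gr_lift_pow (f : gT -> int) a n :
  gr_lift f (a ^+ n) =
    \sum_(t : n.-tuple gT) (\prod_(x <- t) a x) * f (\prod_(x <- t) x)%g.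
Proof.
elim: n f => [|n IHn] f.
  rewrite expr0 -gr_of1 gr_lift_of (big_pred1 [tuple]) /= => [|t].
    by rewrite !big_nil mul1r.
  by rewrite /= tuple0; apply/esym/eqP.
rewrite exprS (sum_tupleS n (fun s => (\prod_(x <- s) a x) * f (\prod_(x <- s) x)%g)).
transitivity (\sum_h \sum_g f g *~ (a h * (a ^+ n) (h^-1 * g)%g)).
  rewrite exchange_big; apply: eq_bigr => g _.
  by rewrite ffunE mulrz_sumr.
apply: eq_bigr => h _; rewrite (reindex_inj (mulgI h)).
transitivity (a h * gr_lift (fun g => f (h * g)%g) (a ^+ n)).
  rewrite mulr_sumr; apply: eq_bigr => g _.
  by rewrite mulKg !mulrzz mulrCA.
rewrite IHn mulr_sumr; apply: eq_bigr => t _.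
by rewrite !big_cons mulrA.
Qed.

Lemma prod_cat_comm s r d m :
    size s = (d * m)%N -> size r = d -> s ++ r = r ++ s ->
  (\prod_(x <- s) x = (\prod_(x <- r) x) ^+ m)%g.
Proof.
elim: m s => [|m IHm] s szs szr sr.
  by move: szs; rewrite muln0 => /size0nil ->; rewrite big_nil.
have leds : (d <= size s)%N by rewrite szs mulnS leq_addr.
have rE : take d s = r.
  by have /(congr1 (take d)) := sr; rewrite takel_cat // take_size_cat.
rewrite -(cat_take_drop d s) rE in sr *.
rewrite big_cat /= expgS; congr (_ * _)%g; apply: IHm => //.
  by rewrite size_drop szs mulnS addKn.
by move/eqP: sr; rewrite -catA eqseq_cat // => /andP[_ /eqP].
Qed.

Lemma prod_rot_period s d m :
    size s = (d * m)%N -> seq.rot d s = s ->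
  exists z, (\prod_(x <- s) x = z ^+ m)%g.
Proof.
case: m => [|m] szs rs.
  exists 1%g; move: szs; rewrite muln0 => /size0nil ->.
  by rewrite big_nil.
exists (\prod_(x <- take d s) x)%g.
rewrite -{1}(cat_take_drop d s) big_cat /= expgS; congr (_ * _)%g.
have szt : size (take d s) = d.
  by rewrite size_takel // szs mulnS leq_addr.
apply: prod_cat_comm szt _; first by rewrite size_drop szs mulnS addKn.
by rewrite cat_take_drop.
Qed.

(** The words of length [l ^ k] are permuted by rotation, with invariant weights;
    a word of period dividing [l ^ b] has a product which is an
    [l ^ (k - b)]-th power. *)
Lemma class_fun_pow_dvd (f : gT -> int) a l k e :
    prime l -> (e <= k)%N -> (forall x y, f (x ^ y)%g = f x) ->
    (forall z, f (z ^+ (l ^ e))%g = 0) ->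
  ((l ^ (k - e).+1)%:Z %| gr_lift f (a ^+ (l ^ k)))%Z.
Proof.
move=> l_pr leek fJ f0; rewrite gr_lift_pow.
set n := (l ^ k)%N.
have injr : injective (fun t : n.-tuple gT => [tuple of seq.rot 1 t]).
  by move=> t1 t2 /(congr1 val) /= /rot_inj tt; apply: val_inj.
pose s := perm injr.
have sX i t : (i <= n)%N -> val ((s ^+ i)%g t) = seq.rot i t.
  elim: i => [|i IHi] lein; first by rewrite expg0 perm1 rot0.
  rewrite expgSr permM permE /= IHi 1?ltnW // -rotD ?add1n //.
  by rewrite size_tuple.
apply: (@perm_invariant_sum_dvd _ s _ l k) => // [|t|t].
- apply/permP=> t; rewrite perm1; apply: val_inj; rewrite sX //.
  by rewrite rot_oversize // size_tuple.
- rewrite permE /=; congr (_ * _).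
    by apply: perm_big; rewrite perm_rot.
  case: (tval t) => [|x r] //; rewrite rot1_cons big_cons -cats1 big_cat big_seq1 /=.
  by rewrite -[in RHS](fJ _ x) conjgE mulgA mulKg.
move=> /(congr1 val); rewrite sX => [rt|]; last first.
  by rewrite leq_pexp2l ?prime_gt0 ?leq_subr.
have [|z ->] := @prod_rot_period t (l ^ (k - e)) (l ^ e) _ rt.
  by rewrite size_tuple -expnD subnK.
by rewrite f0 mulr0.
Qed.

(** A torsion unit of order prime to [l] is one of its own [l ^ k]-th powers for
    arbitrarily large [k], so its partial augmentations at [l]-singular classes
    are divisible by arbitrarily large powers of [l]. *)
Theorem csum_new_prime a n l x :
    a ^+ n = 1 -> (0 < n)%N -> prime l -> ~~ (l %| n)%N -> (l %| #[x]%g)%N ->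
  csum a x = 0.
Proof.
move=> an n0 l_pr lndvn ldvx; apply/eqP/negPn/negP=> c0.
(* The factor [totient n] of [k] ensures [a ^+ (l ^ k) = a]; the number [e] bounds the
   [l]-adic valuation of the order of an element, and [k - e] exceeds that of
   [csum a x]. *)
pose e := #|[set: gT]|; pose k := ((e + `|csum a x|) * totient n)%N.
have lek : (e + `|csum a x| <= k)%N by rewrite leq_pmulr ?totient_gt0.
have ak : a ^+ (l ^ k) = a.
  have co : coprime l n by rewrite prime_coprime.
  have : l ^ k = 1 %[mod n].
    rewrite /k mulnC expnM -modnXm (Euler_exp_totient co) modnXm exp1n.
    by [].
  have lk0 : (0 < l ^ k)%N by rewrite expn_gt0 prime_gt0.
  move/eqP; rewrite eqn_mod_dvd // => /dvdnP[q qE].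
  by rewrite -(subnK lk0) qE exprD mulnC exprM an expr1n mul1r expr1.
pose f g := #|[set m | (x ^ m)%g == g]|%:R : int.
have : ((l ^ (k - e).+1)%:Z %| gr_lift f (a ^+ (l ^ k)))%Z.
  apply: class_fun_pow_dvd => //; first by apply: leq_trans lek; apply: leq_addr.
    move=> y z; rewrite /f; congr _%:R.
    rewrite -(card_imset (mem [set m | (x ^ m)%g == y]) (mulIg z)).
    apply: eq_card => m; rewrite !inE; apply/idP/imsetP=> [/eqP xm|[m']].
      by exists (m * z^-1)%g; rewrite ?mulgKV // inE conjgM xm conjgK.
    by rewrite inE => /eqP xm ->; rewrite conjgM xm.
  move=> z; rewrite /f (_ : [set m | _] = set0) ?cards0 //.
  apply/setP=> m; rewrite !inE; apply/negP=> /eqP xm.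
  have : (#[x]%g %| #[z]%g`_l^')%N.
    rewrite -(orderJ _ m) xm order_dvdn -expgM -order_dvdn.
    rewrite -{1}(partnC l (order_gt0 z)) dvdn_mul // p_part dvdn_exp2l //.
    rewrite (leq_trans (ltnW (ltn_logl _ (order_gt0 z)))) // dvdn_leq ?cardG_gt0 //.
    by rewrite order_dvdG ?inE.
  move=> /(dvdn_trans ldvx) ldv.
  have := part_pnat l^' #[z]%g; rewrite p'natE // => /negP; apply.
  exact: ldv.
rewrite ak -csum_lift => /dvdn_leq; rewrite absz_gt0 c0 => /(_ isT).
rewrite absz_nat leqNgt => /negP; apply.
apply: leq_trans (ltn_expl _ (prime_gt1 l_pr)) _.
rewrite leq_pexp2l ?prime_gt0 // leqW //.
by rewrite leq_subRL ?(leq_trans (leq_addr _ _) lek).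
Qed.

End Words.

End CyclicWords.

(** * Partial augmentations at elements of too large prime power order *)

Section ConvexSequences.

Lemma convex_chord (f : nat -> nat) (i j k : nat) :
    (forall l, 2 * f l.+1 <= f l + f l.+2)%N -> (i <= j <= k)%N ->
  ((k - i) * f j <= (k - j) * f i + (j - i) * f k)%N.
Proof.
move=> cv /andP[leij lejk].
have slope a b : (f (a + b).+1 + f a >= f (a + b) + f a.+1)%N.
  elim: b => [|b IHb]; first by rewrite addn0 addnC.
  have := cv (a + b)%N; rewrite addnS; lia.
have lo a b : (b * f (a + b) + f (a + b) <= f a + b * f (a + b).+1)%N.
  elim: b => [|b IHb]; first by rewrite addn0; lia.
  have := slope a b; have := cv (a + b)%N; rewrite addnS in IHb *; nia.
have hi a b : (f a + b * f a.+1 <= f (a + b) + b * f a)%N.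
  elim: b => [|b IHb]; first by rewrite addn0; lia.
  by have := slope a b; rewrite addnS; lia.
have := lo i (j - i)%N; rewrite subnKC // => lo'.
have := hi j (k - j)%N; rewrite subnKC // => hi'.
have : (k - i = (k - j) + (j - i))%N by lia.
move: (k - j)%N (j - i)%N (f j.+1) lo' hi' => u v w lo' hi' ->; nia.
Qed.

(** The hypothesis at [p] says that the convex sequence, which vanishes at [p * h], is not
    below its chord there, so that it is linear; the conclusions are the consequences
    at [1] and at [p * h - 1]. *)
Lemma convex_linear (f : nat -> nat) (p h : nat) :
    (0 < p)%N -> (1 < h)%N -> (forall l, 2 * f l.+1 <= f l + f l.+2)%N ->
    f (p * h)%N = 0%N -> (h.-1 * f 0 <= h * f p)%N ->
  ((p * h).-1 * f 0 <= p * h * f 1)%N /\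
  (f 0 <= p * h * f (p * h).-1)%N.
Proof.
move=> p0 h1 cv fm fp; have ph : (p < p * h)%N by rewrite ltn_Pmulr.
have ph2 : (2 <= p * h)%N by lia.
have := @convex_chord f 1 p (p * h) cv; have := @convex_chord f 0 p (p * h).-1 cv.
rewrite fm muln0 !addn0 !subn0; set m := (p * h)%N in ph ph2 fm *.
have -> : (0 <= p <= m.-1)%N by lia.
have -> : (1 <= p <= m)%N by lia.
move=> /(_ isT) c1 /(_ isT) c2.
have hm : (m - p = p * h.-1)%N by rewrite /m; nia.
have fp' : ((m - p) * f 0 <= m * f p)%N by rewrite hm /m; nia.
split.
  have : ((m - p) * (m.-1 * f 0) <= (m - p) * (m * f 1))%N.
    apply: (@leq_trans (m.-1 * (m * f p))).
      by rewrite mulnCA leq_mul2l fp' orbT.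
    rewrite mulnCA [X in (_ <= X)%N]mulnCA leq_mul2l; apply/orP; right.
    by rewrite -subn1.
  by rewrite leq_pmul2l // subn_gt0.
have : (p * f 0 <= p * (m * f m.-1))%N.
  have e : (m.-1 * (m - p) = m * (m.-1 - p) + p)%N.
    by move: (m) ph2 ph => [//|k] _ lepk /=; rewrite subSn // mulnS; nia.
  have : (m.-1 * ((m - p) * f 0) <= m * ((m.-1 - p) * f 0 + p * f m.-1))%N.
    apply: (@leq_trans (m.-1 * (m * f p))).
      by rewrite leq_mul2l fp' orbT.
    by rewrite mulnCA leq_mul2l c1 orbT.
  rewrite mulnA e mulnDl mulnDr mulnA leq_add2l mulnCA.
  by [].
by rewrite leq_pmul2l.
Qed.

End ConvexSequences.

Section RankModP.

Local Open Scope ring_scope.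

(** A minor that does not vanish modulo [p] does not vanish. *)
Lemma rank_reduction (p m n : nat) (A : 'M[int]_(m, n)) : prime p ->
  (\rank (map_mx intr A : 'M['F_p]_(m, n)) <=
   \rank (map_mx intr A : 'M[rat]_(m, n)))%N.
Proof.
move=> p_pr; set Ap := map_mx _ _; set Aq := map_mx _ _.
suff sub k (f : 'I_k -> 'I_m) (g : 'I_k -> 'I_n) :
    \rank (rowsub g (rowsub f Ap)^T) = k -> (k <= \rank Aq)%N.
  pose f := maxrankfun Ap; pose g := maxrankfun (rowsub f Ap)^T.
  have rB : \rank (rowsub f Ap)^T = \rank Ap by rewrite mxrank_tr eq_maxrowsub.
  have rC : \rank (rowsub g (rowsub f Ap)^T) = \rank Ap by rewrite eq_maxrowsub.
  move: g rC; rewrite rB => g; exact: sub.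
pose C := rowsub g (rowsub f A)^T.
have -> : rowsub g (rowsub f Ap)^T = map_mx intr C.
  by apply/matrixP=> i j; rewrite !mxE.
move=> rC.
have Cu : map_mx intr C \in (@unitmx 'F_p k) by rewrite -row_free_unit /row_free rC.
have detC : \det C != 0.
  apply/eqP=> d0; move: Cu; rewrite unitmxE det_map_mx d0 rmorph0.
  by rewrite unitr0.
have <- : \rank (map_mx intr C : 'M[rat]_k) = k.
  apply: mxrank_unit; rewrite unitmxE det_map_mx unitfE intr_eq0.
  exact: detC.
have -> : map_mx intr C = rowsub g (rowsub f Aq)^T.
  by apply/matrixP=> i j; rewrite !mxE.
rewrite (leq_trans (mxrankS (rowsub_sub _ _))) // mxrank_tr.
by rewrite mxrankS // rowsub_sub.
Qed.

(** In characteristic [p], [X^(p^i) - 1] is [(X - 1)^(p^i)]; both identities are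
    specialisations of it. *)
Lemma unipotent_powers (p d j : nat) (A : 'M['F_p]_d) : prime p ->
  (A - 1) ^+ (p ^ j) = A ^+ (p ^ j) - 1 /\
  \sum_(i < p ^ j) A ^+ i = (A - 1) ^+ (p ^ j).-1.
Proof.
move=> p_pr; case: d A => [|d] A.
  by split; rewrite [LHS]flatmx0 [RHS]flatmx0.
have pchP : p \in [pchar {poly 'F_p}].
  by rewrite pchar_poly pchar_Fp.
have X1 : ('X - 1) ^+ (p ^ j) = 'X^(p ^ j) - 1 :> {poly 'F_p}.
  elim: j => [|j IHj]; first by rewrite expr1.
  by rewrite expnSr !exprM IHj -!(pFrobenius_autE pchP) pFrobenius_autB_comm
    ?pFrobenius_aut1 //; apply: mulrC.
split.
  have /(congr1 (horner_mx A)) := X1.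
  by rewrite !rmorphXn !rmorphB !rmorphXn /= horner_mx_X rmorph1.
have : \sum_(i < p ^ j) 'X^i = ('X - 1) ^+ (p ^ j).-1 :> {poly 'F_p}.
  apply: (@mulfI _ ('X - 1)); first by rewrite polyXsubC_eq0.
  rewrite -subrX1 -X1 -exprS prednK // expn_gt0 prime_gt0 //.
move/(congr1 (horner_mx A)); rewrite rmorph_sum rmorphXn rmorphB /=.
rewrite horner_mx_X rmorph1 => <-; apply: eq_bigr => i _.
by rewrite rmorphXn /= horner_mx_X.
Qed.

(** Vectors fixed by a translation are constant on the cosets of the subgroup it
    generates. *)
Lemma rank_translation (F : fieldType) (gT : finGroupType) (c : gT) :
  (#[c]%g.-1 * #|gT| <= #[c]%g * \rank (rmx F c - 1%:M)%R)%N.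
Proof.
set B := _ - _; pose K := kermx B; pose H := <[c]>%g.
have KE : K *m rmx F c = K.
  have : K *m B = 0 by apply: mulmx_ker.
  by rewrite mulmxBr mulmx1 => /eqP; rewrite subr_eq0 => /eqP.
have rKB : \rank K = (#|gT| - \rank B)%N by rewrite mxrank_ker.
clearbody K.
have Kc i x : K i (enum_rank (x * c^-1)%g) = K i (enum_rank x).
  rewrite -[in RHS]KE mxE.
  rewrite (bigD1 (enum_rank (x * c^-1)%g)) //=. rewrite [rmx F c _ _]mxE !enum_rankK eqxx mulr1.
  rewrite big1 ?addr0 // => k; rewrite -(inj_eq enum_val_inj) enum_rankK.
  by rewrite [rmx F c _ _]mxE enum_rankK => /negPf ->; rewrite mulr0.
have KH i (x h : gT) : h \in H -> K i (enum_rank (x * h)%g) = K i (enum_rank x).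
  case/cycleP=> k ->; elim: k => [|k IHk]; first by rewrite expg0 mulg1.
  by rewrite -IHk -[LHS]Kc expgSr mulgA mulgK.
pose L := lcosets H [set: gT].
pose S := \matrix_(i < #|gT|, C < #|L|) K i (enum_rank (repr (enum_val C))).
pose Z := \matrix_(C < #|L|, j < #|gT|) ((enum_val j \in (enum_val C : {set gT}))%:R : F).
have KSZ : K = S *m Z.
  apply/matrixP=> i j; rewrite mxE; set x := enum_val j.
  have Lx : (x *: H)%g \in L by apply/lcosetsP; exists x; rewrite ?inE.
  rewrite (bigD1 (enum_rank_in Lx (x *: H)%g)) //= !mxE enum_rankK_in //.
  rewrite lcoset_refl mulr1 big1 ?addr0 => [|C].
    have /lcosetP[h Hh ->] : repr (x *: H)%g \in (x *: H)%g.
      by apply: mem_repr (lcoset_refl H x).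
    by rewrite KH // enum_valK.
  rewrite -(inj_eq enum_val_inj) enum_rankK_in // !mxE -/x => nC.
  case: (boolP (x \in _)) => [xC|_]; last by rewrite mulr0.
  case/eqP: nC; have /lcosetsP[y _ yE] := enum_valP C.
  by rewrite yE; apply/lcoset_eqP; rewrite lcoset_sym -yE.
have rK : (\rank K <= #|L|)%N.
  by rewrite KSZ (leq_trans (mxrankM_maxl _ _)) // rank_leq_col.
have Lc : (#|L| * #[c]%g = #|gT|)%N.
  by rewrite card_lcosets -cardsT mulnC Lagrange ?subsetT.
have := order_gt0 c; move: rK; rewrite rKB leq_subLR; move: (\rank B) => r.
move=> le_r; have: (#[c]%g * #|gT| <= #[c]%g * (r + #|L|))%N by rewrite leq_mul2l le_r orbT.
rewrite mulnDr [(_ * #|L|)%N]mulnC Lc => {}le_r o_gt0.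
by rewrite -(leq_add2r #|gT|) -mulSnr prednK.
Qed.

Lemma trace_quasi_idem (d c : nat) (A : 'M[int]_d) :
    A *m A = A *+ c -> (0 < c)%N ->
  \tr A = (c * \rank (map_mx intr A : 'M[rat]_d))%:Z.
Proof.
move=> AA c0; have := @trace_idem_scale rat d c (map_mx intr A).
rewrite -map_mxM AA raddfMn trace_map_mx => /(_ erefl c0) trE.
by apply/eqP; rewrite -(eqr_int rat) trE.
Qed.

End RankModP.

Section LargeOrder.

Local Open Scope ring_scope.

(** Let [b] be the [p]-part of a torsion unit and [d] its [p']-part, and let [x] be
    a [p]-element of order greater than that of [b]. The map [T : m |-> b m x^-1]
    has order [m = p ^ j] and its [p]-th power is the translation by [x^-p], whose Jordan
    blocks modulo [p] all have the maximal size. By convexity of the ranks of the powers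
    of [T - 1] so have those of [T], and of its restriction to the image of an idempotent
    commuting with [T], here [1 + d + ... ] up to a scalar. The rank of
    [1 + T + ... ] on this image over the rationals is squeezed between ranks modulo [p],
    and is [1 / m] times the dimension. Hence the traces of the powers of [T], other than
    [1], add up to zero; those of the powers with exponent divisible by [p] vanish and
    the others are equal. *)
Theorem csum_large_order (gT : finGroupType) (b d : integral_group_ring gT)
    (x : gT) (p s j : nat) :
    prime p -> coprime s p -> (0 < s)%N -> b ^+ p = 1 -> d ^+ s = 1 ->
    b * d = d * b -> #[x]%g = (p ^ j)%N -> (1 < j)%N ->
  \sum_(k < s) csum (b * d ^+ k) x = 0.
Proof.
move=> p_pr co_sp s0 bp ds bd ox j1.
pose h := (p ^ j.-1)%N; pose m := (p * h)%N; pose n := #|gT|.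
have mE : m = (p ^ j)%N by rewrite /m /h -expnS prednK // ltnW.
have p0 := prime_gt0 p_pr; have h1 : (1 < h)%N.
  by rewrite -(exp1n j.-1) ltn_exp2r ?prime_gt1 // -subn1 subn_gt0.
have m0 : (0 < m)%N by rewrite muln_gt0 p0 ltnW.
pose phi : integral_group_ring gT := \sum_(k < s) d ^+ k.
have phi2 : phi * phi = phi *+ s by apply: sum_powers_idem.
have bphi : b * phi = phi * b.
  rewrite mulr_sumr mulr_suml; apply: eq_bigr => k _.
  exact: (commrX _ bd).
pose T := lmx int b *m rmx int x; pose F := lmx int phi.
pose N := \sum_(k < m) T ^+ k.
have Tk k : T ^+ k = lmx int (b ^+ k) *m rmx int (x ^+ k)%g by exact: lrmxX.
have Tm : T ^+ m = 1.
  rewrite Tk {1}/m exprM bp expr1n lmx1 mul1mx mE -ox expg_order.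
  by rewrite rmx1.
have TF : T * F = F * T.
  rewrite -[LHS]/(_ *m _) -[RHS]/(_ *m _) /T /F -mulmxA -lrmxC !mulmxA -!lmxM.
  by rewrite bphi.
have lmxMn k (a : integral_group_ring gT) : lmx int (a *+ k) = lmx int a *+ k.
  by apply/matrixP=> i l; rewrite mulmxnE !lmxE !intz ffunMnE.
have FF : F * F = F *+ s.
  by rewrite -[LHS]/(_ *m _) /F -lmxM phi2 lmxMn.
have NT : N * T = N.
  rewrite /N mulr_suml; case: (m) m0 Tm => // m' _ Tm'.
  rewrite big_ord_recr [RHS]big_ord_recl /= -exprSr Tm' expr0 addrC; congr (_ + _).
  by apply: eq_bigr => k _; rewrite -exprSr.
have NN : N * N = N *+ m by apply: sum_powers_idem.
have NF : N * F = F * N.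
  rewrite /N mulr_suml mulr_sumr; apply: eq_bigr => k _.
  exact: (esym (commrX _ (esym TF))).
have NFNF : (N * F) * (N * F) = (N * F) *+ (m * s).
  transitivity (N * N * (F * F)).
    by rewrite -!mulrA; congr (_ * _); rewrite !mulrA -NF.
  by rewrite NN FF mulrnAl mulrnAr mulrnAC -mulrnA.
(* over the rationals, ranks are traces *)
pose Q A := \rank (map_mx intr A : 'M[rat]_n).
have trNF : \tr (N * F) = (m * s * Q (N * F))%:Z.
  by apply: trace_quasi_idem => //; rewrite muln_gt0 m0.
have trF : \tr F = (s * Q F)%:Z by apply: trace_quasi_idem.
pose F' : 'M[int]_n := s%:R - F.
have F'F' : F' * F' = F' *+ s.
  by rewrite /F' mulrBl !mulrBr FF !mulr_natr !mulr_natl subrr subr0 mulrnBl.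
have trF' : \tr F' = (s * Q F')%:Z by apply: trace_quasi_idem.
have QFF' : (Q F + Q F' = n)%N.
  have := congr1 (fun A : 'M[int]_n => \tr A) (subrK F s%:R).
  rewrite /= -/F' mxtraceD trF trF' => /eqP.
  have -> : \tr (s%:R : 'M[int]_n) = (s * n)%:Z.
    by rewrite -[s%:R]/(1%:M *+ s) raddfMn /= mxtrace1 -mulrnA mulnC natz.
  rewrite -PoszD eqz_nat -mulnDr eqn_pmul2l // addnC.
  by move/eqP.
suff NFF : (m * Q (N * F)%R = Q F)%N.
  pose Y k := csum (b ^+ k * phi) (x ^+ k)%g.
  have YE k : \tr (T ^+ k * F) = Y k.
    rewrite Tk -[_ * F]/(_ *m _) -mulmxA -lrmxC mulmxA -lmxM.
    by rewrite trace_lrmx.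
  have sumY : \sum_(k < m) Y k = Y 0%N.
    rewrite -YE expr0 mul1r trF -NFF mulnCA mulnA -trNF /N mulr_suml raddf_sum.
    by apply: eq_bigr => k _ /=; rewrite -YE.
  have Yp k : (p %| k)%N -> (0 < k < m)%N -> Y k = 0.
    move=> pk /andP[k0 km]; rewrite /Y; case/dvdnP: (pk) => i kE.
    rewrite {1}kE mulnC exprM bp expr1n mul1r /phi csum_sum big1 // => l _.
    apply: (@csum_new_prime _ _ s p) => //.
    - by rewrite exprAC ds expr1n.
    - by rewrite -prime_coprime // coprime_sym.
    have : (#[x ^+ k]%g %| p ^ j)%N by rewrite -ox orderXdvd.
    case/(dvdn_pfactor _ _ p_pr) => [[|l'] _ oE]; last by rewrite oE expnS dvdn_mulr.
      move/eqP: oE; rewrite expn0 order_eq1 -order_dvdn ox -mE => /dvdn_leq.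
      by rewrite k0 leqNgt km => /(_ isT).
  have Yp' k : ~~ (p %| k)%N -> Y k = Y 1%N.
    move=> pk; rewrite /Y !expr1 /phi !mulr_sumr !csum_sum expg1.
    apply: eq_bigr => l _.
    have co_ms : coprime m s by rewrite mE coprimeXl // coprime_sym.
    pose k' := chinese m s k 1.
    have k'm : k' = k %[mod m] by rewrite chinese_modl.
    have k's : k' = 1 %[mod s] by rewrite chinese_modr.
    have bm : b ^+ m = 1 by rewrite exprM bp expr1n.
    have xm : (x ^+ m = 1)%g by rewrite mE -ox expg_order.
    have dl : (d ^+ l) ^+ s = 1 by rewrite exprAC ds expr1n.
    have cbd : GRing.comm b (d ^+ l) := commrX _ bd.
    have co : coprime k' (m * s).
      rewrite coprimeMr -coprime_modl k'm coprime_modl -[X in _ && X]coprime_modl.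
      rewrite k's coprime_modl coprime1n andbT mE coprimeXr //.
      by rewrite coprime_sym prime_coprime.
    rewrite -(@csum_coprime_pow _ (b * d ^+ l) x (m * s) k') //.
    - rewrite exprMn_comm // -(expr_mod k' bm) k'm (expr_mod _ bm).
      rewrite -(expr_mod k' dl) k's (expr_mod _ dl) expr1.
      by rewrite -(expg_mod k' xm) k'm (expg_mod _ xm).
    - by rewrite exprMn_comm // exprM bm expr1n mul1r mulnC exprM dl expr1n.
    - by rewrite expgM xm expg1n.
    - by rewrite muln_gt0 m0.
  have Y1 : Y 1%N = \sum_(k < s) csum (b * d ^+ k) x.
    by rewrite /Y expr1 expg1 /phi mulr_sumr csum_sum.
  rewrite -Y1; apply/eqP.
  have : \sum_(1 <= k < m) Y k = 0.
    by apply: (addrI (Y 0%N)); rewrite addr0 -big_ltn // big_mkord.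
  rewrite (bigID (dvdn p)) /= big_nat_cond big1 ?add0r => [|k]; last first.
    by case/andP=> /andP[k0 km] /Yp -> //; rewrite k0.
  rewrite (eq_bigr _ Yp') big_const_seq iter_addr_0; set c := count _ _ => /eqP.
  rewrite mulrn_eq0 => /orP[|//]; rewrite -leqn0 leqNgt => /negP[].
  rewrite -has_count; apply/hasP; exists 1%N; last by rewrite dvdn1 neq_ltn prime_gt1 ?orbT.
  by rewrite mem_index_iota /= /m; lia.
(* modulo p, the powers of T - 1 have convex ranks on the two summands *)
pose P (A : 'M[int]_n) : 'M['F_p]_n := map_mx intr A.
have PM A B : P (A * B) = P A * P B by rewrite /P map_mxM.
have PB A B : P (A - B) = P A - P B by rewrite /P map_mxB.
have P1 : P 1 = 1 by rewrite /P map_mx1.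
have PX A k : P (A ^+ k) = P A ^+ k.
  by elim: k => [|k IHk]; rewrite ?expr0 // !exprS PM IHk.
have Ps : P s%:R = s%:R.
  by rewrite /P -[s%:R in LHS]/(1%:M *+ s) raddfMn /= map_mx1.
pose t := P T - 1.
have [tpj tN] := unipotent_powers j (P T) p_pr.
have [tp _] := unipotent_powers 1 (P T) p_pr.
rewrite expn1 -mE -/t in tpj tN tp.
have tm : t ^+ m = 0 by rewrite tpj -PX Tm P1 subrr.
have rank_tp : (h.-1 * n <= h * \rank (t ^+ p)%R)%N.
  have ox' : #[x ^+ p]%g = h by rewrite orderXdiv ox -mE ?mulKn ?dvdn_mulr.
  rewrite tp -PX Tk bp lmx1 mul1mx -{1 2}ox' /P -rmx_map.
  exact: rank_translation.
pose f (E : 'M['F_p]_n) i := \rank (t ^+ i * E)%R.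
have cv (E : 'M['F_p]_n) l : t * E = E * t -> (2 * f E l.+1 <= f E l + f E l.+2)%N.
  move=> tE; rewrite mul2n -addnn /f.
  have e1 : t *m (t ^+ l * E) = t ^+ l.+1 * E by rewrite exprS -mulrA.
  have e2 i : (t ^+ i * E) *m t = t ^+ i.+1 * E.
    by rewrite exprSr -mulrA tE mulrA.
  by have := mxrank_Frobenius t (t ^+ l * E)%R t; rewrite e1 !e2.
have tF : t * P F = P F * t by rewrite /t mulrBl mulrBr mul1r mulr1 -!PM TF.
have PF' : P F' = s%:R - P F by rewrite /F' PB Ps.
have tF' : t * P F' = P F' * t.
  by rewrite PF' [LHS]mulrBr [RHS]mulrBl tF mulr_natl mulr_natr.
have fm E : f E m = 0%N by rewrite /f tm mul0r mxrank0.
have s_unit (A : 'M['F_p]_n) : \rank (A * s%:R)%R = \rank A.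
  rewrite mulr_natr -scaler_nat mxrank_scale_nz //.
  by rewrite -(dvdn_pcharf (pchar_Fp p_pr)) -prime_coprime // coprime_sym.
have split A : (\rank A <= \rank (A * P F)%R + \rank (A * P F')%R)%N.
  have sE : P F + P F' = s%:R by rewrite PF' addrC subrK.
  by rewrite -(s_unit A) -sE mulrDr; apply: mxrank_add.
have f0 : (f (P F) 0 + f (P F') 0 >= n)%N.
  by rewrite /f expr0 !mul1r; have := split 1; rewrite !mul1r mxrank1.
have fp : (f (P F) p + f (P F') p >= \rank (t ^+ p)%R)%N by apply: split.
have QF : (f (P F) 0 <= Q F)%N by rewrite /f expr0 mul1r; apply: rank_reduction.
have QF' : (f (P F') 0 <= Q F')%N by rewrite /f expr0 mul1r; apply: rank_reduction.
have QNF : (f (P F) m.-1 <= Q (N * F)%R)%N.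
  rewrite /f -tN (_ : \sum_(i < m) _ = P N) -?PM; first exact: rank_reduction.
  by rewrite /P /N raddf_sum; apply: eq_bigr => k _; rewrite -[LHS]PX.
have QTF : (f (P F) 1 <= Q ((T - 1) * F)%R)%N.
  by rewrite /f expr1 /t -{1}P1 -PB -PM; apply: rank_reduction.
have QNT : (Q ((T - 1) * F)%R + Q (N * F)%R <= Q F)%N.
  have := mxrank_Frobenius (map_mx intr (T - 1) : 'M[rat]_n) (map_mx intr F) (map_mx intr N).
  rewrite -!map_mxM -![_ *m _]/(_ * _) -NF -mulrA -NF mulrA.
  rewrite (_ : (T - 1) * N = 0) ?mul0r ?map_mx0 ?mxrank0 ?addn0 //.
  have TN : T * N = N * T.
    by rewrite /N mulr_sumr mulr_suml; apply: eq_bigr => k _; rewrite -exprS exprSr.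
  by rewrite mulrBl mul1r TN NT subrr.
have f'p : (h * f (P F') p <= h.-1 * f (P F') 0)%N.
  have := @convex_chord (f (P F')) 0 p m (fun l => cv _ l tF').
  rewrite fm muln0 addn0 !subn0 leq0n leq_pmulr ?(ltnW h1) // => /(_ isT).
  have -> : (m - p = p * h.-1)%N by rewrite /m -{2}[p]muln1 -mulnBr subn1.
  by rewrite /m -!mulnA leq_pmul2l.
have [] := @convex_linear (f (P F)) p h p0 h1 (fun l => cv _ l tF) (fm _).
  by move: rank_tp fp f0 f'p QF QF' QFF'; nia.
rewrite -/m => lo hi; have qE : Q F = f (P F) 0.
  apply/eqP; rewrite eqn_leq QF andbT -(leq_add2r (Q F')) QFF'.
  by rewrite (leq_trans f0) // leq_add2l.
apply/eqP; rewrite eqn_leq qE; apply/andP; split; last first.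
  by rewrite (leq_trans hi) // leq_mul2l QNF orbT.
rewrite -(leq_add2l (m.-1 * f (P F) 0)) -mulSnr prednK //.
apply: leq_trans (leq_add lo (leqnn _)) _; rewrite -mulnDr leq_mul2l -qE.
by apply/orP; right; apply: leq_trans QNT; rewrite leq_add2r.
Qed.

End LargeOrder.

(** * Torsion units and normal subgroups *)

Lemma order_dvd_exists (gT : finGroupType) (x : gT) (d : nat) :
  (d %| #[x]%g)%N -> exists y : gT, #[y]%g = d.
Proof.
move=> dx; have x0 := order_gt0 x; have d0 := dvdn_gt0 x0 dx.
exists (x ^+ (#[x]%g %/ d))%g.
by rewrite orderXdiv ?dvdn_div // divnA // mulKn.
Qed.

Lemma commute_order_pq (gT : finGroupType) (x y : gT) (p q : nat) :
    prime p -> prime q -> p != q -> commute x y -> #[x]%g = p -> #[y]%g = q ->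
  exists z : gT, #[z]%g = (p * q)%N.
Proof.
move=> pp pq npq cxy ox oy; exists (x * y)%g.
by rewrite orderM ?ox ?oy // prime_coprime // dvdn_prime2.
Qed.

Section Quotient.

Local Open Scope ring_scope.

Variable gT : finGroupType.
Implicit Types (a b : integral_group_ring gT) (x y : gT).

(** Deleting the coefficients of [a] in [D] leaves an element all whose class sums
    vanish. *)
Lemma gr_lift_support (V : zmodType) (f : gT -> V) (D : pred gT) a :
    (forall x y, f (x ^ y)%g = f x) -> (forall x y, D (x ^ y)%g = D x) ->
    (forall x, ~~ D x -> csum a x = 0) ->
  gr_lift f a = \sum_(x | D x) f x *~ a x.
Proof.
move=> fJ DJ aD; pose c : integral_group_ring gT := [ffun x => if D x then 0 else a x].
have c0 : gr_lift f c = 0.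
  apply: gr_lift_class0 fJ _ => x; rewrite /csum.
  under eq_bigr do rewrite ffunE DJ.
  by case: (boolP (D x)) => [_|/aD //]; rewrite big1.
rewrite /gr_lift (bigID D) /= [X in _ + X](_ : _ = 0) ?addr0 // -{2}c0.
rewrite /gr_lift [RHS](bigID D) /= [X in _ = X + _]big1 ?add0r => [|x Dx].
  by apply: eq_bigr => x /negPf Dx; rewrite ffunE Dx.
by rewrite ffunE Dx mulr0z.
Qed.

Variable N : {group gT}.
Hypothesis nN : (N <| [set: gT])%g.

Definition gr_quo a : integral_group_ring (coset_of N) :=
  gr_lift (fun g => gr_of (coset N g)) a.

Lemma quo_norm x : x \in 'N(N)%g.
Proof. by have /normal_norm/subsetP := nN; apply; rewrite inE. Qed.

Lemma gr_quoM a b : gr_quo (a * b) = gr_quo a * gr_quo b.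
Proof.
by apply: gr_liftM => x y; rewrite morphM ?quo_norm // gr_ofM.
Qed.

Lemma gr_quo1 : gr_quo 1 = 1.
Proof. by apply: gr_lift1; rewrite morph1 gr_of1. Qed.

Lemma gr_quoX a n : gr_quo (a ^+ n) = gr_quo a ^+ n.
Proof. by elim: n => [|n IHn]; rewrite ?gr_quo1 // !exprS gr_quoM IHn. Qed.

Lemma aug_quo a : aug (gr_quo a) = aug a.
Proof.
rewrite /gr_quo gr_lift_comp /= [RHS]augE; apply: eq_gr_lift => g /=.
by rewrite augE gr_lift_of.
Qed.

Lemma gr_quo_at1 a : gr_quo a 1%g = \sum_(n in N) a n.
Proof.
rewrite /gr_quo /gr_lift sum_ffunE [RHS]big_mkcond /=; apply: eq_bigr => g _.
have -> (b : integral_group_ring (coset_of N)) k C : (b *~ k) C = b C *~ k.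
  case: k => k; first by rewrite -!pmulrn ffunMnE.
  by rewrite NegzE !mulrNz -!pmulrn ffunE ffunMnE.
rewrite ffunE; have [gN|gN] := boolP (g \in N).
  by rewrite coset_id // eqxx intz.
case: eqP => [/esym/(coset_idr (quo_norm g)) gN'|_]; last by rewrite mul0rz.
by rewrite gN' in gN.
Qed.

Lemma sum_csum_normal a :
  \sum_(n in N) csum a n = gr_quo a 1%g *+ #|gT|.
Proof.
rewrite /csum exchange_big (eq_bigr (fun=> gr_quo a 1%g)).
  by rewrite sumr_const cardT.
move=> m _; rewrite gr_quo_at1 [RHS](reindex_inj (conjg_inj m)) /=.
by apply: eq_bigl => n; rewrite memJ_norm ?quo_norm.
Qed.

(** A unit of prime order [p] dying modulo [N] has partial augmentations summing to
    one over [N], and they are supported on [p]-elements other than the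
    identity. *)
Lemma torsion_kernel a p :
  prime p -> a ^+ p = 1 -> a != 1 -> aug a = 1 -> gr_quo a = 1 -> (p %| #|N|)%N.
Proof.
move=> pp ap a1 auga qa; apply/negPn/negP=> pN.
have a10 : a 1%g = 0 by apply: (berman_higman ap) => //; apply: prime_gt0.
have : \sum_(n in N) csum a n = 0.
  apply: big1 => x Nx; have [->|x1] := eqVneq x 1%g; first by rewrite csum1 a10 mul0rn.
  have ox : (1 < #[x]%g)%N by rewrite ltn_neqAle eq_sym order_eq1 x1 order_gt0.
  apply: (csum_new_prime ap (prime_gt0 pp) (pdiv_prime ox) _ (pdiv_dvd _)).
  rewrite dvdn_prime2 // ?pdiv_prime //; apply/eqP=> pE; case/negP: pN.
  by rewrite -pE (dvdn_trans (pdiv_dvd _)) // order_dvdG.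
rewrite sum_csum_normal qa ffunE eqxx => /eqP; rewrite mulrn_eq0 oner_eq0 orbF.
by rewrite -cardsT cards_eq0 => /eqP/setP/(_ 1%g); rewrite !inE.
Qed.

End Quotient.

(** * A unit of mixed order over a normal [p]-subgroup *)

Section NormalPGroup.

Local Open Scope ring_scope.

Variable gT : finGroupType.

Definition rsum (R : pzRingType) (K : {set gT}) : 'M[R]_#|gT| := \sum_(y in K) rmx R y.

Lemma rsum_idem (R : pzRingType) (K : {group gT}) :
  rsum R K * rsum R K = rsum R K *+ #|K|.
Proof.
rewrite {1}/rsum mulr_suml (eq_bigr (fun=> rsum R K)) ?sumr_const // => x Kx.
rewrite /rsum mulr_sumr [RHS](reindex_inj (mulgI x)) /=.
by apply: eq_big => [y|y _]; rewrite ?groupMl // [RHS]rmxM.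
Qed.

Lemma rsum_comm (R : pzRingType) (N : {group gT}) (Q : {set gT}) :
  Q \subset 'N(N)%g -> rsum R Q * rsum R N = rsum R N * rsum R Q.
Proof.
move=> nNQ; rewrite /rsum mulr_suml mulr_sumr; apply: eq_bigr => x Qx.
rewrite mulr_sumr mulr_suml (reindex_inj (conjg_inj x)) /=.
apply: eq_big => y; first by rewrite memJ_norm // (subsetP nNQ).
by move=> _; rewrite -![_ * _]rmxM conjgE mulKVg.
Qed.

(** In the complex group algebra let [M] be the joint eigenspace of left multiplication by
    [v] and [w] for a pair of eigenvalues [(alpha, 1)], [alpha <> 1]; it is a right module,
    of dimension [|G| / (p q)], on which [N] has no fixed point as [v] is trivial
    modulo [N]. If no element of order [q] centralises a non-trivial element of [N], then
    for a Sylow [q]-subgroup [Q] the group [N Q] is a Frobenius group: all elements [x n]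
    with [x] in [Q] non-trivial and [n] in [N] are conjugate to [x], so [x] has trace zero
    on [M], and [|Q|] divides the dimension of [M]. But [|G| / (p q)] is not divisible
    by [|Q|]. *)
Theorem normal_pgroup_edge (N : {group gT}) (p q : nat)
    (v w : integral_group_ring gT) :
    (N <| [set: gT])%g -> prime p -> prime q -> p != q -> (p.-group N)%g ->
    v ^+ p = 1 -> v != 1 -> aug v = 1 -> w ^+ q = 1 -> aug w = 1 ->
    v * w = w * v -> gr_quo N v = 1 -> gr_quo N w != 1 ->
  exists x : gT, #[x]%g = (p * q)%N.
Proof.
move=> nN pp pq npq pN vp v1 augv wq augw vw qv qw.
have p0 := prime_gt0 pp; have q0 := prime_gt0 pq.
case: (pickP [pred x : gT | #[x]%g == (p * q)%N]) => [x /eqP|noel].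
  by exists x.
exfalso; have [Q sylQ] := Sylow_exists q [set: gT].
have qQ : (q.-group Q)%g := pHall_pgroup sylQ.
have nNQ : Q \subset 'N(N)%g.
  by apply: subset_trans (normal_norm nN); apply: subsetT.
have cNx x y : x \in Q -> x != 1%g -> y \in N -> commute x y -> y = 1%g.
  move=> Qx x1 Ny cxy; apply/eqP/negPn/negP=> y1.
  have dvd_order (H : {group gT}) r z : prime r -> (r.-group H)%g -> z \in H ->
      z != 1%g -> (r %| #[z]%g)%N.
    move=> rp rH Hz z1; have /p_natP[[|i] oz] := mem_p_elt rH Hz.
      by case/negP: z1; rewrite -order_eq1 oz.
    by rewrite oz expnS dvdn_mulr.
  have cop : coprime #[y]%g #[x]%g.
    have /pnat_coprime := mem_p_elt pN Ny; apply.
    by rewrite /= (pi_pnat (mem_p_elt qQ Qx)) // !inE eq_sym.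
  have [|z oz] := @order_dvd_exists gT (y * x)%g (p * q).
    by rewrite orderM // dvdn_mul ?(dvd_order N p) ?(dvd_order Q q).
  by have := noel z; rewrite /= oz eqxx.
have conjx x n : x \in Q -> x != 1%g -> n \in N -> exists m, (x * n = x ^ m)%g.
  move=> Qx x1 Nn.
  pose g m := (x^-1 * x ^ m)%g.
  have gN m : m \in N -> g m \in N.
    move=> Nm; have -> : g m = (m^-1 ^ x * m)%g by rewrite /g !conjgE !mulgA.
    by rewrite groupM // memJ_norm ?groupV // (subsetP nNQ).
  have ginj : {in N &, injective g}.
    move=> m1 m2 Nm1 Nm2 /mulgI xm; have : (m1 * m2^-1 = 1)%g.
      apply: (cNx x) => //; first by rewrite groupM ?groupV.
      apply/commgP/conjg_fixP; rewrite conjgM xm conjgK.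
      by [].
    by move/eqP; rewrite -eq_mulgV1 => /eqP.
  have : g @: N = N.
    apply/eqP; rewrite eqEcard card_in_imset // leqnn andbT.
    by apply/subsetP=> _ /imsetP[m Nm ->]; apply: gN.
  move/setP/(_ n); rewrite Nn => /imsetP[m _ nE]; exists m.
  by rewrite nE /g mulKVg.
have [z zP] := C_prim_root_exists p0.
pose V := z *: lmx algC v; pose W := lmx algC w.
have VpE i : V ^+ i = z ^+ i *: lmx algC (v ^+ i).
  elim: i => [|i IHi]; first by rewrite !expr0 lmx1 scale1r.
  by rewrite !exprS IHi /V -[LHS]/(_ *m _) -scalemxAl -scalemxAr scalerA lmxM.
have Vp : V ^+ p = 1 by rewrite VpE vp lmx1 (prim_expr_order zP) scale1r.
have Wq : W ^+ q = 1 by rewrite -lmxX wq lmx1.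
have VW : V * W = W * V.
  rewrite -[LHS]/(_ *m _) -[RHS]/(_ *m _) /V -scalemxAl -scalemxAr.
  by rewrite -!lmxM vw.
pose A := \sum_(i < p) V ^+ i; pose B := \sum_(i < q) W ^+ i.
have AB : A * B = B * A.
  rewrite mulr_suml mulr_sumr; apply: eq_bigr => i _.
  rewrite mulr_sumr mulr_suml; apply: eq_bigr => j _.
  by apply: commrX; apply: commr_sym; apply: commrX.
have lr a (K : {set gT}) : lmx algC a * rsum algC K = rsum algC K * lmx algC a.
  rewrite /rsum [LHS]mulr_sumr [RHS]mulr_suml; apply: eq_bigr => y _.
  exact: lrmxC.
have AK (K : {set gT}) : A * rsum algC K = rsum algC K * A.
  rewrite mulr_suml mulr_sumr; apply: eq_bigr => i _.
  rewrite VpE -[LHS]/(_ *m _) -[RHS]/(_ *m _) -scalemxAl -scalemxAr.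
  by congr (_ *: _); apply: lr.
have BK (K : {set gT}) : B * rsum algC K = rsum algC K * B.
  rewrite mulr_suml mulr_sumr; apply: eq_bigr => i _.
  by rewrite -lmxX lr.
pose c y : algC := \sum_(i < p) \sum_(j < q) z ^+ i * (csum (v ^+ i * w ^+ j) y)%:~R.
have trc y : \tr (A * B * rmx algC y) = c y.
  rewrite /A /B !mulr_suml raddf_sum; apply: eq_bigr => i _.
  rewrite mulr_sumr mulr_suml raddf_sum; apply: eq_bigr => j _ /=.
  rewrite VpE -lmxX -[_ * _ * _]/(_ *m _ *m _) -!scalemxAl mxtraceZ.
  congr (_ * _); by rewrite -lmxM lmx_map rmx_map -map_mxM
    trace_map_mx trace_lrmx.
have trK (K : {set gT}) : \tr (A * B * rsum algC K) = \sum_(y in K) c y.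
  by rewrite mulr_sumr raddf_sum; apply: eq_bigr => y _; apply: trc.
have ABE (E : 'M[algC]_#|gT|) k : A * E = E * A -> B * E = E * B ->
    E * E = E *+ k -> (A * B * E) * (A * B * E) = (A * B * E) *+ (p * q * k).
  move=> AE BE EE; transitivity ((A * A) * (B * B) * (E * E)).
    rewrite -!mulrA; congr (_ * _); rewrite !mulrA.
    rewrite -[B * E * A]mulrA -AE [B * (A * E)]mulrA -AB -!mulrA.
    by congr (_ * _); congr (_ * _); rewrite !mulrA -BE.
  rewrite !sum_powers_idem // EE !(mulrnAl, mulrnAr) -!mulrnA.
  by rewrite -[(p * q)%N]mulnC mulnA.
have cJ x y : c (x ^ y)%g = c x.
  by apply: eq_bigr => i _; apply: eq_bigr => j _; rewrite csumJ.
have wjn j : (0 < j < q)%N -> gr_quo N w ^+ j != 1.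
  case/andP=> j0 jq; apply: contra qw => /eqP wj; apply/eqP.
  apply: (expr_coprime_eq1 q0 _ _ wj); first by rewrite prime_coprime // gtnNdvd.
  by rewrite -gr_quoX // wq gr_quo1.
(* the sum over the normal subgroup only sees the quotient *)
have cN : \sum_(n in N) c n = 0.
  rewrite /c exchange_big (eq_bigr (fun i : 'I_p => z ^+ i * #|gT|%:R)) /=.
    rewrite -mulr_suml; suff -> : \sum_(i < p) z ^+ i = 0 by rewrite mul0r.
    have z1 : z != 1.
      apply: contraL (prime_gt1 pp) => /eqP z1; rewrite -leqNgt dvdn_leq //.
      by rewrite (prim_order_dvd zP) z1 expr1.
    apply: (mulfI (_ : z - 1 != 0)); first by rewrite subr_eq0.
    by rewrite -subrX1 (prim_expr_order zP) subrr mulr0.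
  move=> i _; rewrite exchange_big (bigD1 (Ordinal q0)) //= [X in _ + X]big1 ?addr0.
    rewrite -mulr_sumr -rmorph_sum sum_csum_normal // expr0 mulr1 gr_quoX // qv.
    by rewrite expr1n ffunE eqxx rmorph_nat.
  move=> j j0; rewrite -mulr_sumr -rmorph_sum sum_csum_normal //.
  rewrite gr_quoM // !gr_quoX // qv expr1n mul1r.
  rewrite (@berman_higman _ _ q) ?mul0rn ?mulr0 //.
  - by rewrite exprAC -gr_quoX // wq gr_quo1 expr1n.
  - by rewrite rmorphXn /= aug_quo // augw expr1n.
  by apply: wjn; rewrite lt0n ltn_ord andbT -(inj_eq val_inj) in j0 *.
(* comparison of the fixed points of Q and of N Q *)
have [r1 E1] : exists r, \sum_(y in Q) c y = (p * q * #|Q| * r)%:R.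
  exists (\rank (A * B * rsum algC Q)%R); rewrite -trK natrM -natrM.
  apply: trace_idem_scale; last by rewrite !muln_gt0 p0 q0 cardG_gt0.
  by apply: ABE => //; apply: rsum_idem.
have [r2 E2] : exists r, \sum_(x in Q) \sum_(n in N) c (x * n)%g
    = (p * q * (#|Q| * #|N|) * r)%:R.
  pose E := rsum algC Q * rsum algC N.
  have EE : E * E = E *+ (#|Q| * #|N|).
    transitivity ((rsum algC Q * rsum algC Q) * (rsum algC N * rsum algC N)).
      rewrite -!mulrA; congr (_ * _); rewrite !mulrA; congr (_ * _).
      by rewrite -rsum_comm.
    by rewrite !rsum_idem mulrnAl mulrnAr -mulrnA mulnC.
  exists (\rank (A * B * E)%R).
  have -> : \sum_(x in Q) \sum_(n in N) c (x * n)%g = \tr (A * B * E).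
    rewrite /E {1}/rsum [X in A * B * X]mulr_suml [A * B * _]mulr_sumr raddf_sum; apply: eq_bigr => x _ /=.
    rewrite /rsum [rmx algC x * _]mulr_sumr [A * B * _]mulr_sumr raddf_sum; apply: eq_bigr => n _ /=.
    by rewrite -trc; congr (\tr (_ * _)); rewrite rmxM.
  apply: trace_idem_scale; last by rewrite !muln_gt0 p0 q0 !cardG_gt0.
  by apply: ABE => //; rewrite /E mulrA (AK, BK) -mulrA (AK, BK) mulrA.
have vw1 (i : 'I_p) (j : 'I_q) : (i != 0 :> nat) || (j != 0 :> nat) ->
    (v ^+ i * w ^+ j) 1%g = 0.
  move=> ij; apply: (@berman_higman _ _ (p * q)).
  - have /exprMn_comm -> : GRing.comm (v ^+ i) (w ^+ j).
      by apply: commrX; apply: commr_sym; apply: commrX.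
    rewrite exprM [v ^+ i ^+ p]exprAC vp !expr1n mul1r mulnC exprM.
    by rewrite [w ^+ j ^+ q]exprAC wq !expr1n.
  - by rewrite muln_gt0 p0.
  - by rewrite rmorphM !rmorphXn /= augv augw !expr1n mul1r.
  apply: contraL ij => /eqP vwE; rewrite negb_or !negbK.
  have j0 : j = 0 :> nat.
    apply/eqP; rewrite -leqn0 leqNgt; apply/negP=> j0.
    have /eqP[] : gr_quo N w ^+ j != 1 by apply: wjn; rewrite j0 ltn_ord.
    have := congr1 (gr_quo N) vwE.
    by rewrite gr_quoM // !gr_quoX // qv expr1n mul1r gr_quo1.
  rewrite j0 eqxx andbT -leqn0 leqNgt; apply: contra v1 => i0.
  move: vwE; rewrite j0 expr0 mulr1 => vi; apply/eqP.
  apply: (expr_coprime_eq1 p0 _ vp vi).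
  by rewrite prime_coprime // gtnNdvd.
have c1 : c 1%g = #|gT|%:R.
  rewrite /c (bigD1 (Ordinal p0)) //= (bigD1 (Ordinal q0)) //= !expr0 mulr1 mul1r.
  rewrite csum1 ffunE eqxx rmorph_nat !big1 ?addr0 //.
    move=> i i0; rewrite big1 // => j _; rewrite csum1 vw1 ?mul0rn ?mulr0 //.
    by rewrite -(inj_eq val_inj) in i0; rewrite i0.
  move=> j j0; have := vw1 (Ordinal p0) j; rewrite expr0 mul1r csum1 => ->.
    by rewrite mul0rn ?mul1r ?mulr0.
  exact: j0.
have key : #|gT|%:R = (p * q * #|Q|)%:R * (r1%:R - r2%:R) :> algC.
  have : (\sum_(x in Q) \sum_(n in N) c (x * n)%g) =
      #|N|%:R * (\sum_(y in Q) c y - c 1%g).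
    rewrite !(bigD1 1%g (group1 Q)) /= (eq_bigr c) => [|n _]; last by rewrite mul1g.
    rewrite cN add0r [c 1%g + _]addrC addrK mulr_sumr; apply: eq_bigr => x /andP[Qx x1].
    rewrite (eq_bigr (fun=> c x)) ?sumr_const ?mulr_natl // => n Nn.
    by have [m ->] := conjx x n Qx x1 Nn; rewrite cJ.
  rewrite E1 E2 c1 => e; apply: (mulfI (_ : #|N|%:R != 0)).
    by rewrite pnatr_eq0 -lt0n cardG_gt0.
  move: e; rewrite !natrM => e.
  rewrite -[LHS](subKr (#|N|%:R * (p%:R * q%:R * #|Q|%:R * r1%:R))) -mulrBr -e.
  by ring.
have oQ : #|Q| = (q ^ logn q #|gT|)%N by rewrite (card_Hall sylQ) p_part cardsT.
have [le21|lt12] := leqP r2 r1.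
  move: key; rewrite -natrB // -natrM => /eqP; rewrite eqr_nat => /eqP GE.
  have : (q ^ (logn q #|gT|).+1 %| #|gT|)%N.
    rewrite expnS -oQ; apply/dvdnP; exists (p * (r1 - r2))%N.
    by rewrite {1}GE; ring.
  by rewrite pfactor_dvdn // ?ltnn // -cardsT cardG_gt0.
have : (0 : algC) < #|gT|%:R by rewrite ltr0n -cardsT cardG_gt0.
rewrite key pmulr_rgt0 ?ltr0n ?muln_gt0 ?p0 ?q0 ?cardG_gt0 //.
by rewrite subr_gt0 ltr_nat ltnNge ltnW.
Qed.

End NormalPGroup.

(** * Matrices of size two and the group PSL(2, r) *)

Section Matrices2.

Local Open Scope ring_scope.

Variable R : comNzRingType.
Implicit Types (A B : 'M[R]_2) (a b c d : R).

Definition mx2 a b c d : 'M[R]_2 :=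
  \matrix_(i, j) if i == 0 then if j == 0 then a else b
                 else if j == 0 then c else d.

Lemma mx2_eta A : A = mx2 (A 0 0) (A 0 1) (A 1 0) (A 1 1).
Proof.
apply/matrixP=> i j; rewrite mxE.
by case: i j => [[|[|i]] ?] [[|[|j]] ?] //=; congr (A _ _); apply: val_inj.
Qed.

Lemma mx2E a b c d :
  ((mx2 a b c d 0 0 = a) * (mx2 a b c d 0 1 = b)) *
  ((mx2 a b c d 1 0 = c) * (mx2 a b c d 1 1 = d)).
Proof. by rewrite !mxE. Qed.

Lemma mx2_inj a b c d a' b' c' d' :
  mx2 a b c d = mx2 a' b' c' d' -> [/\ a = a', b = b', c = c' & d = d'].
Proof.
move=> e; have := congr1 (fun M : 'M_2 => (M 0 0, M 0 1, M 1 0, M 1 1)) e.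
by rewrite !mx2E => -[-> -> -> ->].
Qed.

Lemma mulmx2 a b c d a' b' c' d' :
  mx2 a b c d *m mx2 a' b' c' d' =
  mx2 (a * a' + b * c') (a * b' + b * d') (c * a' + d * c') (c * b' + d * d').
Proof.
by rewrite [LHS]mx2_eta; congr mx2; rewrite mxE !big_ord_recl big_ord0 addr0 !mxE.
Qed.

Lemma scalemx2 k a b c d :
  k *: mx2 a b c d = mx2 (k * a) (k * b) (k * c) (k * d).
Proof. by rewrite [LHS]mx2_eta !mxE. Qed.

Lemma addmx2 a b c d a' b' c' d' :
  mx2 a b c d + mx2 a' b' c' d' = mx2 (a + a') (b + b') (c + c') (d + d').
Proof. by rewrite [LHS]mx2_eta !mxE. Qed.

Lemma oppmx2 a b c d : - mx2 a b c d = mx2 (- a) (- b) (- c) (- d).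
Proof. by rewrite [LHS]mx2_eta !mxE. Qed.

Lemma scalar_mx2 k : k%:M = mx2 k 0 0 k.
Proof. by rewrite [LHS]mx2_eta !mxE. Qed.

Lemma trmx2 a b c d : \tr (mx2 a b c d) = a + d.
Proof. by rewrite /mxtrace !big_ord_recl big_ord0 addr0 !mxE. Qed.

Lemma detmx2 a b c d : \det (mx2 a b c d) = a * d - b * c.
Proof.
rewrite (expand_det_row _ 0) !big_ord_recl big_ord0 addr0 !mxE /cofactor.
rewrite !det_mx11 !mxE /= expr0 expr1 mul1r.
by rewrite mulN1r mulrN.
Qed.

Lemma cayley2 A : A *m A = \tr A *: A - (\det A)%:M.
Proof.
rewrite (mx2_eta A) mulmx2 trmx2 detmx2 scalemx2 scalar_mx2 oppmx2 addmx2.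
by congr mx2; ring.
Qed.

Lemma det_scale2 k A : \det (k *: A) = k ^+ 2 * \det A.
Proof. by rewrite detZ. Qed.

End Matrices2.

Section Projective.

Local Open Scope ring_scope.

Variable F : fieldType.
Implicit Types A B C : 'M[F]_2.

(** Equality in the projective linear group. *)
Definition peq A B := exists2 c : F, c != 0 & A = c *: B.

Lemma peq_refl A : peq A A.
Proof. by exists 1; rewrite ?oner_eq0 ?scale1r. Qed.

Lemma peq_sym A B : peq A B -> peq B A.
Proof.
by case=> c c0 ->; exists c^-1; rewrite ?invr_eq0 // scalerA mulVf ?scale1r.
Qed.

Lemma peq_trans B A C : peq A B -> peq B C -> peq A C.
Proof.
case=> c c0 -> [d d0 ->]; exists (c * d); first by rewrite mulf_neq0.
by rewrite scalerA.
Qed.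

Lemma peqM A A' B B' : peq A A' -> peq B B' -> peq (A *m B) (A' *m B').
Proof.
case=> c c0 -> [d d0 ->]; exists (c * d); first by rewrite mulf_neq0.
by rewrite -scalemxAl -scalemxAr scalerA.
Qed.

Lemma peqZ k A : k != 0 -> peq (k *: A) A.
Proof. by exists k. Qed.

Lemma peq_scalar A B : peq A B -> is_scalar_mx B -> is_scalar_mx A.
Proof.
case=> c _ -> /is_scalar_mxP[b ->]; apply/is_scalar_mxP; exists (c * b).
by rewrite scale_scalar_mx.
Qed.

End Projective.

Section ProjectiveSpecialLinearGroup.

Local Open Scope ring_scope.

Variable r : nat.
Hypothesis r_pr : prime r.
Let F := 'F_r.

Lemma SL_matrix (X : 'M[F]_2) : \det X = 1 -> exists2 u, u \in SL 2 F & GLval u = X.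
Proof.
move=> detX; have Xu : X \is a GRing.unit by rewrite -[_ \is a _]/(X \in unitmx) unitmxE detX unitr1.
by exists (FinRing.Unit Xu); rewrite ?inE /= ?detX.
Qed.

Definition unip : 'M[F]_2 := mx2 1 1 0 1.
Definition unipT : 'M[F]_2 := mx2 1 0 1 1.

(** The two root elements have a trace other than zero, so a matrix that commutes with
    them up to a scalar commutes with them. *)
Lemma centralise_root_subgroups (Q : 'M[F]_2) :
    \det Q != 0 -> (2 < r)%N -> peq (Q *m unip) (unip *m Q) ->
    peq (Q *m unipT) (unipT *m Q) ->
  is_scalar_mx Q.
Proof.
move=> dQ r2; have two0 : 2%:R != 0 :> F.
  rewrite -(dvdn_pcharf (pchar_Fp r_pr)) gtnNdvd //.
have comm E : \tr E = 2%:R -> peq (Q *m E) (E *m Q) -> Q *m E = E *m Q.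
  move=> trE [c c0 QE]; suff c1 : c = 1 by rewrite QE c1 scale1r.
  have Qu : Q \in unitmx by rewrite unitmxE unitfE.
  have := congr1 (fun M => \tr (M *m invmx Q)) QE.
  rewrite mxtrace_mulC mulmxA mulVmx // mul1mx -scalemxAl mulmxK // mxtraceZ trE.
  by move=> e; apply: (mulIf two0); rewrite mul1r -e.
move=> /comm QU /comm QL; move: QU QL.
rewrite !trmx2 (mx2_eta Q) !mulmx2 => /(_ erefl)/mx2_inj[e1 e2 e3 e4].
move=> /(_ erefl)/mx2_inj[f1 f2 f3 f4].
move: (Q 0 0) (Q 0 1) (Q 1 0) (Q 1 1) e1 e2 e3 e4 f1 f2 f3 f4 => a b c d.
move=> e1 e2 _ _ f1 _ _ _.
have c0 : c = 0.
  move: e1; rewrite !mulr1 !mulr0 !addr0 !mul1r => /esym/eqP.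
  by rewrite -subr_eq0 addrAC subrr add0r => /eqP.
have b0 : b = 0.
  move: f1; rewrite !mulr1 !mul1r !mul0r !addr0 => /eqP.
  by rewrite -subr_eq0 addrAC subrr add0r => /eqP.
have ad : a = d by move: e2; rewrite b0 !mulr1 !mul1r !add0r !addr0 => ->.
apply/is_scalar_mxP; exists a; rewrite scalar_mx2 b0 c0 ad.
by [].
Qed.

Lemma PSL_card_dvd (p : nat) :
  prime p -> (p %| #|PSL 2 F|)%N -> [\/ p = r, (p %| r.-1)%N | (p %| r.+1)%N].
Proof.
move=> pp pdv; have : (p %| #|'GL_2[F]%g|)%N.
  apply: dvdn_trans pdv _; apply: dvdn_trans (dvdn_quotient _ _) _.
  by rewrite cardSg // subsetT.
rewrite card_GL_2 card_Fp // !Euclid_dvdM // => /orP[/orP[]|].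
- by rewrite dvdn_prime2 // => /eqP; constructor 1.
- by rewrite orbb; constructor 2.
by constructor 3.
Qed.

(** Elements of a copy [S] of PSL(2, r) are handled through representatives in SL(2, r),
    which are multiplicative up to a scalar only. *)
Lemma PSL_matrices (gT : finGroupType) (S : {group gT}) :
    (2 < r)%N -> S \isog PSL 2 F ->
  exists M : gT -> 'M[F]_2,
    [/\ {in S, forall s, \det (M s) = 1},
        {in S &, forall s t, peq (M (s * t)%g) (M s *m M t)},
        {in S, forall s, is_scalar_mx (M s) -> s = 1%g}
      & forall X : 'M[F]_2, \det X = 1 -> exists2 s, s \in S & peq (M s) X].
Proof.
move=> r2 /isogP[f injf fS].
have dU : \det (unip : 'M[F]_2) = 1 by rewrite detmx2; ring.
have dL : \det (unipT : 'M[F]_2) = 1 by rewrite detmx2; ring.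
have [uU SU UE] := SL_matrix dU; have [uL SL_ LE] := SL_matrix dL.
have Zscal u : u \in 'Z(SL 2 F)%g -> is_scalar_mx (GLval u).
  case/centerP=> _ cu; apply: centralise_root_subgroups => //; first exact: (@GL_det 2 F u).
    have -> : GLval u *m unip = unip *m GLval u.
      by rewrite -UE; apply: (congr1 (@GLval 2 F) (cu _ SU)).
    exact: peq_refl.
  have -> : GLval u *m unipT = unipT *m GLval u.
    by rewrite -LE; apply: (congr1 (@GLval 2 F) (cu _ SL_)).
  exact: peq_refl.
have scalZ u : u \in SL 2 F -> is_scalar_mx (GLval u) -> u \in 'Z(SL 2 F)%g.
  move=> Su /is_scalar_mxP[c uc]; apply/centerP; split=> // v _.
  by apply: val_inj; rewrite /= -[LHS]/(GLval u *m GLval v)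
    -[RHS]/(GLval v *m GLval u) uc scalar_mxC.
have nZ u : u \in SL 2 F -> u \in 'N('Z(SL 2 F))%g.
  by apply/subsetP; apply: normal_norm (center_normal _).
have centP (u v : {'GL_2[F]}) : u \in SL 2 F -> v \in SL 2 F ->
    coset 'Z(SL 2 F)%g u = coset 'Z(SL 2 F)%g v -> peq (GLval u) (GLval v).
  move=> Su Sv /(kercoset_rcoset (nZ u Su) (nZ v Sv))[z Zz ->].
  have /is_scalar_mxP[c zc] := Zscal z Zz.
  have -> : GLval (z * v)%g = c *: (GLval v : 'M[F]_2).
    by rewrite -mul_scalar_mx -zc.
  apply: peqZ; by have := @GL_det 2 F z; rewrite zc det_scalar; apply: contraNneq => ->; rewrite expr0n.
have fP (s : gT) : exists X : 'M[F]_2, s \in S ->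
    exists u, [/\ u \in SL 2 F, GLval u = X & f s = coset 'Z(SL 2 F)%g u].
  have [Ss|] := boolP (s \in S); last by exists 0.
  have : f s \in PSL 2 F by rewrite -fS mem_morphim.
  by case/morphimP=> u _ SLu fu; exists (GLval u) => _; exists u.
have [M MP] := fin_all_exists fP; exists M; split.
- move=> s /MP[u [SLu <- _]]; apply/eqP.
  by rewrite inE in SLu.
- move=> s t Ss St; have [u [SLu <- fsu]] := MP s Ss; have [v [SLv <- ftv]] := MP t St.
  have [w [SLw <- fstw]] := MP _ (groupM Ss St).
  rewrite -[_ *m _]/(GLval (u * v)%g); apply: centP; rewrite ?groupM // -fstw morphM // fsu ftv.
  by rewrite -morphM ?nZ.
- move=> s Ss; have [u [SLu <- fsu]] := MP s Ss => /(scalZ u SLu) Zu.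
  by apply: (injmP injf) => //; rewrite morph1 fsu coset_id.
move=> X /SL_matrix[u SLu uX].
have : coset 'Z(SL 2 F)%g u \in PSL 2 F.
  by rewrite mem_morphim // nZ.
rewrite -fS => /morphimP[s _ Ss fs]; exists s => //.
have [v [SLv <- fsv]] := MP s Ss; rewrite -uX; apply: centP => //.
by rewrite -fsv fs.
Qed.

End ProjectiveSpecialLinearGroup.

(** * Elements and automorphisms of PSL(2, r) *)

Section Representatives.

Local Open Scope ring_scope.

Variable r : nat.
Hypotheses (r_pr : prime r) (r_gt2 : (2 < r)%N).
Local Notation F := 'F_r.

Variables (gT : finGroupType) (S : {group gT}) (M : gT -> 'M[F]_2).
Hypothesis M_det : {in S, forall s, \det (M s) = 1}.
Hypothesis M_mul : {in S &, forall s t, peq (M (s * t)%g) (M s *m M t)}.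
Hypothesis M_scal : {in S, forall s, is_scalar_mx (M s) -> s = 1%g}.
Hypothesis M_surj : forall X : 'M[F]_2, \det X = 1 -> exists2 s, s \in S & peq (M s) X.

Lemma Fr_neq0 n : (0 < n < r)%N -> n%:R != 0 :> F.
Proof.
by case/andP=> n0 nr; rewrite -(dvdn_pcharf (pchar_Fp r_pr)) gtnNdvd.
Qed.

Lemma M1 : peq (M 1%g) 1.
Proof.
have [c c0 e] := M_mul (group1 S) (group1 S); rewrite mulg1 in e.
have Mu : M 1%g \in unitmx by rewrite unitmxE M_det ?unitr1.
exists c^-1; rewrite ?invr_eq0 //.
have := congr1 (fun X => c^-1 *: (X *m invmx (M 1%g))) e.
rewrite /= -!scalemxAl mulmxK // scalerA mulVf // scale1r => <-.
by rewrite mulmxV.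
Qed.

Lemma M1_scal : is_scalar_mx (M 1%g).
Proof. by apply: peq_scalar M1 _; apply: scalar_mx_is_scalar. Qed.

Lemma M_mul_rep s t X Y :
  s \in S -> t \in S -> peq (M s) X -> peq (M t) Y -> peq (M (s * t)%g) (X *m Y).
Proof. by move=> Ss St sX tY; apply: peq_trans (M_mul Ss St) (peqM sX tY). Qed.

Lemma M_exp_rep s X n : s \in S -> peq (M s) X -> peq (M (s ^+ n)%g) (X ^+ n).
Proof.
move=> Ss sX; elim: n => [|n IHn]; first exact: M1.
by rewrite expgS exprS; apply: M_mul_rep; rewrite ?groupX.
Qed.

Lemma M_inv_rep s X Y : s \in S -> peq (M s) X -> X *m Y = 1 -> peq (M s^-1%g) Y.
Proof.
move=> Ss sX XY; have YX : Y *m X = 1 by apply: mulmx1C.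
have := M_mul_rep (groupVr Ss) Ss (peq_refl _) sX; rewrite mulVg => e.
have := peqM (peq_trans (peq_sym e) M1) (peq_refl Y).
by rewrite -mulmxA XY mulmx1 mul1mx.
Qed.

Lemma M_inj s t : s \in S -> t \in S -> peq (M s) (M t) -> s = t.
Proof.
move=> Ss St st; apply/eqP; rewrite eq_mulgV1; apply/eqP/M_scal.
  by rewrite groupM ?groupV.
have tV : peq (M (t * t^-1)%g) (M t *m M t^-1%g) by apply: M_mul; rewrite ?groupV.
apply: peq_scalar M1_scal; rewrite -(mulgV t); apply: peq_trans (peq_sym tV).
by apply: M_mul_rep; rewrite ?groupV //; apply: peq_refl.
Qed.

Lemma element_of_matrix (X : 'M[F]_2) n :
    \det X = 1 -> (0 < n)%N -> (forall k, is_scalar_mx (X ^+ k) = (n %| k)%N) ->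
  exists2 s, s \in S & #[s]%g = n.
Proof.
move=> dX n0 Xk; have [s Ss sX] := M_surj dX; exists s => //.
have sk k : (s ^+ k == 1)%g = (n %| k)%N.
  rewrite -Xk; apply/eqP/idP => [sk1|Xs].
    apply: peq_scalar (M1_scal); apply: peq_sym; rewrite -sk1.
    exact: M_exp_rep.
  by apply: M_scal; rewrite ?groupX //; apply: peq_scalar Xs; apply: M_exp_rep.
apply/eqP; rewrite eqn_dvd order_dvdn sk dvdnn /=.
by rewrite -sk expg_order.
Qed.

Lemma unip_exp k : (unip r) ^+ k = mx2 1 k%:R 0 1.
Proof.
elim: k => [|k IHk]; first by rewrite expr0 -[LHS]/(1%:M) scalar_mx2.
by rewrite exprS IHk -[LHS]/(_ *m _) mulmx2 -[k.+1]addn1 natrD; congr mx2; ring.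
Qed.

Lemma unipT_exp k : (unipT r) ^+ k = mx2 1 0 k%:R 1.
Proof.
elim: k => [|k IHk]; first by rewrite expr0 -[LHS]/(1%:M) scalar_mx2.
by rewrite exprS IHk -[LHS]/(_ *m _) mulmx2 -[k.+1]addn1 natrD; congr mx2; ring.
Qed.

Lemma scalar_mx2P a b c d :
  is_scalar_mx (mx2 a b c d : 'M[F]_2) = [&& b == 0, c == 0 & a == d].
Proof.
apply/is_scalar_mxP/and3P=> [[k]|[/eqP-> /eqP-> /eqP->]]; last first.
  by exists d; rewrite scalar_mx2.
by rewrite scalar_mx2 => /mx2_inj[-> -> -> ->].
Qed.

Lemma PSL_order_r : exists2 s, s \in S & #[s]%g = r.
Proof.
apply: (@element_of_matrix (unip r)); rewrite ?prime_gt0 //.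
  by rewrite detmx2; ring.
move=> k; rewrite unip_exp scalar_mx2P !eqxx !andbT.
by rewrite -(dvdn_pcharf (pchar_Fp r_pr)).
Qed.

Definition weyl : 'M[F]_2 := mx2 0 1 (-1) 0.

Lemma weyl2 : weyl *m weyl = (-1)%:M.
Proof. by rewrite mulmx2 scalar_mx2; congr mx2; ring. Qed.

Lemma weyl_nscal : ~~ is_scalar_mx weyl.
Proof. by rewrite scalar_mx2P oner_eq0. Qed.

Lemma PSL_order_2 : exists2 s, s \in S & #[s]%g = 2.
Proof.
apply: (@element_of_matrix weyl) => // [|k]; first by rewrite detmx2; ring.
have wk j : weyl ^+ (j.*2) = ((-1) ^+ j)%:M.
  elim: j => [|j IHj]; first by rewrite !expr0.
  rewrite doubleS !exprS IHj mulrA -[weyl * weyl]/(weyl *m weyl) weyl2.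
  by rewrite -[LHS]/(_ *m _) -scalar_mxM.
rewrite -{1}[k]odd_double_half dvdn2; case: (odd k) => /=; last first.
  by rewrite add0n wk scalar_mx_is_scalar.
rewrite add1n exprS wk -[_ * _]/(_ *m _) mul_mx_scalar.
apply/negP=> sc; case/negP: weyl_nscal.
by apply: peq_scalar sc; apply/peq_sym/peqZ; rewrite signr_eq0.
Qed.

End Representatives.

Section Torus.

Local Open Scope ring_scope.

Variable r : nat.
Hypothesis r_pr : prime r.
Local Notation F := 'F_r.

Lemma Fr_expr (x : F) : x ^+ r = x.
Proof. by have := expf_card x; rewrite card_Fp. Qed.

Lemma closed_prim_root (K : closedFieldType) n :
  (0 < n)%N -> n%:R != 0 :> K -> exists z : K, n.-primitive_root z.
Proof.
move=> n_gt0 nK; pose p : {poly K} := 'X^n - 1.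
have [s Dp] := closed_field_poly_normal p.
rewrite (monicP _) ?monicXnsubC // scale1r in Dp.
have rn1 : all n.-unity_root s by apply/allP=> z; rewrite -root_prod_XsubC -Dp.
have sz_s : (n < (size s).+1)%N.
  by rewrite -(size_prod_XsubC s id) -Dp size_XnsubC.
have [|z] := hasP (has_prim_root n_gt0 rn1 _ sz_s); last by exists z.
by rewrite -separable_prod_XsubC -Dp cyclotomic.separable_Xn_sub_1.
Qed.

Lemma frobenius_fixed (K : fieldType) (iota : {rmorphism F -> K}) (x : K) :
  x ^+ r = x -> exists y, x = iota y.
Proof.
move=> xr; have := congr1 (fun p => (map_poly iota p).[x]) (finField_genPoly F).
rewrite card_Fp // rmorphB rmorph_prod /= map_polyXn map_polyX !hornerE xr subrr.
rewrite horner_prod => /esym/eqP; rewrite prodf_seq_eq0 => /hasP[y _] /=.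
rewrite rmorphB /= map_polyX map_polyC !hornerE subr_eq0 => /eqP ->.
by exists y.
Qed.

(** A torus element of odd order [n], split or not: the companion matrix of the minimal
    polynomial of a primitive [n]-th root of unity and its inverse. *)
Lemma torus_matrix n :
    odd n -> (1 < n)%N -> (n %| r.-1)%N || (n %| r.+1)%N ->
  exists2 X : 'M[F]_2, \det X = 1 & forall k, is_scalar_mx (X ^+ k) = (n %| k)%N.
Proof.
move=> n_odd n1 ndv; have n0 : (0 < n)%N by apply: ltnW.
have r0 := prime_gt0 r_pr.
have [K [iota _]] := countable_algebraic_closure F.
have pK : r \in [pchar K] by rewrite (fmorph_pchar iota) pchar_Fp.
have nK : n%:R != 0 :> K.
  rewrite -(dvdn_pcharf pK) -prime_coprime // coprime_sym.
  case/orP: ndv => ndv; first exact: coprime_dvdl ndv (coprimePn r0).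
  exact: coprime_dvdl ndv (coprimeSn r).
have [l lP] := closed_prim_root n0 nK; have ln := prim_expr_order lP.
have l0 : l != 0 by apply: contraTneq (oner_neq0 K) => l0; rewrite -ln l0 expr0n gtn_eqF ?eqxx.
have lV : l * l^-1 = 1 by rewrite mulfV.
have [t tE] : exists t, l + l^-1 = iota t.
  apply: frobenius_fixed; rewrite -(pFrobenius_autE pK) rmorphD /= !pFrobenius_autE exprVn.
  case/orP: ndv => /dvdnP[k kE].
    by rewrite -(prednK r0) kE exprS mulnC exprM ln expr1n mulr1.
  have lr : l ^+ r * l = 1 by rewrite -exprSr kE mulnC exprM ln expr1n.
  have -> : l ^+ r = l^-1 by apply: (mulIf l0); rewrite lr mulVf.
  by rewrite invrK addrC.
pose X : 'M[F]_2 := mx2 t (-1) 1 0; exists X => [|k].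
  by rewrite detmx2; ring.
pose Y : 'M[K]_2 := map_mx iota X.
pose V : 'M[K]_2 := mx2 l l^-1 1 1.
have YE : Y = mx2 (l + l^-1) (-1) 1 0.
  by rewrite [LHS]mx2_eta !mxE /= rmorphN rmorph1 rmorph0 tE.
have YV j : Y ^+ j *m V = V *m mx2 (l ^+ j) 0 0 (l^-1 ^+ j).
  elim: j => [|j IHj]; first by rewrite !expr0 mul1mx -scalar_mx2 mulmx1.
  rewrite exprS -[_ * _]/(_ *m _) -mulmxA IHj YE !mulmx2 !exprS.
  have eq_mod u v w : u - v = (l * l^-1 - 1) * w -> u = v.
    by rewrite lV subrr mul0r => /eqP; rewrite subr_eq0 => /eqP.
  move: (l^-1) eq_mod => m eq_mod; move: (l ^+ j) (m ^+ j) => a b.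
  by congr mx2; [apply: (eq_mod _ _ a) | apply: (eq_mod _ _ b) | |]; ring.
have l2 : l - l^-1 != 0.
  rewrite subr_eq0; apply/eqP=> le; have : l ^+ 2 = 1 by rewrite expr2 {2}le.
  move/eqP; rewrite -(prim_order_dvd lP) => /dvdn_leq => /(_ isT) n2.
  by move: n_odd; rewrite (_ : n = 2) //; apply/eqP; rewrite eqn_leq n2.
have Vu : V \in unitmx by rewrite unitmxE detmx2 !mulr1 unitfE.
have YX j : Y ^+ j = map_mx iota (X ^+ j).
  elim: j => [|j IHj]; first by rewrite !expr0 map_mx1.
  by rewrite !exprS IHj -[RHS]/(map_mx _ (_ *m _)) map_mxM.
apply/idP/idP=> [/is_scalar_mxP[c Xc]|/dvdnP[j ->]].
  have := YV k; rewrite YX Xc map_scalar_mx /= -scalar_mxC => /(congr1 (mulmx (invmx V))).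
  rewrite !mulKmx // scalar_mx2 => /mx2_inj[e1 _ _ e2].
  have : l ^+ (k.*2) = 1 by rewrite -addnn exprD -{2}e1 e2 -exprMn lV expr1n.
  move/eqP; rewrite -(prim_order_dvd lP) -mul2n Gauss_dvdr // coprimen2.
  exact: n_odd.
have : Y ^+ (j * n) = 1.
  have := YV (j * n)%N; rewrite mulnC !exprM exprVn ln invr1 expr1n -scalar_mx2 mulmx1.
  by move/(congr1 (mulmx^~ (invmx V))); rewrite mulmxK // mulmxV.
rewrite YX -[1]/(1%:M) -(map_mx1 iota) => /map_mx_inj ->.
exact: scalar_mx_is_scalar.
Qed.

End Torus.

Section Automorphisms.

Local Open Scope ring_scope.

Variable r : nat.
Hypotheses (r_pr : prime r) (r_gt2 : (2 < r)%N).
Local Notation F := 'F_r.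

Lemma detX (R : comNzRingType) n (A : 'M[R]_n) k : \det (A ^+ k) = \det A ^+ k.
Proof.
elim: k => [|k IHk]; first by rewrite !expr0 det1.
by rewrite !exprS -IHk -det_mulmx.
Qed.

Lemma two_neq0 : 2%:R != 0 :> F.
Proof. exact: Fr_neq0. Qed.

Lemma traceless_anticommutator (R : comNzRingType) (A B : 'M[R]_2) :
  \tr A = 0 -> \tr B = 0 -> A *m B + B *m A = (\tr (A *m B))%:M.
Proof.
rewrite (mx2_eta A) (mx2_eta B) !trmx2 !mulmx2 addmx2 trmx2 scalar_mx2.
move: (A 0 0) (A 0 1) (A 1 0) (A 1 1) => a b c d.
move: (B 0 0) (B 0 1) (B 1 0) (B 1 1) => a' b' c' d'.
move=> /(canRL (addrK _)); rewrite sub0r => ->.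
move=> /(canRL (addrK _)); rewrite sub0r => ->.
by congr mx2; ring.
Qed.

(** The scalar [X ^+ r] is a sign [c], and then [(c X - 1) ^+ r = 0] in
    characteristic [r]. *)
Lemma unipotent_of_order_r (X : 'M[F]_2) :
    \det X = 1 -> is_scalar_mx (X ^+ r) -> ~~ is_scalar_mx X ->
  exists N : 'M[F]_2, [/\ N *m N = 0, \tr N = 0 & peq X (1 + N)].
Proof.
move=> dX /is_scalar_mxP[c Xr] Xns; have r0 := prime_gt0 r_pr.
have r_odd : odd r by case: (even_prime r_pr) r_gt2 => [->|].
have c2 : c * c = 1.
  have := congr1 (fun M : 'M_2 => \det M) Xr; rewrite /= det_scalar expr2 => <-.
  by rewrite detX dX expr1n.
have c0 : c != 0 by apply: contraTneq (oner_neq0 F) => c0; rewrite -c2 c0 mulr0 eqxx.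
have Xr1 : (c *: X) ^+ r = 1.
  rewrite exprZn Xr scale_scalar_mx (_ : c ^+ r * c = 1) //.
  rewrite -exprSr -[r.+1]odd_double_half /= r_odd /= add0n -mul2n exprM expr2.
  by rewrite c2 expr1n.
pose N : 'M[F]_2 := c *: X - 1.
have [NE _] := unipotent_powers 1 (c *: X) r_pr; rewrite expn1 Xr1 subrr -/N in NE.
have dN : \det N = 0.
  have : \det (N ^+ r) = 0 by rewrite NE det0.
  by move/eqP; rewrite detX expf_eq0 => /andP[_ /eqP].
have N2 : N *m N = \tr N *: N by rewrite cayley2 dN raddf0 subr0.
have Nk k : N ^+ k.+1 = \tr N ^+ k *: N.
  elim: k => [|k IHk]; first by rewrite expr0 scale1r expr1.
  by rewrite exprS IHk -[_ * _]/(_ *m _) -scalemxAr N2 scalerA -exprSr.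
have XN : peq X (1 + N).
  exists c; first by [].
  by rewrite /N addrC subrK scalerA c2 scale1r.
have tN : \tr N = 0.
  have : N ^+ r.-1.+1 = 0 by rewrite prednK.
  rewrite Nk => /eqP; rewrite scaler_eq0 expf_eq0.
  case/orP=> [/andP[_ /eqP] //|/eqP N0]; case/negP: Xns.
  by apply: peq_scalar XN _; rewrite N0 addr0 scalar_mx_is_scalar.
by exists N; split; rewrite // N2 tN scale0r.
Qed.

(** By [traceless_anticommutator] the trace condition says that
    [N1 N2 + N2 N1 = 1]; the required basis consists of [N1 e] and [e] for a vector [e] in
    the image of [N2]. *)
Lemma conjugate_root_pair (N1 N2 : 'M[F]_2) :
    N1 *m N1 = 0 -> \tr N1 = 0 -> N2 *m N2 = 0 -> \tr N2 = 0 ->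
    \tr (N1 *m N2) = 1 ->
  exists2 P : 'M[F]_2, \det P != 0 &
    (1 + N1) *m P = P *m unip r /\ (1 + N2) *m P = P *m unipT r.
Proof.
move=> n1 t1 n2 t2 t12.
have ac : N2 *m N1 = 1%:M - N1 *m N2.
  by rewrite -t12 -traceless_anticommutator // addrC addKr.
have N2n0 : N2 != 0.
  by apply: contraTneq (oner_neq0 F) => N20; rewrite -t12 N20 mulmx0 mxtrace0 eqxx.
have [j e0] : exists j, col j N2 != 0.
  have : ~~ [forall j, col j N2 == 0].
    apply: contra N2n0 => /forallP N20; apply/eqP/matrixP=> i j.
    by have /eqP/matrixP/(_ i 0) := N20 j; rewrite !mxE.
  by rewrite negb_forall => /existsP.
pose e := col j N2; have eE : e = N2 *m delta_mx j 0 by rewrite /e colE.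
pose f := N1 *m e.
have n1f : N1 *m f = 0 by rewrite /f mulmxA n1 mul0mx.
have n2e : N2 *m e = 0 by rewrite eE mulmxA n2 mul0mx.
have n2f : N2 *m f = e.
  by rewrite /f mulmxA ac mulmxBl mul1mx -mulmxA n2e mulmx0 subr0.
have n1e : N1 *m e = f by [].
have en0 : e != 0 by [].
clearbody f; clearbody e.
pose P : 'M[F]_(1 + 1) := row_mx f e.
have dP : \det P != 0.
  rewrite -det_tr; apply/negP=> /det0P[v v0 vP].
  have : P *m v^T = 0 by rewrite -[P]trmxK -trmx_mul vP trmx0.
  rewrite -[v](@hsubmxK _ 1 1 1) tr_row_mx mul_row_col.
  set a := (lsubmx v)^T; set b := (rsubmx v)^T => ab.
  have fb : f *m b = 0.
    have := congr1 (mulmx N1) ab.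
    by rewrite mulmxDr !mulmxA n1f n1e mul0mx add0r mulmx0.
  have scal (x : 'cV[F]_2) (c : 'M[F]_1) : x *m c = c 0 0 *: x.
    by rewrite [c]mx11_scalar mul_mx_scalar mxE eqxx.
  have ea : e *m a = 0.
    have := congr1 (mulmx N2) ab.
    by rewrite mulmxDr !mulmxA n2f n2e mul0mx addr0 mulmx0.
  have a0 : a = 0.
    move: ea; rewrite scal => /eqP; rewrite scaler_eq0 (negPf en0) orbF => /eqP a00.
    by rewrite [a]mx11_scalar a00 raddf0.
  have b0 : b = 0.
    move: ab; rewrite a0 mulmx0 add0r scal => /eqP.
    rewrite scaler_eq0 (negPf en0) orbF => /eqP b00.
    by rewrite [b]mx11_scalar b00 raddf0.
  case/eqP: v0; rewrite -[v](@hsubmxK _ 1 1 1).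
  by rewrite -[lsubmx v]trmxK -[rsubmx v]trmxK -/a -/b a0 b0 trmx0 row_mx0.
have unipE : unip r = block_mx 1%:M 1%:M 0 (1%:M : 'M[F]_1) :> 'M[F]_(1 + 1).
  apply/matrixP=> i k; rewrite !mxE.
  case: (@splitP 1 1 i) => i' iE; rewrite mxE; case: (@splitP 1 1 k) => k' kE;
    by rewrite !mxE -!val_eqE /= iE kE !ord1.
have unipTE : unipT r = block_mx 1%:M 0 1%:M (1%:M : 'M[F]_1) :> 'M[F]_(1 + 1).
  apply/matrixP=> i k; rewrite !mxE.
  case: (@splitP 1 1 i) => i' iE; rewrite mxE; case: (@splitP 1 1 k) => k' kE;
    by rewrite !mxE -!val_eqE /= iE kE !ord1.
have XP (A : 'M[F]_2) : A *m (P : 'M[F]_2) = row_mx (A *m f) (A *m e) :> 'M[F]_(2, 1 + 1).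
  exact: mul_mx_row.
have PU : (P : 'M[F]_2) *m unip r = row_mx f (f + e) :> 'M[F]_(2, 1 + 1).
  rewrite unipE -[LHS]/(@mulmx _ 2 (1 + 1) (1 + 1) (row_mx f e) _).
  rewrite mul_row_block.
  by rewrite !mulmx1 mulmx0 addr0.
have PL : (P : 'M[F]_2) *m unipT r = row_mx (f + e) e :> 'M[F]_(2, 1 + 1).
  rewrite unipTE -[LHS]/(@mulmx _ 2 (1 + 1) (1 + 1) (row_mx f e) _).
  rewrite mul_row_block.
  by rewrite !mulmx1 mulmx0 add0r.
exists P; first exact: dP.
rewrite PU PL !XP !mulmxDl !mul1mx n1f n1e n2f n2e !addr0.
by rewrite [e + f]addrC.
Qed.

End Automorphisms.

Section ProjectiveAction.

Local Open Scope ring_scope.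

Variable r : nat.
Hypotheses (r_pr : prime r) (r_gt2 : (2 < r)%N).
Local Notation F := 'F_r.

Variables (gT : finGroupType) (S : {group gT}) (M : gT -> 'M[F]_2).
Hypothesis M_det : {in S, forall s, \det (M s) = 1}.
Hypothesis M_mul : {in S &, forall s t, peq (M (s * t)%g) (M s *m M t)}.
Hypothesis M_scal : {in S, forall s, is_scalar_mx (M s) -> s = 1%g}.
Hypothesis M_surj : forall X : 'M[F]_2, \det X = 1 -> exists2 s, s \in S & peq (M s) X.

Let M1s := M1_scal M_det M_mul.
Let Mmul := M_mul_rep M_mul.
Let Mexp := M_exp_rep M_det M_mul.
Let Minv := M_inv_rep M_det M_mul.
Let Minj := M_inj M_det M_mul M_scal.

Lemma Fr_nat (a : F) : exists n, a = n%:R.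
Proof. by exists (nat_of_ord a); rewrite natr_Zp. Qed.

(** A matrix with a non-zero lower left entry is a product of three elementary ones, and
    one of [s] and [s * l] has such an entry. *)
Lemma root_generation (u l s : gT) (H : {group gT}) :
    H \subset S -> u \in H -> l \in H -> peq (M u) (unip r) -> peq (M l) (unipT r) ->
  s \in S -> s \in H.
Proof.
move=> sHS Hu Hl Mu Ml; have Su := subsetP sHS u Hu; have Sl := subsetP sHS l Hl.
have big t : t \in S -> M t 1 0 != 0 -> t \in H.
  move=> St c0; have dt := M_det St; rewrite (mx2_eta (M t)) detmx2 in dt.
  move: (mx2_eta (M t)) c0 dt.
  move: (M t 0 0) (M t 0 1) (M t 1 0) (M t 1 1) => a b c d Mt c0 dt.
  have [i iE] := Fr_nat ((a - 1) / c); have [j jE] := Fr_nat c.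
  have [k kE] := Fr_nat ((d - 1) / c).
  have -> : t = (u ^+ i * l ^+ j * u ^+ k)%g; last by rewrite !groupM ?groupX.
  apply: Minj => //; first by rewrite !groupM ?groupX.
  apply: peq_sym; rewrite Mt.
  have -> : mx2 a b c d = unip r ^+ i *m unipT r ^+ j *m unip r ^+ k.
    rewrite unip_exp unipT_exp unip_exp -iE -jE -kE !mulmx2.
    have bE : b = (a * d - 1) / c.
      by apply: (mulIf c0); rewrite mulfVK // -dt; ring.
    by rewrite bE; congr mx2; field.
  apply: Mmul; rewrite ?groupM ?groupX //; last exact: Mexp.
  by apply: Mmul; rewrite ?groupX //; apply: Mexp.
move=> Ss; have [c0|] := eqVneq (M s 1 0) 0; last exact: big.
suff : (s * l)%g \in H by rewrite groupMr.
apply: big; first by rewrite groupM.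
have [k k0 ->] := Mmul Ss Sl (peq_refl _) Ml.
have ds := M_det Ss; rewrite (mx2_eta (M s)) detmx2 in ds.
move: (mx2_eta (M s)) c0 ds; move: (M s 0 0) (M s 0 1) (M s 1 0) (M s 1 1).
move=> a b c d -> -> ad; rewrite mulmx2 scalemx2 mx2E mul0r add0r mulr1.
rewrite mulr0 subr0 in ad; rewrite mulf_neq0 //.
by apply: contraTneq (oner_neq0 F) => d0; rewrite -ad d0 mulr0 eqxx.
Qed.

(** Every automorphism of PSL(2, r) is conjugation by a matrix. The images of the two
    standard unipotents are conjugate to a pair of opposite unipotents; that the
    Weyl element obtained from the former has order two fixes the remaining
    parameter. *)
Lemma PSL_automorphism (alpha : gT -> gT) :
    {in S, forall s, alpha s \in S} ->
    {in S &, {morph alpha : s t / (s * t)%g}} ->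
    {in S, forall s, alpha s = 1%g -> s = 1%g} ->
  exists2 P : 'M[F]_2, \det P != 0
    & {in S, forall s, peq (M (alpha s) *m P) (P *m M s)}.
Proof.
move=> aS aM a1.
have alpha1 : alpha 1%g = 1%g.
  by apply: (mulgI (alpha 1%g)); rewrite -aM ?group1 // !mulg1.
have aX s n : s \in S -> alpha (s ^+ n)%g = (alpha s ^+ n)%g.
  move=> Ss; elim: n => [|n IHn]; first by rewrite !expg0.
  by rewrite !expgS aM ?groupX // IHn.
have aV s : s \in S -> alpha s^-1%g = (alpha s)^-1%g.
  move=> Ss; apply: (mulgI (alpha s)); rewrite -aM ?groupV // !mulgV.
  exact: alpha1.
have dU : \det (unip r) = 1 by rewrite detmx2; ring.
have dL : \det (unipT r) = 1 by rewrite detmx2; ring.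
have [u Su Mu] := M_surj dU; have [l Sl Ml] := M_surj dL.
have unipotent s X : s \in S -> peq (M s) X -> X ^+ r = 1 -> ~~ is_scalar_mx X ->
    exists N : 'M[F]_2, [/\ N *m N = 0, \tr N = 0 & peq (M (alpha s)) (1 + N)].
  move=> Ss sX Xr Xns; apply: unipotent_of_order_r => //; first exact: M_det (aS s Ss).
    apply: peq_scalar M1s; apply: peq_sym.
    have -> : 1%g = (alpha s ^+ r)%g.
      rewrite -aX // (_ : s ^+ r = 1)%g ?alpha1 //; apply: M_scal; rewrite ?groupX //.
      apply: peq_scalar (_ : is_scalar_mx 1); first by rewrite -Xr; apply: Mexp.
      exact: scalar_mx_is_scalar.
    by apply: Mexp; rewrite ?aS //; apply: peq_refl.
  apply: contra Xns => /(M_scal (aS s Ss))/(a1 s Ss) s1.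
  by apply: peq_scalar M1s; apply: peq_sym; rewrite -s1.
have pcharF : r%:R = 0 :> F by apply/eqP; rewrite -(dvdn_pcharf (pchar_Fp r_pr)).
have [N1 [n1 t1 MN1]] : exists N : 'M[F]_2,
    [/\ N *m N = 0, \tr N = 0 & peq (M (alpha u)) (1 + N)].
  apply: unipotent Su Mu _ _; last by rewrite scalar_mx2P oner_eq0.
  by rewrite unip_exp pcharF -scalar_mx2.
have [N2 [n2 t2 MN2]] : exists N : 'M[F]_2,
    [/\ N *m N = 0, \tr N = 0 & peq (M (alpha l)) (1 + N)].
  apply: unipotent Sl Ml _ _; last by rewrite scalar_mx2P oner_eq0 andbF.
  by rewrite unipT_exp pcharF -scalar_mx2.
pose w := (u * l^-1 * u)%g; have Sw : w \in S by rewrite !groupM ?groupV.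
have Mw : peq (M w) (weyl r).
  have -> : weyl r = unip r *m mx2 1 0 (-1) 1 *m unip r.
    by rewrite !mulmx2; congr mx2; ring.
  apply: (Mmul _ _ _ Mu); rewrite ?groupM ?groupV //.
  apply: (Mmul _ _ Mu); rewrite ?groupV //; apply: (Minv Sl Ml).
  by rewrite mulmx2 -[RHS]/(1%:M) scalar_mx2; congr mx2; ring.
have w2 : (w ^+ 2 = 1)%g.
  apply: M_scal; rewrite ?groupX //.
  apply: peq_scalar (_ : is_scalar_mx (weyl r ^+ 2)); first exact: Mexp.
  by rewrite expr2 -[_ * _]/(_ *m _) weyl2 scalar_mx_is_scalar.
have w1 : w != 1%g.
  apply: contra (weyl_nscal r) => /eqP w1; apply: peq_scalar M1s.
  by apply: peq_sym; rewrite -w1.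
pose Z : 'M[F]_2 := (1 + N1) *m (1 - N2) *m (1 + N1).
have MZ : peq (M (alpha w)) Z.
  rewrite /w !aM ?groupM ?groupV // aV //.
  have au : alpha u \in S by apply: aS.
  have al : alpha l \in S by apply: aS.
  apply: (Mmul _ _ _ MN1); rewrite ?groupM ?groupV //.
  apply: (Mmul _ _ MN1); rewrite ?groupV //; apply: (Minv al MN2).
  by rewrite mulmxBr mulmx1 mulmxDl mul1mx n2 addr0 addrK.
have Zns : ~~ is_scalar_mx Z.
  apply: contra w1 => Zs; apply/eqP/(a1 w Sw)/M_scal; first exact: aS.
  exact: peq_scalar MZ Zs.
have Z2 : is_scalar_mx (Z *m Z).
  apply: peq_scalar M1s; rewrite -alpha1 -w2 expgS expg1 aM //.
  by apply: peq_sym; apply: Mmul; rewrite ?aS.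
have tZ : \tr Z = 0.
  apply/eqP; apply: contraNT Zns => tZ.
  have /is_scalar_mxP[c Zc] := Z2; rewrite cayley2 in Zc.
  apply/is_scalar_mxP; exists ((\tr Z)^-1 * (c + \det Z)).
  by rewrite -scale_scalar_mx raddfD /= -Zc subrK scalerA mulVf // scale1r.
have t12 : \tr (N1 *m N2) = 1.
  have : \tr Z = 2%:R - 2%:R * \tr (N1 *m N2).
    rewrite /Z mxtrace_mulC mulmxA.
    have -> : (1 + N1) *m (1 + N1) = 1 + (N1 + N1).
      by rewrite mulmxDl !mulmxDr n1 !mul1mx !mulmx1 addr0 addrA.
    rewrite mulmxBr mulmx1 !mulmxDl mul1mx -[1]/(1%:M) raddfB /= !mxtraceD mxtrace1.
    by rewrite t1 t2; ring.
  by rewrite tZ => /esym/eqP; rewrite subr_eq0 -{1}[2%:R]mulr1 => /eqP/(mulfI (two_neq0 r_pr r_gt2)) <-.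
have [P dP [XP YP]] := conjugate_root_pair n1 t1 n2 t2 t12; exists P => // s Ss.
pose good t := peq (M (alpha t) *m P) (P *m M t).
have good_mul s1 s2 : s1 \in S -> s2 \in S -> good s1 -> good s2 -> good (s1 * s2)%g.
  move=> S1 S2 g1 g2; rewrite /good aM //.
  apply: peq_trans (peqM (M_mul (aS _ S1) (aS _ S2)) (peq_refl P)) _.
  rewrite -mulmxA; apply: peq_trans (peqM (peq_refl _) g2) _.
  rewrite mulmxA; apply: peq_trans (peqM g1 (peq_refl _)) _.
  by rewrite -mulmxA; apply: peqM (peq_refl P) _; apply/peq_sym/M_mul.
have good_root s1 X N : s1 \in S -> peq (M s1) X -> peq (M (alpha s1)) (1 + N) ->
    (1 + N) *m P = P *m X -> good s1.
  move=> S1 s1X s1N NP; apply: peq_trans (peqM s1N (peq_refl P)) _.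
  by rewrite NP; apply: peqM (peq_refl P) (peq_sym s1X).
have gu := good_root u _ _ Su Mu MN1 XP; have gl := good_root l _ _ Sl Ml MN2 YP.
have sHS : <<[set u; l]>>%g \subset S.
  by rewrite gen_subG; apply/subsetP=> t; rewrite !inE => /orP[] /eqP ->.
have : s \in <<[set u; l]>>%g.
  by apply: (root_generation sHS _ _ Mu Ml Ss); rewrite mem_gen // !inE eqxx ?orbT.
case/gen_prodgP=> n [c cul ->]; rewrite -/(good _).
suff [] : (\prod_(i < n) c i)%g \in S /\ good (\prod_(i < n) c i)%g by [].
have g1 : good 1%g.
  rewrite -[1%g](expg_order u) -(prednK (order_gt0 u)).
  elim: (#[u]%g.-1) => [|k IHk]; first by rewrite expg1.
  by rewrite expgS; apply: good_mul; rewrite ?groupX.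
elim/big_rec: _ => [|i t _ [St gt]]; first by [].
have [Sc gc] : c i \in S /\ good (c i).
  by have := cul i; rewrite !inE => /orP[] /eqP ->.
by split; [rewrite groupM | apply: good_mul].
Qed.

(** By [PSL_automorphism] an element of the normaliser acts on [S] as conjugation by a
    matrix, which is unique up to a scalar. *)
Theorem PSL_normaliser_action :
  exists A : gT -> 'M[F]_2,
    [/\ {in 'N(S)%g, forall g, \det (A g) != 0},
        {in 'N(S)%g &, forall g h, peq (A (g * h)%g) (A g *m A h)}
      & {in 'N(S)%g, forall g, is_scalar_mx (A g) = (g \in 'C(S)%g)}].
Proof.
have fP (g : gT) : exists P : 'M[F]_2, g \in 'N(S)%g -> \det P != 0 /\
    {in S, forall s, peq (M (s ^ g^-1)%g *m P) (P *m M s)}.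
  have [nSg|] := boolP (g \in 'N(S)%g); last by exists 0.
  have [s Ss|s t _ _|s _|P dP PP] := @PSL_automorphism (fun s => s ^ g^-1)%g.
  - by rewrite memJ_norm ?groupV.
  - by rewrite conjMg.
  - by move/eqP; rewrite conjg_eq1 => /eqP.
  by exists P => _.
have [A AP] := fin_all_exists fP.
have AN g : g \in 'N(S)%g -> \det (A g) != 0 by case/AP.
have AS g s : g \in 'N(S)%g -> s \in S ->
    peq (M (s ^ g^-1)%g *m A g) (A g *m M s).
  by move=> /AP[_]; apply.
have dU : \det (unip r) = 1 by rewrite detmx2; ring.
have dL : \det (unipT r) = 1 by rewrite detmx2; ring.
have [u Su Mu] := M_surj dU; have [l Sl Ml] := M_surj dL.
have central Q : \det Q != 0 -> {in S, forall s, peq (Q *m M s) (M s *m Q)} ->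
    is_scalar_mx Q.
  move=> dQ QS; apply: centralise_root_subgroups => //.
    apply: peq_trans (peqM (peq_refl Q) (peq_sym Mu)) _.
    exact: peq_trans (QS u Su) (peqM Mu (peq_refl Q)).
  apply: peq_trans (peqM (peq_refl Q) (peq_sym Ml)) _.
  exact: peq_trans (QS l Sl) (peqM Ml (peq_refl Q)).
exists A; split=> [g /AN //|g h nSg nSh|g nSg].
  have nSgh : (g * h)%g \in 'N(S)%g by rewrite groupM.
  set B := A g *m A h; set C := A (g * h)%g.
  have dB : \det B != 0 by rewrite det_mulmx mulf_neq0 ?AN.
  have Bu : B \in unitmx by rewrite unitmxE unitfE.
  have BS s : s \in S -> peq (M (s ^ (g * h)^-1)%g *m B) (B *m M s).
    move=> Ss; have Sh : (s ^ h^-1)%g \in S by rewrite memJ_norm ?groupV.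
    rewrite invMg conjgM /B mulmxA.
    apply: peq_trans (peqM (AS g _ nSg Sh) (peq_refl _)) _.
    by rewrite -!mulmxA; apply: peqM (peq_refl _) (AS h s nSh Ss).
  have dC : \det C != 0 by apply: AN.
  have CS s : s \in S -> peq (M (s ^ (g * h)^-1)%g *m C) (C *m M s) by apply: AS.
  clearbody B C; have /is_scalar_mxP[q qE] : is_scalar_mx (invmx B *m C).
    apply: central => [|s Ss].
      by rewrite det_mulmx mulf_neq0 // det_inv invr_eq0.
    rewrite -mulmxA mulmxA; apply: peq_trans (_ : peq (invmx B *m (M (s ^ (g * h)^-1)%g *m C)) _).
      by rewrite -mulmxA; apply: peqM (peq_refl _) (peq_sym (CS s Ss)).
    rewrite mulmxA [M s *m _]mulmxA; apply: peqM (peq_refl C).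
    have := peqM (peqM (peq_refl (invmx B)) (BS s Ss)) (peq_refl (invmx B)).
    by rewrite !mulmxA mulmxK // mulVmx // mul1mx => /peq_sym; apply: peq_sym.
  have CE : C = q *: B by rewrite -mul_mx_scalar -qE mulKVmx.
  exists q => //; apply: contraTneq dC => q0.
  by rewrite CE q0 scale0r det0 eqxx.
apply/idP/idP => [/is_scalar_mxP[c cE]|/centP cg].
  apply/centP=> s Ss; have c0 : c != 0.
    by apply: contraTneq (AN g nSg) => c0; rewrite cE c0 det_scalar expr0n eqxx.
  have Sg : (s ^ g^-1)%g \in S by rewrite memJ_norm ?groupV.
  have : (s ^ g^-1 = s)%g.
    apply: Minj => //; have := AS g s nSg Ss.
    rewrite cE mul_mx_scalar mul_scalar_mx => /(peq_trans (peq_sym (peqZ _ c0))).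
    by move/peq_trans; apply; apply: peqZ.
  by move/(congr1 (fun t => t ^ g)%g); rewrite conjgKV => /esym/conjg_fixP/commgP.
apply: central => [|s Ss]; first exact: AN.
have := AS g s nSg Ss; suff -> : (s ^ g^-1 = s)%g by apply: peq_sym.
by apply/conjg_fixP/commgP; apply: commuteV (commute_sym (cg s Ss)).
Qed.

End ProjectiveAction.

(** * The action on the projective line *)

Section ProjectiveLine.

Local Open Scope ring_scope.

(** Unipotents, the Weyl element and the tori. *)
Lemma PSL_elements (r : nat) (gT : finGroupType) (S : {group gT}) :
    prime r -> (2 < r)%N -> S \isog PSL 2 'F_r ->
  [/\ exists2 s, s \in S & #[s]%g = r, exists2 s, s \in S & #[s]%g = 2%N
    & forall n, odd n -> (1 < n)%N -> (n %| r.-1)%N || (n %| r.+1)%N ->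
        exists2 s, s \in S & #[s]%g = n].
Proof.
move=> r_pr r2 /(PSL_matrices r_pr r2)[M [Mdet Mmul Mscal Msurj]]; split.
- exact: PSL_order_r Msurj.
- exact: PSL_order_2 Msurj.
move=> n n_odd n1 ndv; have [X dX Xk] := torus_matrix r_pr n_odd n1 ndv.
exact: (element_of_matrix Mdet Mmul Mscal Msurj dX (ltnW n1) Xk).
Qed.

Lemma PSL_action (r : nat) (gT : finGroupType) (S : {group gT}) :
    prime r -> (2 < r)%N -> S \isog PSL 2 'F_r ->
  exists A : gT -> 'M['F_r]_2,
    [/\ {in 'N(S)%g, forall g, \det (A g) != 0},
        {in 'N(S)%g &, forall g h, peq (A (g * h)%g) (A g *m A h)}
      & {in 'N(S)%g, forall g, is_scalar_mx (A g) = (g \in 'C(S)%g)}].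
Proof.
move=> r_pr r2 /(PSL_matrices r_pr r2)[M [Mdet Mmul Mscal Msurj]].
exact: PSL_normaliser_action Mdet Mmul Mscal Msurj.
Qed.

Variable F : finFieldType.
Implicit Types (A B : 'M[F]_2) (o : option F).

Lemma mulmxE2 (R : pzSemiRingType) (A B : 'M[R]_2) i j :
  (A *m B) i j = A i 0 * B 0 j + A i 1 * B 1 j.
Proof.
rewrite mxE !big_ord_recl big_ord0 addr0.
by congr (_ + A i _ * B _ j); apply: val_inj.
Qed.

(** The projective line as [option F], with [None] the point at infinity. *)
Definition vx o : F := if o is Some t then t else 1.
Definition vy o : F := if o is Some _ then 1 else 0.
Definition point (x y : F) : option F := if y == 0 then None else Some (x / y).

Definition moebius A o : option F :=
  point (A 0 0 * vx o + A 0 1 * vy o) (A 1 0 * vx o + A 1 1 * vy o).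

Lemma pointK x y : (x != 0) || (y != 0) ->
  exists2 c, c != 0 & x = c * vx (point x y) /\ y = c * vy (point x y).
Proof.
rewrite /point; have [->|y0] := eqVneq y 0.
  by rewrite orbF => x0; exists x; rewrite //= mulr1 mulr0.
by exists y => //=; rewrite mulr1 mulrC mulfVK.
Qed.

Lemma point_scale c x y : c != 0 -> point (c * x) (c * y) = point x y.
Proof.
move=> c0; rewrite /point mulf_eq0 (negPf c0) /=; case: eqP => // /eqP y0.
by congr Some; rewrite -mulf_div divff // mul1r.
Qed.

Lemma point_v o : point (vx o) (vy o) = o.
Proof. by case: o => [t|]; rewrite /point /= ?eqxx ?oner_eq0 ?divr1. Qed.

Lemma moebius_peq A B : peq A B -> moebius A =1 moebius B.
Proof.
case=> c c0 -> o; rewrite /moebius !mxE -[RHS](point_scale _ _ c0).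
by congr point; rewrite mulrDr !mulrA.
Qed.

Lemma moebius_scalar A : \det A != 0 -> is_scalar_mx A -> moebius A =1 id.
Proof.
move=> dA /is_scalar_mxP[c AE] o; have c0 : c != 0.
  by apply: contraNneq dA => c0; rewrite AE c0 det_scalar expr0n.
rewrite /moebius AE scalar_mx2 !mx2E !mul0r addr0 add0r point_scale // point_v.
by [].
Qed.

Lemma moebiusM A B o : \det B != 0 -> moebius (A *m B) o = moebius A (moebius B o).
Proof.
move=> dB; rewrite {3}/moebius.
set x := B 0 0 * _ + _; set y := B 1 0 * _ + _.
have /pointK[c c0 [xE yE]] : (x != 0) || (y != 0).
  rewrite -negb_and; apply: contra dB => /andP[/eqP x0 /eqP y0].
  rewrite (mx2_eta B) detmx2; move: x0 y0; rewrite /x /y.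
  move: (B 0 0) (B 0 1) (B 1 0) (B 1 1) => a b c d.
  case: o {x y} => [t|]; rewrite /= ?mulr1 ?mulr0 ?addr0 => x0 y0.
    have -> : b = - (a * t) by rewrite -[b](addKr (a * t)) x0 addr0.
    have -> : d = - (c * t) by rewrite -[d](addKr (c * t)) y0 addr0.
    by apply/eqP; ring.
  by rewrite x0 y0 mul0r mulr0 subrr.
rewrite {1}/moebius [X in point X](_ : _ = A 0 0 * x + A 0 1 * y); last first.
  by rewrite /x /y !mulmxE2; ring.
rewrite [X in point _ X](_ : _ = A 1 0 * x + A 1 1 * y); last first.
  by rewrite /x /y !mulmxE2; ring.
clearbody x y; move: (point x y) xE yE => o' -> ->.
by rewrite /moebius -[RHS](point_scale _ _ c0); congr point; ring.
Qed.

(** The fixed points are the zeros of a binary quadratic form. *)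
Lemma moebius_fix A o : moebius A o = o ->
  A 1 0 * vx o ^+ 2 + (A 1 1 - A 0 0) * (vx o * vy o) = A 0 1 * vy o ^+ 2.
Proof.
rewrite /moebius; set x := _ + _; set y := _ + _ => oE.
have xy : x * vy o = y * vx o.
  rewrite -oE /point; case: eqP => [->|/eqP y0] /=; first by rewrite mulr0 mul0r.
  by rewrite mulr1 mulrC mulfVK.
apply/eqP; rewrite -subr_eq0 -oppr_eq0; apply/eqP.
by rewrite -[RHS](subrr (y * vx o)) -{1}xy /x /y; ring.
Qed.

Lemma moebius_fix_le2 A : ~~ is_scalar_mx A -> (#|[set o | moebius A o == o]| <= 2)%N.
Proof.
move=> nsA; rewrite leqNgt; apply: contra nsA => /card_gt2P[o1 [o2 [o3 [[]]]]].
rewrite !inE => /eqP/moebius_fix f1 /eqP/moebius_fix f2 /eqP/moebius_fix f3 [].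
suff sc : o1 != o2 -> o2 != o3 -> o3 != o1 ->
    [/\ A 1 0 = 0, A 0 1 = 0 & A 0 0 = A 1 1].
  move=> n12 n23 n31; have [c0 b0 ad] := sc n12 n23 n31.
  apply/is_scalar_mxP; exists (A 1 1).
  by rewrite (mx2_eta A) scalar_mx2 c0 b0 ad !mx2E.
move: (A 0 0) (A 0 1) (A 1 0) (A 1 1) f1 f2 f3 => a b c d.
have two s t : s != t -> c * s ^+ 2 + (d - a) * (s * 1) = b * 1 ^+ 2 ->
    c * t ^+ 2 + (d - a) * (t * 1) = b * 1 ^+ 2 -> c * (s + t) + (d - a) = 0.
  move=> st es et; apply: (mulfI (_ : s - t != 0)); first by rewrite subr_eq0.
  by rewrite mulr0 -[RHS](subrr (b * 1 ^+ 2)) -{1}es -et; ring.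
have inf : c * 1 ^+ 2 + (d - a) * (1 * 0) = b * 0 ^+ 2 -> c = 0.
  by move=> e; rewrite -[LHS]mulr1 -[1 in LHS](expr1n _ 2) -[LHS]addr0
    -[0 in LHS](mulr0 (d - a)) -[0 in LHS](mul0r 1) [0 * 1]mulrC e expr0n mulr0.
have fin s t : c = 0 -> c * (s + t) + (d - a) = 0 ->
    c * s ^+ 2 + (d - a) * (s * 1) = b * 1 ^+ 2 -> [/\ c = 0, b = 0 & a = d].
  move=> -> ; rewrite !mul0r !add0r => da; rewrite da mul0r expr1n mulr1 => <-.
  by split=> //; apply/esym/eqP; rewrite -subr_eq0 da.
case: o1 o2 o3 => [s1|] [s2|] [s3|] //= f1 f2 f3 n12 n23 n31.
- have e12 := two s1 s2 n12 f1 f2; have e23 := two s2 s3 n23 f2 f3.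
  apply: (fin s1 s2) => //; apply: (mulIf (_ : s3 - s1 != 0)); first by rewrite subr_eq0.
  by rewrite mul0r -[RHS](subrr (c * (s1 + s2) + (d - a))) {1}e12 -e23; ring.
- by apply: (fin s1 s2) => //; [apply: inf | apply: two].
- by apply: (fin s1 s3) => //; [apply: inf | apply: two; rewrite // eq_sym].
by apply: (fin s2 s3) => //; [apply: inf | apply: two].
Qed.

End ProjectiveLine.

(** * Traces of units of prime order and joint multiplicities *)

Section PrimeOrderUnits.

Local Open Scope ring_scope.

(** At the identity this is [berman_higman]. If the order of [x] is not a power of [l],
    [csum_new_prime] applies, and if it is [l ^ j] with [j > 1], [csum_large_order] does,
    with [d = 1]. *)
Lemma prime_unit_support (gT : finGroupType) (a : integral_group_ring gT) (l : nat) (x : gT) :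
    prime l -> a ^+ l = 1 -> a != 1 -> aug a = 1 -> #[x]%g != l ->
  csum a x = 0.
Proof.
move=> l_pr al a1 aug1 xl; have l0 := prime_gt0 l_pr.
have [-> | x1] := eqVneq x 1%g.
  by rewrite csum1 (berman_higman al l0 aug1 a1) mul0rn.
have [l_x|] := boolP (l.-nat #[x]%g).
  have [j xj] := p_natP l_x; have j1 : (1 < j)%N.
    case: j xj => [|[|j]] // xj; last by rewrite xj expn1 eqxx in xl.
    by rewrite expn0 in xj; case/eqP: x1; apply/eqP; rewrite -order_eq1 xj.
  have := @csum_large_order gT a 1 x l 1 j l_pr (coprime1n _) isT al (expr1n _ _).
  by rewrite mulr1 mul1r big_ord1 expr0 mulr1; apply.
rewrite /pnat order_gt0 => /allPn[k]; rewrite mem_primes => /and3P[k_pr _ kx] kl.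
apply: (csum_new_prime al l0 k_pr _ kx).
by rewrite dvdn_prime2.
Qed.

Lemma prime_unit_lift (gT : finGroupType) (V : zmodType) (f : gT -> V)
    (a : integral_group_ring gT) (l : nat) :
    (forall x y, f (x ^ y)%g = f x) ->
    prime l -> a ^+ l = 1 -> a != 1 -> aug a = 1 ->
  gr_lift f a = \sum_(x | #[x]%g == l) f x *~ a x.
Proof.
move=> fJ l_pr al a1 aug1; apply: gr_lift_support => // [x y|x].
  by rewrite orderJ.
exact: prime_unit_support.
Qed.

Lemma prime_unit_lift_const (gT : finGroupType) (V : zmodType) (f : gT -> V) (c : V)
    (a : integral_group_ring gT) (l : nat) :
    (forall x y, f (x ^ y)%g = f x) ->
    prime l -> a ^+ l = 1 -> a != 1 -> aug a = 1 ->
    (forall x, #[x]%g = l -> f x = c) ->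
  gr_lift f a = c.
Proof.
move=> fJ l_pr al a1 aug1 fc; rewrite (prime_unit_lift fJ l_pr al a1 aug1).
have := prime_unit_lift (f := fun _ : gT => 1 : int) (fun _ _ => erefl) l_pr al a1 aug1.
rewrite -augE aug1 => E.
rewrite (eq_bigr (fun x => c *~ a x)) => [|x /eqP/fc -> //].
rewrite -mulrz_sumr -[RHS]mulr1z E; congr (_ *~ _).
by apply: eq_bigr => x _; rewrite mulrzz mul1r.
Qed.

End PrimeOrderUnits.

Lemma card_fix_mod (T : finType) (f : T -> T) (l : nat) :
  prime l -> iter l f =1 id -> (#|[set t | f t == t]| = #|T| %[mod l])%N.
Proof.
move=> l_pr fl.
have inj_f : injective f.
  move=> x y xy; rewrite -(fl x) -(fl y) -(prednK (prime_gt0 l_pr)) !iterSr.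
  by rewrite xy.
pose s := perm inj_f; have sX k t : (s ^+ k)%g t = iter k f t.
  by rewrite permX; apply: eq_iter => u; rewrite permE.
have s_l : (l.-group <[s]>)%g.
  rewrite /pgroup -orderE (pnat_dvd _ (pnat_id l_pr)) // order_dvdn.
  by apply/eqP/permP=> t; rewrite sX fl perm1.
have := pgroup_fix_mod (to := perm_action T) (S := [set: T]) s_l.
rewrite cardsT => -> //; last by apply/actsP=> a _ t; rewrite !inE.
rewrite afix_cycle ?inE //; congr (_ %% _)%N; apply: eq_card => t.
by rewrite !inE /= sub1set inE /= apermE permE.
Qed.

Section JointMultiplicities.

Local Open Scope ring_scope.

Lemma sum_root_powers (F : fieldType) (n : nat) (z : F) :
  (0 < n)%N -> z ^+ n = 1 -> z != 1 -> \sum_(i < n | (i : nat) != 0%N) z ^+ i = -1.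
Proof.
case: n => // n _ zn z1.
have : \sum_(i < n.+1) z ^+ i = 0.
  apply/eqP; rewrite -(mulrI_eq0 _ (mulfI (_ : z - 1 != 0))) ?subr_eq0 //.
  by rewrite -subrX1 zn subrr.
rewrite (bigD1 ord0) //= expr0 => /eqP.
rewrite addrC addr_eq0 => /eqP <-; apply: eq_bigl => i.
by rewrite -val_eqE.
Qed.

Lemma unity_root_neq0 (F : fieldType) (n : nat) (z : F) :
  (0 < n)%N -> z ^+ n = 1 -> z != 0.
Proof.
move=> n0 zn; apply: contra (oner_neq0 F) => /eqP z0.
by rewrite -zn z0 expr0n eqn0Ngt n0.
Qed.

Lemma prim_root_neq1 (F : fieldType) (n : nat) (z : F) :
  (1 < n)%N -> n.-primitive_root z -> z != 1.
Proof.
move=> n1 zP; apply: contraTneq n1 => z1.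
by have := prim_order_dvd zP 1; rewrite z1 expr1n eqxx dvdn1 => /eqP ->.
Qed.

Lemma sum_one_powers (R : nzRingType) (n : nat) : (0 < n)%N ->
  \sum_(i < n | (i : nat) != 0%N) 1 ^+ i = n%:R - 1 :> R.
Proof.
case: n => // n _; rewrite big_mkcond big_ord_recl /= add0r.
rewrite (eq_bigr (fun=> 1)) => [|i _]; last by rewrite expr1n.
by rewrite sumr_const card_ord -natr1 addrK.
Qed.

Variables (d p q : nat) (V W : 'M[int]_d).
Hypotheses (p_pr : prime p) (q_pr : prime q) (pq : p != q).
Hypotheses (VW : V * W = W * V) (Vp : V ^+ p = 1) (Wq : W ^+ q = 1).

Let co_pq : coprime p q.
Proof. by rewrite prime_coprime // dvdn_prime2. Qed.

(** Galois invariance: there is an exponent prime to [pq] congruent to [i] modulo [p] and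
    to [j] modulo [q], unless these are zero. *)
Lemma trace_joint i j : (i < p)%N -> (j < q)%N ->
  \tr (V ^+ i * W ^+ j) =
    \tr (V ^+ (i != 0%N) * W ^+ (j != 0%N)).
Proof.
move=> ip jq; have p0 := prime_gt0 p_pr; have q0 := prime_gt0 q_pr.
pose U := V ^+ (i != 0%N) * W ^+ (j != 0%N).
have UX k : U ^+ k = V ^+ ((i != 0%N) * k) * W ^+ ((j != 0%N) * k).
  by rewrite exprMn_comm -?exprM //; apply/commrX/commr_sym/commrX.
have Un : U ^+ (p * q) = 1.
  by rewrite UX mulnCA exprM Vp expr1n mul1r mulnA mulnC exprM Wq expr1n.
pose k := chinese p q (if i == 0%N then 1 else i)%N (if j == 0%N then 1 else j)%N.
have co l m : prime l -> (m < l)%N -> coprime (if m == 0%N then 1 else m)%N l.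
  move=> l_pr ml; case: eqP => [_|/eqP m0]; first exact: coprime1n.
  by rewrite coprime_sym prime_coprime // gtnNdvd ?lt0n.
have kp := chinese_modl co_pq (if i == 0%N then 1 else i)%N (if j == 0%N then 1 else j)%N.
have kq := chinese_modr co_pq (if i == 0%N then 1 else i)%N (if j == 0%N then 1 else j)%N.
have := @trace_coprime_pow _ _ k U Un; rewrite muln_gt0 p0 q0 coprimeMr.
rewrite -(coprime_modl k p) -(coprime_modl k q) kp kq !coprime_modl !co //.
move=> /(_ isT isT) <-; rewrite UX; congr (\tr (_ * _)).
  rewrite -(expr_mod _ Vp) -[RHS](expr_mod _ Vp) -modnMmr kp modnMmr.
  by case: (i) => [|n]; rewrite ?mul0n ?mul1n.
rewrite -(expr_mod _ Wq) -[RHS](expr_mod _ Wq) -modnMmr kq modnMmr.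
by case: (j) => [|n]; rewrite ?mul0n ?mul1n.
Qed.

(** Up to the factor [p * q], the projection to the joint eigenspace of [V] and [W] with
    eigenvalues [x^-1] and [y^-1]. *)
Definition joint_proj (x y : algC) : 'M[algC]_d :=
  (\sum_(i < p) (x *: mxC V) ^+ i) * (\sum_(j < q) (y *: mxC W) ^+ j).

Lemma joint_proj_trace x y : x ^+ p = 1 -> y ^+ q = 1 ->
  \sum_(i < p) \sum_(j < q) x ^+ i * y ^+ j * (\tr (V ^+ i * W ^+ j))%:~R =
    (p * q * \rank (joint_proj x y))%:R.
Proof.
move=> xp yq; have p0 := prime_gt0 p_pr; have q0 := prime_gt0 q_pr.
have sX (z : algC) (A : 'M[algC]_d) n : (z *: A) ^+ n = z ^+ n *: A ^+ n.
  elim: n => [|n IHn]; first by rewrite !expr0 scale1r.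
  by rewrite !exprS IHn -[_ * _]/(_ *m _) -scalemxAl -scalemxAr scalerA.
have sV : (x *: mxC V) ^+ p = 1 by rewrite sX xp scale1r -mxC_X Vp; exact: map_mx1.
have sW : (y *: mxC W) ^+ q = 1 by rewrite sX yq scale1r -mxC_X Wq; exact: map_mx1.
have cVW : mxC V * mxC W = mxC W * mxC V.
  by rewrite -[LHS]map_mxM -[RHS]map_mxM; congr mxC; exact: VW.
have cs : GRing.comm (\sum_(i < p) (x *: mxC V) ^+ i) (\sum_(j < q) (y *: mxC W) ^+ j).
  apply: commr_sum => j _; apply: commr_sym; apply: commr_sum => i _.
  apply: commrX; apply: commr_sym; apply: commrX.
  by rewrite /GRing.comm -![_ * _]/(_ *m _) -!scalemxAl -!scalemxAr [mxC V *m _]cVW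
    scalerA mulrC -scalerA.
rewrite -trace_idem_scale ?muln_gt0 ?p0 //; last first.
  rewrite -[_ *m _]/(_ * _) /joint_proj mulrA -[_ * _ * \sum_(i < p) _]mulrA -cs.
  rewrite mulrA sum_powers_idem // -mulrA sum_powers_idem //.
  by rewrite mulrnAl mulrnAr -mulrnA mulnC.
rewrite /joint_proj mulr_suml raddf_sum; apply: eq_bigr => i _ /=.
rewrite mulr_sumr raddf_sum; apply: eq_bigr => j _ /=.
rewrite !sX -[RHS]/(\tr (_ *m _)) -scalemxAl -scalemxAr !mxtraceZ mulrA.
by rewrite -!mxC_X -map_mxM trace_mxC.
Qed.

Let t i j : int := \tr (V ^+ i * W ^+ j).

Lemma joint_sum (x y : algC) (sx sy : int) :
    \sum_(i < p | (i : nat) != 0%N) x ^+ i = sx%:~R ->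
    \sum_(j < q | (j : nat) != 0%N) y ^+ j = sy%:~R ->
  \sum_(i < p) \sum_(j < q) x ^+ i * y ^+ j * (\tr (V ^+ i * W ^+ j))%:~R =
    (t 0 0 + sx * t 1 0 + sy * t 0 1 + sx * sy * t 1 1)%:~R.
Proof.
move=> sxE syE; have p0 := prime_gt0 p_pr; have q0 := prime_gt0 q_pr.
have row (i : 'I_p) : \sum_(j < q) x ^+ i * y ^+ j * (\tr (V ^+ i * W ^+ j))%:~R =
    x ^+ i * (t (i != 0%N :> nat) 0 + sy * t (i != 0%N :> nat) 1)%:~R.
  rewrite (bigD1 (Ordinal q0)) //= expr0 mulr1 trace_joint //= intrD mulrDr.
  congr (_ + _). rewrite intrM -syE !(mulr_suml, mulr_sumr).
  apply: eq_big => [j|j j0]; first by rewrite -val_eqE.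
  have j0' : ((j : nat) != 0%N) by rewrite -[0%N]/(val (Ordinal q0)) val_eqE.
  by rewrite trace_joint // j0' mulrA.
rewrite (eq_bigr _ (fun i _ => row i)) (bigD1 (Ordinal p0)) //= expr0 mul1r.
set S := \sum_(i < p | _) _.
have -> : S = sx%:~R * (t 1 0 + sy * t 1 1)%:~R.
  rewrite -sxE mulr_suml; apply: eq_big => [i|i i0]; first by rewrite -val_eqE.
  by have -> : ((i : nat) != 0%N) by rewrite -[0%N]/(val (Ordinal p0)) val_eqE.
by rewrite -intrM -intrD; congr (_ %:~R); ring.
Qed.

(** The multiplicities of the joint eigenvalues, which are ranks of projections and hence
    natural numbers. By Galois invariance there are only four of them, according to which
    of the two eigenvalues are trivial. *)
Theorem joint_multiplicities :
  exists m ma mb mab : nat,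
  [/\ (p * q * m)%:Z = d%:Z + (p%:Z - 1) * t 1 0 + (q%:Z - 1) * t 0 1
                       + (p%:Z - 1) * (q%:Z - 1) * t 1 1,
      (p * q * ma)%:Z = d%:Z - t 1 0 + (q%:Z - 1) * t 0 1 - (q%:Z - 1) * t 1 1,
      (p * q * mb)%:Z = d%:Z + (p%:Z - 1) * t 1 0 - t 0 1 - (p%:Z - 1) * t 1 1,
      (p * q * mab)%:Z = d%:Z - t 1 0 - t 0 1 + t 1 1
    & (exists2 x : 'rV[int]_d, x != 0 & x *m V = x /\ x *m W = x) -> (0 < m)%N].
Proof.
have p0 := prime_gt0 p_pr; have q0 := prime_gt0 q_pr.
have [a aP] := C_prim_root_exists p0; have [b bP] := C_prim_root_exists q0.
have t00 : t 0 0 = d%:Z by rewrite /t !expr0 mulr1 mxtrace1 natz.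
have sum1 n : (0 < n)%N -> \sum_(i < n | (i : nat) != 0%N) 1 ^+ i = (n%:Z - 1)%:~R :> algC.
  by move=> n0; rewrite sum_one_powers // intrB.
have ap := prim_expr_order aP; have bq := prim_expr_order bP.
have sa : \sum_(i < p | (i : nat) != 0%N) a ^+ i = (-1)%:~R.
  exact: sum_root_powers p0 ap (prim_root_neq1 (prime_gt1 p_pr) aP).
have sb : \sum_(i < q | (i : nat) != 0%N) b ^+ i = (-1)%:~R.
  exact: sum_root_powers q0 bq (prim_root_neq1 (prime_gt1 q_pr) bP).
have key x y sx sy : x ^+ p = 1 -> y ^+ q = 1 ->
    \sum_(i < p | (i : nat) != 0%N) x ^+ i = sx%:~R ->
    \sum_(j < q | (j : nat) != 0%N) y ^+ j = sy%:~R ->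
    (p * q * \rank (joint_proj x y))%:Z =
      d%:Z + sx * t 1 0 + sy * t 0 1 + sx * sy * t 1 1.
  move=> xp yq xs ys; apply: (@intr_inj algC).
  by rewrite -t00 -(joint_sum xs ys) joint_proj_trace.
exists (\rank (joint_proj 1 1)), (\rank (joint_proj a 1)).
exists (\rank (joint_proj 1 b)), (\rank (joint_proj a b)).
split.
- by rewrite (key _ _ (p%:Z - 1) (q%:Z - 1)) ?expr1n ?sum1.
- rewrite (key _ _ (- 1) (q%:Z - 1)) ?expr1n ?sum1 //; ring.
- rewrite (key _ _ (p%:Z - 1) (- 1)) ?expr1n ?sum1 //; ring.
- rewrite (key _ _ (- 1) (- 1)) ?expr1n ?sum1 //; ring.
case=> x x0 [xV xW]; rewrite lt0n mxrank_eq0; apply: contra x0 => /eqP E0.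
pose X : 'rV[algC]_d := map_mx intr x.
have XV : X *m mxC V = X by rewrite -map_mxM xV.
have XW : X *m mxC W = X by rewrite -map_mxM xW.
have XE : X = map_mx intr x by [].
clearbody X; have fixX n A : X *m A = X -> X *m (\sum_(i < n) (1 *: A) ^+ i) = X *+ n.
  move=> XA; rewrite mulmx_sumr (eq_bigr (fun=> X)) ?sumr_const ?card_ord // => i _.
  rewrite scale1r; elim: (val i) => [|k IHk]; first by rewrite expr0 mulmx1.
  by rewrite exprS -[_ * _]/(_ *m _) mulmxA XA.
have : X *m joint_proj 1 1 = 0 by rewrite E0 mulmx0.
rewrite /joint_proj -[_ * _]/(_ *m _) mulmxA fixX // -scaler_nat -scalemxAl.
rewrite fixX // scaler_nat -mulrnA => /eqP; rewrite -scaler_nat scaler_eq0.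
rewrite pnatr_eq0 eqn0Ngt muln_gt0 p0 q0 /= => /eqP/matrixP X0.
apply/eqP/matrixP=> i j; have := X0 i j; rewrite XE !mxE => /eqP.
by rewrite intr_eq0 => /eqP.
Qed.

End JointMultiplicities.

(** * Units of order [r] in almost simple groups *)

Section AlmostSimple.

Local Open Scope ring_scope.

(** Here [m] is the multiplicity of the eigenvalue [-1]. *)
Lemma det_involution (d : nat) (P : 'M[int]_d) :
    P ^+ 2 = 1 ->
  exists m : nat, \tr P = d%:Z - m%:Z *+ 2 /\ \det P = (-1) ^+ m.
Proof.
move=> P2; have [z zP] := C_prim_root_exists (isT : (0 < 2)%N).
have PC2 : mxC P ^+ 2 = 1 by rewrite -mxC_X P2; exact: map_mx1.
have [Q [D [Qu PE D2]]] := finite_order_diag zP PC2.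
have n1 : (1 == -1 :> algC) = false.
  by rewrite -subr_eq0 opprK; exact: (pnatr_eq0 algC 2).
have DE k : D 0 k = 1 - (D 0 k == -1)%:R *+ 2.
  have := D2 k; move/eqP; rewrite sqrf_eq1 => /orP[]/eqP ->.
    by rewrite n1 mul0rn subr0.
  by rewrite eqxx mulr2n opprD addrA subrr add0r.
have DE' k : D 0 k = (-1) ^+ (D 0 k == -1).
  have := D2 k; move/eqP; rewrite sqrf_eq1 => /orP[]/eqP ->.
    by rewrite n1 expr0.
  by rewrite eqxx expr1.
exists (\sum_k (D 0 k == -1)%R)%N; split; apply: (@intr_inj algC).
  rewrite -trace_mxC PE mxtrace_mulC mulmxA mulmxV // mul1mx mxtrace_diag.
  rewrite (eq_bigr _ (fun k _ => DE k)) sumrB sumr_const card_ord sumrMnl.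
  by rewrite rmorphB rmorphMn /= -!pmulrn -natr_sum.
rewrite -det_map_mx -/(mxC P) PE !det_mulmx det_inv mulrC mulrA mulrV ?mul1r; last first.
  by rewrite -unitmxE.
rewrite det_diag (eq_bigr _ (fun k _ => DE' k)) prodrXr rmorphXn.
by rewrite /= rmorphN1.
Qed.

Variables (r : nat) (gT : finGroupType) (A : gT -> 'M['F_r]_2).
Hypotheses (r_pr : prime r) (r5 : (5 <= r)%N).
Hypothesis A_det : forall g, \det (A g) != 0.
Hypothesis A_mul : forall g h, peq (A (g * h)%g) (A g *m A h).
Hypothesis A_scal : forall g, is_scalar_mx (A g) = (g == 1%g).

Definition line_act g : option 'F_r -> option 'F_r := moebius (A g).

Lemma line_actM g h : line_act (g * h)%g =1 line_act g \o line_act h.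
Proof. by move=> o; rewrite /line_act (moebius_peq (A_mul g h)) moebiusM. Qed.

Lemma line_act1 : line_act 1%g =1 id.
Proof. by apply: moebius_scalar; rewrite ?A_scal. Qed.

Lemma line_actX g k : iter k (line_act g) =1 line_act (g ^+ k)%g.
Proof.
move=> o; elim: k => [|k IHk] /=; first by rewrite expg0 line_act1.
by rewrite IHk expgS line_actM.
Qed.

Definition line_fix g : nat := #|[set o | line_act g o == o]|.

Lemma line_fix_le2 g : g != 1%g -> (line_fix g <= 2)%N.
Proof. by move=> g1; apply: moebius_fix_le2; rewrite A_scal. Qed.

Lemma card_line : #|{: option 'F_r}| = r.+1.
Proof. by rewrite card_option card_Fp. Qed.

Lemma line_fix_mod g l : prime l -> #[g]%g = l -> (line_fix g = r.+1 %[mod l])%N.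
Proof.
move=> l_pr gl; rewrite -card_line; apply: card_fix_mod => // o.
by rewrite line_actX -gl expg_order line_act1.
Qed.

Definition line_mx g : 'M[int]_#|{: option 'F_r}| := fun_mx int (line_act g).

Lemma line_mx1 : line_mx 1%g = 1.
Proof. by rewrite /line_mx (eq_fun_mx _ line_act1); exact: fun_mx_id. Qed.

Lemma line_mxM : {morph line_mx : g h / (g * h)%g >-> g * h}.
Proof. by move=> g h; rewrite /line_mx (eq_fun_mx _ (line_actM g h)); exact: fun_mx_comp. Qed.

Lemma trace_line_mx g : \tr (line_mx g) = (line_fix g)%:R.
Proof. by rewrite trace_fun_mx. Qed.

Lemma line_fixJ x y : line_fix (x ^ y)%g = line_fix x.
Proof.
have trC g h : \tr (line_mx (g * h)%g) = \tr (line_mx (h * g)%g).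
  by rewrite !line_mxM; exact: mxtrace_mulC.
have := trC y^-1%g (x * y)%g; rewrite -conjgE -mulgA mulgV mulg1.
by rewrite [LHS]trace_line_mx [RHS]trace_line_mx => /eqP; rewrite eqr_nat => /eqP.
Qed.

Lemma trace_line_lift a :
  \tr (gr_lift line_mx a) = gr_lift (fun g => (line_fix g)%:R) a.
Proof. by rewrite gr_lift_comp; apply: eq_gr_lift => g /=; rewrite trace_line_mx. Qed.

(** The columns of a permutation matrix add up to one. *)
Lemma line_mx_fixed a : (const_mx 1 : 'rV[int]__) *m gr_lift line_mx a = const_mx (aug a).
Proof.
rewrite augE mulmx_sumr; apply/matrixP=> i j; rewrite summxE mxE.
apply: eq_bigr => g _; rewrite mxE.
under eq_bigr do rewrite mulmzE mxE mul1r.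
rewrite -mulrz_suml; congr (_ *~ _).
rewrite (bigD1 (enum_rank (line_act g (enum_val j)))) //= mxE enum_rankK eqxx.
rewrite big1 ?addr0 // => k kj; rewrite mxE; case: eqP => // kE.
by rewrite -kE enum_valK eqxx in kj.
Qed.

(** An involution of [gT] has no or two fixed points, and its sign as a permutation tells
    which. The sign extends to a ring morphism, with value [1] or [-1] at [w], and on
    involutions it is, up to a constant sign, the number of fixed points minus one. *)
Lemma line_trace_involution w :
    w ^+ 2 = 1 -> w != 1 -> aug w = 1 ->
  \tr (gr_lift line_mx w) = 0 \/ \tr (gr_lift line_mx w) = 2.
Proof.
move=> w2 w1 aug1; pose delta g := \det (line_mx g).
have r_odd : odd r by case: (even_prime r_pr) r5 => [->|].
pose eps : int := (-1) ^+ r.-1./2.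
have dinv g : #[g]%g = 2%N -> delta g = eps * ((line_fix g)%:R - 1).
  move=> g2; have [|m [trm detm]] := @det_involution _ (line_mx g).
    by rewrite expr2 -line_mxM -[(g * g)%g]/(g ^+ 2)%g -g2 expg_order line_mx1.
  rewrite /delta detm; move: trm; rewrite trace_line_mx card_line.
  have g1 : g != 1%g by rewrite -order_eq1 g2.
  have := line_fix_mod (isT : prime 2) g2; have := line_fix_le2 g1; rewrite /eps.
  case: (line_fix g) => [|[|[|f]]] // _; rewrite !modn2 /= ?r_odd //.
    move=> _ trm; have -> : m = (r.-1./2).+1 by lia.
    by rewrite exprS sub0r mulrC.
  move=> _ trm; have -> : m = r.-1./2 by lia.
  by rewrite (_ : 2 - 1 = 1) ?mulr1.
have dM : {morph delta : g h / (g * h)%g >-> g * h}.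
  by move=> g h; rewrite /delta line_mxM -[_ * _]/(_ *m _) det_mulmx.
have d1 : delta 1%g = 1 by rewrite /delta line_mx1 det1.
clearbody delta; have dJ x y : delta (x ^ y)%g = delta x.
  by rewrite conjgE !dM mulrC -mulrA -dM mulgV d1 mulr1.
have dw : gr_lift delta w ^+ 2 = 1 by rewrite -gr_liftX // w2 gr_lift1.
have E : gr_lift delta w = eps * (\tr (gr_lift line_mx w) - 1).
  have L (f : gT -> int) (cf : forall x y, f (x ^ y)%g = f x) :=
    prime_unit_lift cf (isT : prime 2) w2 w1 aug1.
  have fJ x y : (line_fix (x ^ y)%g)%:R = (line_fix x)%:R :> int by rewrite line_fixJ.
  have one : 1 = gr_lift (fun _ : gT => 1 : int) w by rewrite -[LHS]aug1; exact: augE.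
  rewrite trace_line_lift [X in _ - X]one (L _ dJ) (L _ fJ) (L (fun=> 1) (fun _ _ => erefl)).
  rewrite -sumrB mulr_sumr; apply: eq_bigr => g /eqP/dinv ->.
  by rewrite -mulrzBl mulrzAr.
move: dw; rewrite E exprMn sqrr_sign mul1r => /eqP.
rewrite sqrf_eq1 => /orP[]/eqP e; [right|left].
  by rewrite -[LHS](subrK 1) e.
by rewrite -[LHS](subrK 1) e.
Qed.

Lemma line_trace_const a l c :
    prime l -> a ^+ l = 1 -> a != 1 -> aug a = 1 ->
    (forall g, #[g]%g = l -> line_fix g = c) ->
  \tr (gr_lift line_mx a) = c%:Z.
Proof.
move=> l_pr al a1 aug1 fc; rewrite trace_line_lift -natz.
have fJ x y : (line_fix (x ^ y)%g)%:R = (line_fix x)%:R :> int by rewrite line_fixJ.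
have fE g : #[g]%g = l -> (line_fix g)%:R = c%:R :> int by move=> /fc ->.
exact: (prime_unit_lift_const fJ l_pr al a1 aug1 fE).
Qed.

(** On the projective line a unit of order [r] has trace one and a unit of
    another prime order has trace at most two; this is incompatible with the four joint
    multiplicities being natural numbers. *)
Theorem no_edge_at_r q (v w : integral_group_ring gT) :
    prime q -> r != q -> v ^+ r = 1 -> v != 1 -> aug v = 1 ->
    w ^+ q = 1 -> w != 1 -> aug w = 1 -> v * w = w * v ->
  False.
Proof.
move=> q_pr rq vr v1 augv wq w1 augw vw.
pose V := gr_lift line_mx v; pose W := gr_lift line_mx w.
have VW : V * W = W * V by rewrite -!(gr_liftM _ _ line_mxM) vw.
have Vr : V ^+ r = 1 by rewrite -(gr_liftX _ _ line_mx1 line_mxM) vr gr_lift1 ?line_mx1.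
have Wq : W ^+ q = 1 by rewrite -(gr_liftX _ _ line_mx1 line_mxM) wq gr_lift1 ?line_mx1.
have trV : \tr V = 1.
  apply: (line_trace_const (c := 1) r_pr vr v1 augv) => g gr.
  have g1 : g != 1%g by rewrite -order_eq1 gr; lia.
  have := line_fix_mod r_pr gr; rewrite -[r.+1]addn1 modnDl.
  by have := line_fix_le2 g1; case: line_fix => [|[|[|]]] // _;
    rewrite ?mod0n !modn_small //; lia.
(* An odd prime [q] exceeds the number of fixed points, which is then constant on
   elements of order [q]. *)
have [tau tauE [tau2 tau0]] : exists2 tau : nat, \tr W = tau%:Z &
    (tau <= 2)%N /\ (q = 2%N -> tau = 0%N \/ tau = 2%N).
  have [q2|q2] := eqVneq q 2%N.
    rewrite q2 in wq; case: (line_trace_involution wq w1 augw) => trW.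
      by exists 0%N => //; split=> // _; left.
    by exists 2%N => //; split=> // _; right.
  have q3 : (2 < q)%N by rewrite ltn_neqAle eq_sym q2 prime_gt1.
  have [g /eqP gq|no] := pickP (fun g : gT => #[g]%g == q).
    have le2 h : #[h]%g = q -> (line_fix h <= 2)%N.
      by move=> hq; apply: line_fix_le2; rewrite -order_eq1 hq; lia.
    exists (line_fix g); last by split=> [|e]; [exact: le2 | rewrite e in q2].
    apply: (line_trace_const q_pr wq w1 augw) => h hq.
    have := line_fix_mod q_pr hq; rewrite -(line_fix_mod q_pr gq).
    rewrite (modn_small (leq_ltn_trans (le2 h hq) q3)).
    by rewrite (modn_small (leq_ltn_trans (le2 g gq) q3)).
  exists 0%N; last by split=> // e; rewrite e in q2.
  by apply: (line_trace_const q_pr wq w1 augw) => h /eqP; rewrite no.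
have [m [ma [mb [mab []]]]] := joint_multiplicities r_pr q_pr rq VW Vr Wq.
have t10 : \tr (V ^+ 1 * W ^+ 0) = 1 by rewrite expr0 mulr1.
have t01 : \tr (V ^+ 0 * W ^+ 1) = tau by rewrite expr0 mul1r.
rewrite t10 t01; move: (\tr _).
move=> X Em Ea Eb Eab fix_m; have m0 : (0 < m)%N.
  apply: fix_m; exists (const_mx 1).
    apply/eqP=> /matrixP/(_ 0 (enum_rank None)); rewrite !mxE => /eqP.
    by rewrite oner_eq0.
  by rewrite !line_mx_fixed augv augw.
have q1 := prime_gt1 q_pr.
rewrite card_line !PoszM in Em Ea Eb Eab.
have rq0 : r%:Z * q%:Z != 0 by rewrite mulf_neq0 // -lt0n; lia.
(* The multiplicities over the eigenvalues of [V]: a non-trivial one occurs once, the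
   trivial one twice. *)
have K1 : ma%:Z + (q%:Z - 1) * mab%:Z = 1.
  apply: (mulfI rq0); transitivity (r%:Z * q%:Z * ma + (q%:Z - 1) * (r%:Z * q%:Z * mab)).
    by ring.
  by rewrite Ea Eab intS; ring.
have K2 : m%:Z + (q%:Z - 1) * mb%:Z = 2.
  apply: (mulfI rq0); transitivity (r%:Z * q%:Z * m + (q%:Z - 1) * (r%:Z * q%:Z * mb)).
    by ring.
  by rewrite Em Eb intS; ring.
(* The multiplicity of the trivial eigenvalue of [W]. *)
have K3 : q%:Z * (m%:Z + (r%:Z - 1) * ma%:Z) = r%:Z + 1 + (q%:Z - 1) * tau%:Z.
  have r0 : r%:Z != 0 by lia.
  apply: (mulfI r0); transitivity (r%:Z * q%:Z * m + (r%:Z - 1) * (r%:Z * q%:Z * ma)).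
    by ring.
  by rewrite Em Ea intS; ring.
clear Em Ea Eb Eab tauE t01 t10 trV.
have m2 : (m <= 2)%N.
  by have : 0 <= (q%:Z - 1) * mb%:Z; [apply: mulr_ge0; lia | lia].
case: ma K1 K3 => [|ma] K1 K3; last first.
  have ma0 : ma = 0%N.
    by have : 0 <= (q%:Z - 1) * mab%:Z; [apply: mulr_ge0; lia | lia].
  rewrite ma0 mulr1 in K3.
  have h1 : 0 <= q%:Z * (m%:Z - 1) by apply: mulr_ge0; lia.
  have h2 : 0 <= (q%:Z - 1) * (2 - tau%:Z) by apply: mulr_ge0; lia.
  have h3 : 0 <= (q%:Z - 2) * (r%:Z - 2) by apply: mulr_ge0; lia.
  by move: K3 h1 h2 h3; rewrite !(mulrDl, mulrDr, mulrN, mulNr, mul1r, mulr1); lia.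
have q2 : q = 2%N.
  case: mab K1 => [|k] K1; first by lia.
  by have : 0 <= (q%:Z - 1) * k%:Z; [apply: mulr_ge0; lia | lia].
by case: (tau0 q2) => e; rewrite q2 e in K3; lia.
Qed.

End AlmostSimple.

(** * The Galois action on partial augmentations *)

Section GaloisAction.

Local Open Scope ring_scope.

(** Impose the residue one modulo the part of [N] prime to [m]. *)
Lemma coprime_residue (k m N : nat) :
    coprime k m -> (0 < m)%N -> (0 < N)%N ->
  exists2 k', (k' = k %[mod m])%N & coprime k' (m * N).
Proof.
move=> km m0 N0; have [->|m1] := eqVneq m 1%N.
  by exists 1%N; rewrite ?modn1 // coprime1n.
pose M := (N`_(\pi(m)^'))%N.
have mM : coprime m M.
  by rewrite coprime_sym (pnat_coprime (part_pnat _ _)) // pnatNK pnat_pi.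
exists (chinese m M k 1); first exact: chinese_modl.
have cm : coprime (chinese m M k 1) m.
  by rewrite -coprime_modl chinese_modl // coprime_modl.
have cM : coprime (chinese m M k 1) M.
  by rewrite -coprime_modl chinese_modr // coprime_modl coprime1n.
rewrite coprimeMr cm -(partnC \pi(m) N0) coprimeMr cM andbT.
rewrite coprime_sym; apply: (@pnat_coprime \pi(m)); first exact: part_pnat.
have k0 : (0 < chinese m M k 1)%N.
  by rewrite lt0n; apply: contra m1 => /eqP k0; move: cm; rewrite k0 /coprime gcd0n.
rewrite /pnat k0; apply/allP=> l; rewrite mem_primes => /and3P[l_pr _ lk].
rewrite inE /= mem_primes l_pr m0 /=; apply: contraL lk => lm.
by rewrite -prime_coprime // coprime_sym (coprime_dvdr lm).
Qed.

Variable gT : finGroupType.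
Implicit Types (a b v w : integral_group_ring gT) (x y : gT).

(** Galois invariance: by [csum_coprime_pow] the units [a ^+ k] and [b], obtained from [a]
    by raising the group elements to the power [k], have the same partial
    augmentations. *)
Lemma gr_lift_coprime_pow (V : zmodType) (f : gT -> V) a n k :
    (forall x y, f (x ^ y)%g = f x) ->
    a ^+ n = 1 -> (0 < n)%N -> coprime k (n * #|gT|) ->
  gr_lift f (a ^+ k) = gr_lift (fun x => f (x ^+ k)%g) a.
Proof.
move=> fJ an n0; rewrite coprimeMr => /andP[kn kG].
have kG' : coprime #|[set: gT]| k by rewrite cardsT coprime_sym.
have injk : injective (fun x : gT => x ^+ k)%g.
  by move=> x y; apply: (can_in_inj (expgK kG')); rewrite inE.
have expJ x y : ((x ^ y) ^+ k = (x ^+ k) ^ y)%g by rewrite conjXg.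
pose b : integral_group_ring gT := gr_lift (fun x => gr_of (x ^+ k)%g) a.
have bE x : b (x ^+ k)%g = a x.
  rewrite /b /gr_lift sum_ffunE (bigD1 x) //= big1 ?addr0 => [|y yx].
    by rewrite ffunMzE ffunE eqxx mulrzz mul1r.
  by rewrite ffunMzE ffunE eq_sym (inj_eq injk) (negPf yx) mul0rz.
have -> : gr_lift f (a ^+ k) = gr_lift f b.
  apply/eqP; rewrite -subr_eq0 -gr_liftB; apply/eqP/gr_lift_class0 => // x0.
  have [x ->] : exists x, x0 = (x ^+ k)%g.
    by have [g _ gK] := injF_bij injk; exists (g x0); rewrite gK.
  apply/eqP; rewrite csumB subr_eq0; apply/eqP.
  have N0 : (0 < n * #|gT|)%N by rewrite muln_gt0 n0 -cardsT cardG_gt0.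
  rewrite (@csum_coprime_pow _ a x (n * #|gT|) k) // ?coprimeMr ?kn //.
  - by apply: eq_bigr => m _; rewrite -expJ bE.
  - by rewrite exprM an expr1n.
  by apply/eqP; rewrite -order_dvdn dvdn_mull // -cardsT order_dvdG ?inE.
by rewrite /gr_lift (reindex_inj injk) /=; apply: eq_bigr => x _; rewrite bE.
Qed.

Lemma gr_lift_inv (V : zmodType) (f : gT -> V) a n :
    (forall x y, f (x ^ y)%g = f x) -> (forall x, f x^-1%g = f x) ->
    a ^+ n = 1 -> (0 < n)%N ->
  gr_lift f (a ^+ n.-1) = gr_lift f a.
Proof.
move=> fJ fV an n0; pose N := (n * #|gT|)%N.
have N0 : (0 < N)%N by rewrite muln_gt0 n0 -cardsT cardG_gt0.
have aN : a ^+ N = 1 by rewrite exprM an expr1n.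
have -> : a ^+ n.-1 = a ^+ N.-1.
  rewrite -[LHS]mulr1 -aN -exprD -[RHS]mulr1 -an -exprD; congr (_ ^+ _).
  by rewrite /N in N0 *; lia.
rewrite (gr_lift_coprime_pow fJ an n0) ?coprimePn // ?eq_gr_lift //.
apply: eq_gr_lift => x; rewrite -[RHS]fV; congr f.
apply/esym/eqP; rewrite eq_invg_mul -expgS prednK // -order_dvdn dvdn_mull //.
by rewrite -cardsT order_dvdG ?inE.
Qed.

Section MixedUnits.

Variables (p q : nat) (v w : integral_group_ring gT).
Hypotheses (p_pr : prime p) (q_pr : prime q) (pq : p != q).
Hypotheses (vp : v ^+ p = 1) (wq : w ^+ q = 1) (vw : v * w = w * v).
Hypotheses (v1 : v != 1) (augv : aug v = 1).

Lemma mixed_exp k : (v * w) ^+ k = v ^+ k * w ^+ k.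
Proof. exact: exprMn_comm. Qed.

Lemma mixed_order : (v * w) ^+ (p * q) = 1.
Proof. by rewrite mixed_exp exprM vp mulnC exprM wq !expr1n mulr1. Qed.

(** Galois invariance with an exponent congruent to [k] modulo [q] and to one modulo the
    order of [x]. *)
Lemma csum_mixed_power (x : gT) j k : #[x]%g = (p ^ j)%N -> (0 < k < q)%N ->
  csum (v * w ^+ k) x = csum (v * w) x.
Proof.
move=> xj /andP[k0 kq]; pose N := (p ^ j.+1)%N.
have p0 := prime_gt0 p_pr; have q0 := prime_gt0 q_pr.
have N0 : (0 < N)%N by rewrite expn_gt0 p0.
have co_qN : coprime q N by rewrite coprimeXr // prime_coprime // dvdn_prime2 // eq_sym.
pose h := chinese q N k 1.
have hq : (h = k %[mod q])%N by apply: chinese_modl.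
have hN : (h = 1 %[mod N])%N by apply: chinese_modr.
have pN : (p %| N)%N by rewrite /N expnS dvdn_mulr.
have xN : (#[x]%g %| N)%N by rewrite xj /N expnS dvdn_mull.
have mod1 l : (l %| N)%N -> (h = 1 %[mod l])%N.
  by move=> lN; rewrite -(modn_dvdm _ lN) hN modn_dvdm.
have <- : (v * w) ^+ h = v * w ^+ k.
  rewrite mixed_exp -(expr_mod _ vp) mod1 // (expr_mod _ vp) expr1.
  by rewrite -(expr_mod _ wq) hq (expr_mod _ wq).
have {1}<- : (x ^+ h = x)%g.
  by rewrite -[RHS]expg1; apply/eqP; rewrite eq_expg_mod_order mod1.
apply: (@csum_coprime_pow _ _ _ (q * N)); rewrite ?muln_gt0 ?q0 //.
- by rewrite mulnC -(divnK pN) -mulnA exprM exprAC mixed_order expr1n.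
- by apply/eqP; rewrite -order_dvdn dvdn_mull.
rewrite coprimeMr -coprime_modl hq coprime_modl -[X in _ && X]coprime_modl hN.
rewrite coprime_modl coprime1n andbT coprime_sym prime_coprime //.
by rewrite gtnNdvd.
Qed.

(** In the vanishing sum of [csum_large_order] the term for the exponent zero vanishes, and
    the other ones are equal. *)
Lemma csum_mixed_primary (x : gT) j : #[x]%g = (p ^ j)%N -> (1 < j)%N ->
  csum (v * w) x = 0.
Proof.
move=> xj j1; have q0 := prime_gt0 q_pr; have q1 := prime_gt1 q_pr.
have co : coprime q p by rewrite prime_coprime // dvdn_prime2 // eq_sym.
have := csum_large_order p_pr co q0 vp wq vw xj j1.
rewrite (bigD1 (Ordinal q0)) //= expr0 mulr1 (prime_unit_support p_pr vp v1 augv); last first.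
  rewrite xj; apply: contraTneq j1 => e; rewrite -leqNgt.
  by rewrite -(leq_exp2l _ _ (prime_gt1 p_pr)) e expn1.
rewrite add0r (eq_bigr (fun=> csum (v * w) x)) => [|k k0].
  rewrite sumr_const => /eqP; rewrite -mulr_natr mulf_eq0 => /orP[/eqP //|].
  by rewrite pnatr_eq0 cardC1 card_ord; case: (q) q1 => [|[|]].
apply: csum_mixed_power xj _.
by rewrite ltn_ord andbT lt0n; apply: contra k0 => /eqP e; apply/eqP/val_inj.
Qed.

End MixedUnits.

(** By [csum_new_prime] and the hypothesis on [pq] the order of [x] is a power of [p] or
    of [q], and [csum_mixed_primary] excludes proper powers. *)
Theorem mixed_unit_support (p q : nat) (v w : integral_group_ring gT) (x : gT) :
    prime p -> prime q -> p != q ->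
    v ^+ p = 1 -> w ^+ q = 1 -> v * w = w * v ->
    v != 1 -> w != 1 -> aug v = 1 -> aug w = 1 ->
    (forall y : gT, #[y]%g <> (p * q)%N) ->
    #[x]%g != p -> #[x]%g != q ->
  csum (v * w) x = 0.
Proof.
move=> p_pr q_pr pq vp wq vw v1 w1 augv augw no xp xq.
have p0 := prime_gt0 p_pr; have q0 := prime_gt0 q_pr.
have pq0 : (0 < p * q)%N by rewrite muln_gt0 p0.
have u_pq := mixed_order vp wq vw.
have [-> | x1] := eqVneq x 1%g.
  rewrite csum1 (berman_higman u_pq) ?rmorphM /= ?augv ?augw ?mulr1 ?mul0rn //.
  apply: contra v1 => /eqP u1; apply/eqP.
  apply: (expr_coprime_eq1 (m := p) (n := q)) => //.
    by rewrite prime_coprime // dvdn_prime2.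
  by rewrite -[LHS]mulr1 -wq -(mixed_exp vw) u1 expr1n.
have no_pq : ~~ ((p * q) %| #[x]%g)%N.
  by apply/negP=> /order_dvd_exists[y /no].
have [pi_x|] := boolP (pnat (pred2 p q) #[x]%g); last first.
  rewrite /pnat order_gt0 => /allPn[l]; rewrite mem_primes => /and3P[l_pr _ lx] l_pq.
  apply: (csum_new_prime u_pq pq0 l_pr _ lx); rewrite Euclid_dvdM // !dvdn_prime2 //.
have [px|px] := boolP (p %| #[x]%g)%N.
  have qx : ~~ (q %| #[x]%g)%N.
    apply: contra no_pq => qx; rewrite Gauss_dvd ?px // prime_coprime // dvdn_prime2 //.
  have /p_natP[j xj] : (p.-nat #[x]%g)%N.
    rewrite /pnat order_gt0; apply/allP=> l lx; rewrite inE /=.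
    have := allP (proj2 (andP pi_x)) l lx; rewrite inE => /orP[//|/eqP lq].
    by move: lx qx; rewrite lq mem_primes => /and3P[_ _ ->].
  have j1 : (1 < j)%N.
    case: j xj => [|[|j]] // xj; last by rewrite xj expn1 eqxx in xp.
    by rewrite -order_eq1 xj expn0 in x1.
  exact: (csum_mixed_primary p_pr q_pr pq vp wq vw v1 augv xj j1).
have /p_natP[j xj] : (q.-nat #[x]%g)%N.
  rewrite /pnat order_gt0; apply/allP=> l lx; rewrite inE /=.
  have := allP (proj2 (andP pi_x)) l lx; rewrite inE => /orP[/eqP lp|//].
  by move: lx px; rewrite lp mem_primes => /and3P[_ _ ->].
have j1 : (1 < j)%N.
  case: j xj => [|[|j]] // xj; last by rewrite xj expn1 eqxx in xq.
  by rewrite -order_eq1 xj expn0 in x1.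
have qp : q != p by rewrite eq_sym.
by rewrite vw; exact: (csum_mixed_primary q_pr p_pr qp wq vp (esym vw) w1 augw xj j1).
Qed.

End GaloisAction.

(** * Symmetric powers and modular characters *)

Section SymmetricPowers.

Local Open Scope ring_scope.

Section Entries.

Variable R : comNzRingType.
Implicit Types (a b c d : R) (A B : 'M[R]_2).

(** The action on binary forms of degree [n = 2] and [n = 4]: the row of index [i] lists
    the coefficients of [(a X + b Y)^(n - i) (c X + d Y)^i]. *)
Definition sym2_row a b c d (i : nat) : seq R :=
  nth [::] [:: [:: a ^+ 2; a * b *+ 2; b ^+ 2];
               [:: a * c; a * d + b * c; b * d];
               [:: c ^+ 2; c * d *+ 2; d ^+ 2]] i.

Definition sym2_mx A : 'M[R]_3 :=
  \matrix_(i, j) (sym2_row (A 0 0) (A 0 1) (A 1 0) (A 1 1) i)`_j.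

Definition sym4_row a b c d (i : nat) : seq R :=
  nth [::]
    [:: [:: a ^+ 4; a ^+ 3 * b *+ 4; a ^+ 2 * b ^+ 2 *+ 6; a * b ^+ 3 *+ 4; b ^+ 4];
        [:: a ^+ 3 * c; a ^+ 3 * d + a ^+ 2 * b * c *+ 3;
            a ^+ 2 * b * d *+ 3 + a * b ^+ 2 * c *+ 3;
            a * b ^+ 2 * d *+ 3 + b ^+ 3 * c; b ^+ 3 * d];
        [:: a ^+ 2 * c ^+ 2; a ^+ 2 * c * d *+ 2 + a * b * c ^+ 2 *+ 2;
            a ^+ 2 * d ^+ 2 + a * b * c * d *+ 4 + b ^+ 2 * c ^+ 2;
            a * b * d ^+ 2 *+ 2 + b ^+ 2 * c * d *+ 2; b ^+ 2 * d ^+ 2];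
        [:: a * c ^+ 3; a * c ^+ 2 * d *+ 3 + b * c ^+ 3;
            a * c * d ^+ 2 *+ 3 + b * c ^+ 2 * d *+ 3;
            a * d ^+ 3 + b * c * d ^+ 2 *+ 3; b * d ^+ 3];
        [:: c ^+ 4; c ^+ 3 * d *+ 4; c ^+ 2 * d ^+ 2 *+ 6; c * d ^+ 3 *+ 4; d ^+ 4]] i.

Definition sym4_mx A : 'M[R]_5 :=
  \matrix_(i, j) (sym4_row (A 0 0) (A 0 1) (A 1 0) (A 1 1) i)`_j.

Lemma sym2_mxM A B : sym2_mx (A *m B) = sym2_mx A *m sym2_mx B.
Proof.
apply/matrixP=> i j; rewrite mxE !mulmxE2 [RHS]mxE !big_ord_recl big_ord0 addr0 !mxE.
move: (A 0 0) (A 0 1) (A 1 0) (A 1 1) (B 0 0) (B 0 1) (B 1 0) (B 1 1).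
move=> a b c d a' b' c' d'.
by case: i => [[|[|[|i]]] //= _]; case: j => [[|[|[|j]]] //= _]; ring.
Qed.

Lemma sym4_mxM A B : sym4_mx (A *m B) = sym4_mx A *m sym4_mx B.
Proof.
apply/matrixP=> i j; rewrite mxE !mulmxE2 [RHS]mxE !big_ord_recl big_ord0 addr0 !mxE.
move: (A 0 0) (A 0 1) (A 1 0) (A 1 1) (B 0 0) (B 0 1) (B 1 0) (B 1 1).
move=> a b c d a' b' c' d'.
by case: i => [[|[|[|[|[|i]]]]] //= _]; case: j => [[|[|[|[|[|j]]]]] //= _]; ring.
Qed.

Lemma sym2_mx1 : sym2_mx 1%:M = 1%:M.
Proof.
apply/matrixP=> i j; rewrite !mxE /= -val_eqE.
by case: i => [[|[|[|i]]] //= _]; case: j => [[|[|[|j]]] //= _]; ring.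
Qed.

Lemma sym4_mx1 : sym4_mx 1%:M = 1%:M.
Proof.
apply/matrixP=> i j; rewrite !mxE /= -val_eqE.
by case: i => [[|[|[|[|[|i]]]]] //= _]; case: j => [[|[|[|[|[|j]]]]] //= _]; ring.
Qed.

Lemma sym2_mxZ k A : sym2_mx (k *: A) = k ^+ 2 *: sym2_mx A.
Proof.
apply/matrixP=> i j; rewrite !mxE.
by case: i => [[|[|[|i]]] //= _]; case: j => [[|[|[|j]]] //= _]; ring.
Qed.

Lemma sym4_mxZ k A : sym4_mx (k *: A) = k ^+ 4 *: sym4_mx A.
Proof.
apply/matrixP=> i j; rewrite !mxE.
by case: i => [[|[|[|[|[|i]]]]] //= _]; case: j => [[|[|[|[|[|j]]]]] //= _]; ring.
Qed.

Lemma trace_sym2 A : \tr (sym2_mx A) = \tr A ^+ 2 - \det A.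
Proof.
rewrite [in RHS](mx2_eta A) trmx2 detmx2 /mxtrace !big_ord_recl big_ord0 !mxE /=.
ring.
Qed.

Lemma trace_sym4 A :
  \tr (sym4_mx A) = \tr A ^+ 4 - \tr A ^+ 2 * \det A *+ 3 + \det A ^+ 2.
Proof.
rewrite [in RHS](mx2_eta A) trmx2 detmx2 /mxtrace !big_ord_recl big_ord0 !mxE /=.
ring.
Qed.

End Entries.

End SymmetricPowers.

Section ModularCharacters.

Local Open Scope ring_scope.

Variables (r : nat) (gT : finGroupType) (A : gT -> 'M['F_r]_2).
Hypotheses (r_pr : prime r) (r5 : (5 <= r)%N).
Hypothesis A_det : forall g, \det (A g) != 0.
Hypothesis A_mul : forall g h, peq (A (g * h)%g) (A g *m A h).
Hypothesis A_scal : forall g, is_scalar_mx (A g) = (g == 1%g).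

Local Notation F := 'F_r.

(** The trace of conjugation by [M] on matrices of size two, which only depends on the
    image of [M] in the projective linear group. *)
Definition adj_trace (M : 'M[F]_2) : F := \tr M ^+ 2 / \det M.

Lemma adj_trace_peq M N : peq M N -> adj_trace M = adj_trace N.
Proof.
case=> c c0 ->; rewrite /adj_trace mxtraceZ det_scale2 exprMn -mulf_div.
by rewrite divff ?expf_neq0 // mul1r.
Qed.

Lemma A1_peq : peq (A 1%g) 1.
Proof.
have /is_scalar_mxP[c cE] : is_scalar_mx (A 1%g) by rewrite A_scal.
exists c; last by rewrite cE -[1]/1%:M scale_scalar_mx mulr1.
by apply: contraNneq (A_det 1%g) => c0; rewrite cE c0 det_scalar expr0n.
Qed.

Lemma AX_peq g k : peq (A (g ^+ k)%g) (A g ^+ k).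
Proof.
elim: k => [|k IHk]; first exact: A1_peq.
rewrite expgS exprS; apply: peq_trans (A_mul _ _) _.
exact: peqM (peq_refl _) IHk.
Qed.

Lemma AV_trace g : adj_trace (A g^-1%g) = adj_trace (A g).
Proof.
pose N := mx2 (A g 1 1) (- A g 0 1) (- A g 1 0) (A g 0 0).
have AN : A g *m N = \det (A g) *: 1%:M.
  rewrite {1 2}(mx2_eta (A g)) detmx2 mulmx2 scale_scalar_mx scalar_mx2 /N.
  by congr mx2; ring.
have e : peq (A g^-1%g) N.
  apply: peq_trans (_ : peq _ (A g^-1%g *m (A g *m N))) _.
    by rewrite AN -scalemxAr mulmx1; apply/peq_sym/peqZ.
  rewrite mulmxA; apply: peq_trans (peqM (peq_sym (A_mul _ _)) (peq_refl N)) _.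
  rewrite mulVg -[X in peq _ X]mul1mx; exact: peqM A1_peq (peq_refl N).
rewrite (adj_trace_peq e) /adj_trace /N [in RHS](mx2_eta (A g)).
by rewrite !trmx2 !detmx2; congr (_ ^+ 2 / _); ring.
Qed.

Variables (K : closedFieldType) (iota : {rmorphism F -> K}).

(** The quotient [w] of the two eigenvalues of [A g], which determines the trace of all
    powers of [g] on representations that factor through [PGL]. *)
Lemma eigenvalue_ratio g n : g != 1%g -> (g ^+ n = 1)%g -> n%:R != 0 :> F ->
  exists w : K, [/\ w ^+ n = 1, w != 1
    & forall k, iota (adj_trace (A (g ^+ k)%g)) = w ^+ k + 2 + w^-1 ^+ k].
Proof.
move=> g1 gn nF; set B := A g; pose t := \tr B; pose e := \det B.
have e0 : e != 0 := A_det g.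
have [x xE] : exists x : K, x ^+ 2 = iota t * x - iota e.
  have [|x xE] := @solve_monicpoly K 2 (fun i => if i == 0%N then - iota e else iota t).
    by [].
  by exists x; rewrite xE !big_ord_recl big_ord0 /= expr0 mulr1 addr0 addrC expr1.
pose y := iota t - x; have xy : x * y = iota e.
  by rewrite /y mulrBr -expr2 xE; ring.
have xDy : x + y = iota t by rewrite /y addrC subrK.
have ie0 : iota e != 0 by rewrite fmorph_eq0.
have x0 : x != 0 by apply: contraNneq ie0 => x0; rewrite -xy x0 mul0r.
have y0 : y != 0 by apply: contraNneq ie0 => y0; rewrite -xy y0 mulr0.
have trB k : iota (\tr (B ^+ k)) = x ^+ k + y ^+ k.
  suff [//] : iota (\tr (B ^+ k)) = x ^+ k + y ^+ k /\
              iota (\tr (B ^+ k.+1)) = x ^+ k.+1 + y ^+ k.+1.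
  elim: k => [|k [IH1 IH2]]; last split=> //.
    by rewrite !expr1 !expr0 mxtrace1 xDy rmorphMn rmorph1.
  have -> : B ^+ k.+2 = t *: B ^+ k.+1 - e *: B ^+ k.
    rewrite 2!exprS mulrA -[B * B]/(B *m B) cayley2 -/t -/e mulrBl.
    rewrite -[_ * _]/(_ *m _) -scalemxAl -[(e%:M * _)]/(_ *m _).
    by rewrite mul_scalar_mx.
  rewrite raddfB /= !mxtraceZ rmorphB !rmorphM IH1 IH2 -xDy -xy !exprS.
  ring.
have detB k : iota (\det (B ^+ k)) = x ^+ k * y ^+ k.
  by rewrite detX rmorphXn -exprMn xy.
exists (x / y).
have key k : iota (adj_trace (A (g ^+ k)%g)) = (x / y) ^+ k + 2 + (x / y)^-1 ^+ k.
  rewrite (adj_trace_peq (AX_peq g k)) /adj_trace fmorph_div rmorphXn trB detB.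
  rewrite invf_div !expr_div_n.
  by field; rewrite ?expf_neq0.
split=> //.
(* The ratio is an [n]-th root of unity because the trace of the scalar [A (g ^+ n)]
   is [4]. *)
  have : iota (adj_trace (A (g ^+ n)%g)) = 4.
    rewrite gn (adj_trace_peq A1_peq) /adj_trace mxtrace1 det1 divr1 rmorphXn rmorphMn.
    by rewrite rmorph1 -natrX.
  rewrite key exprVn; have xy0 : x / y != 0 by rewrite mulf_neq0 ?invr_eq0.
  move: (x / y) xy0 => z z0 zE; have {}z0 : z ^+ n != 0 by rewrite expf_neq0.
  apply/eqP; rewrite -subr_eq0 -sqrf_eq0; apply/eqP.
  move: (z ^+ n) z0 zE => u u0 uE.
  have E : u * u + u * 2 + 1 = u * 4 by rewrite -uE; field.
  transitivity (u * u + u * 2 + 1 - u * 4); first by ring.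
  by rewrite E subrr.
(* If the eigenvalues agree, the matrix is a scalar plus a nilpotent [N], and
   the [n]-th power of such a matrix is not scalar unless [N] is zero. *)
apply: contraNneq g1 => xy1; have xey : x = y by rewrite -[x](divfK y0) xy1 mul1r.
have two0 : 2 != 0 :> F by apply: Fr_neq0; rewrite // ltnW // ltnW // ltnW.
pose c := t / 2; have tc : t = c + c by rewrite -mulr2n -mulr_natr divfK.
have ec : e = c ^+ 2.
  apply: (fmorph_inj iota); rewrite rmorphXn -xy xey -expr2; congr (_ ^+ 2).
  apply: (mulIf (_ : 2 != 0)); first by rewrite -(rmorph_nat iota) fmorph_eq0.
  by rewrite !mulr_natr !mulr2n -rmorphD -tc -xDy xey.
have c0 : c != 0 by apply: contraNneq e0 => c0; rewrite ec c0 expr0n.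
pose N := B - c%:M; have BE : B = c%:M + N by rewrite addrC subrK.
have N2 : N *m N = 0.
  rewrite mulmxBl !mulmxBr cayley2 -/t -/e mul_scalar_mx mul_mx_scalar tc ec.
  rewrite -scalar_mxM -expr2 scalerDl; set Z := c *: B; set W := _%:M.
  by apply/eqP; rewrite subr_eq0 subr_eq addrAC.
have BX k : B ^+ k.+1 = (c ^+ k.+1)%:M + (c ^+ k *+ k.+1) *: N.
  elim: k => [|k IHk]; first by rewrite !expr1 expr0 mulr1n scale1r.
  rewrite exprS IHk -[_ * _]/(_ *m _) {1}BE mulmxDl !mulmxDr -!scalemxAr N2 scaler0.
  rewrite addr0 mul_scalar_mx mul_mx_scalar scale_scalar_mx -exprS -addrA; congr (_ + _).
  by rewrite mul_scalar_mx scalerA -scalerDl mulrnAl -exprSr -mulrSr.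
have : is_scalar_mx (B ^+ n).
  by apply: (peq_scalar (peq_sym (AX_peq g n))); rewrite A_scal gn.
case: n nF {gn} => [|n] nF; first by rewrite eqxx in nF.
rewrite BX => /is_scalar_mxP[a aE].
have d0 : c ^+ n *+ n.+1 != 0 by rewrite -mulr_natr mulf_neq0 ?expf_neq0.
rewrite -A_scal -/B BE; apply/is_scalar_mxP.
exists (c + (c ^+ n *+ n.+1)^-1 * (a - c ^+ n.+1)); rewrite raddfD /=; congr (_ + _).
apply: (scalerI d0); rewrite scale_scalar_mx mulrA mulfV // mul1r.
by apply: (addrI (c ^+ n.+1)%:M); rewrite aE -raddfD addrC subrK.
Qed.

(** What is needed of the two representations of the almost simple group, on the second
    and the fourth symmetric power of the natural module, of dimension [d = 3] and
    [d = 5]: an element of odd prime order other than [r] has a one-dimensional fixed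
    space, an involution has a two-dimensional [-1]-eigenspace. *)
Record symmetric_rep (d : nat) (R : gT -> 'M[F]_d) : Prop := SymmetricRep {
  srep1 : R 1%g = 1;
  srepM : {morph R : x y / (x * y)%g >-> x * y};
  srepV : forall x, \tr (R x^-1%g) = \tr (R x);
  srep_odd : forall s x, prime s -> odd s -> s != r -> #[x]%g = s ->
    \sum_(i < s | (i : nat) != 0%N) \tr (R (x ^+ i)%g) = s%:R - d%:R;
  srep_inv : forall x, #[x]%g = 2%N -> \tr (R x) = d%:R - 4%:R
}.

Lemma Fr_prime_neq0 s : prime s -> s != r -> s%:R != 0 :> F.
Proof.
by move=> s_pr sr; rewrite -(dvdn_pcharf (pchar_Fp r_pr)) dvdn_prime2 // eq_sym.
Qed.

Lemma ratio_sums s (w : K) : prime s -> odd s -> w ^+ s = 1 -> w != 1 ->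
  [/\ \sum_(i < s | (i : nat) != 0%N) w ^+ i = -1,
      \sum_(i < s | (i : nat) != 0%N) w^-1 ^+ i = -1,
      \sum_(i < s | (i : nat) != 0%N) (w ^+ i) ^+ 2 = -1
    & \sum_(i < s | (i : nat) != 0%N) (w^-1 ^+ i) ^+ 2 = -1].
Proof.
move=> s_pr s_odd ws w1; have s0 := prime_gt0 s_pr.
have V (z : K) : z ^+ s = 1 -> z != 1 -> z^-1 ^+ s = 1 /\ z^-1 != 1.
  by move=> zs z1; rewrite exprVn zs invr1 invr_eq1.
have ws2 : (w ^+ 2) ^+ s = 1 by rewrite exprAC ws expr1n.
have w21 : w ^+ 2 != 1.
  apply: contra w1 => /eqP w2; apply/eqP.
  by apply: (expr_coprime_eq1 (m := 2) (n := s)) => //; rewrite coprime2n.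
have [wVs wV1] := V _ ws w1; have [wV2s wV21] := V _ ws2 w21.
split; try exact: sum_root_powers.
  by under eq_bigr do rewrite exprAC; apply: sum_root_powers.
by under eq_bigr do rewrite exprAC exprVn; apply: sum_root_powers.
Qed.

Lemma sum_nz_const s (c : F) : (0 < s)%N ->
  \sum_(i < s | (i : nat) != 0%N) c = (s%:R - 1) * c.
Proof.
move=> s0; rewrite -(sum_one_powers F s0) mulr_suml; apply: eq_bigr => i _.
by rewrite expr1n mul1r.
Qed.

Definition rep3 g : 'M[F]_3 := (\det (A g))^-1 *: sym2_mx (A g).
Definition rep5 g : 'M[F]_5 := (\det (A g) ^+ 2)^-1 *: sym4_mx (A g).

Lemma trace_rep3 g : \tr (rep3 g) = adj_trace (A g) - 1.
Proof.
rewrite mxtraceZ trace_sym2 mulrBr mulVf ?A_det //; congr (_ - _).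
by rewrite mulrC.
Qed.

Lemma trace_rep5 g : \tr (rep5 g) = adj_trace (A g) ^+ 2 - adj_trace (A g) *+ 3 + 1.
Proof. by rewrite mxtraceZ trace_sym4 /adj_trace; field; apply: A_det. Qed.

(** The character values are polynomials in [w + w^-1], and the sums of the powers [w ^+ i]
    and [w ^+ (2 * i)] over non-zero [i] are [-1] since [s] is odd. *)
Lemma odd_sum g s : prime s -> odd s -> s != r -> #[g]%g = s ->
  \sum_(i < s | (i : nat) != 0%N) (adj_trace (A (g ^+ i)%g) - 2%:R) = -2%:R /\
  \sum_(i < s | (i : nat) != 0%N) (adj_trace (A (g ^+ i)%g) - 2%:R) ^+ 2 =
    s%:R *+ 2 - 4%:R.
Proof.
move=> s_pr s_odd sr gs; have s0 := prime_gt0 s_pr.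
have g1 : g != 1%g by rewrite -order_eq1 gs gtn_eqF ?prime_gt1.
have gsn : (g ^+ s = 1)%g by rewrite -gs expg_order.
have [w [ws w1 wE]] := eigenvalue_ratio g1 gsn (Fr_prime_neq0 s_pr sr).
have [s1 s2 s3 s4] := ratio_sums s_pr s_odd ws w1.
have w0 := unity_root_neq0 s0 ws.
have term i : iota (adj_trace (A (g ^+ i)%g) - 2%:R) = w ^+ i + w^-1 ^+ i.
  by rewrite rmorphB wE rmorph_nat; ring.
split; apply: (fmorph_inj iota); rewrite rmorph_sum.
  under eq_bigr do rewrite term.
  rewrite big_split /= s1 s2 rmorphN rmorph_nat.
  by ring.
rewrite (eq_bigr (fun i : 'I_s => (w ^+ i) ^+ 2 + (w^-1 ^+ i) ^+ 2 + 1 ^+ i + 1 ^+ i)); last first.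
  move=> i _; rewrite rmorphXn term expr1n sqrrD -exprMn divff // expr1n mulr2n.
  by ring.
rewrite !big_split /= s3 s4 !sum_one_powers // rmorphB rmorphMn !rmorph_nat.
by ring.
Qed.

Lemma involution_trace g : #[g]%g = 2%N -> adj_trace (A g) = 0.
Proof.
move=> g2; have g1 : g != 1%g by rewrite -order_eq1 g2.
have gsn : (g ^+ 2 = 1)%g by rewrite -g2 expg_order.
have two0 : 2%:R != 0 :> F by apply: Fr_neq0; rewrite // ltnW // ltnW // ltnW.
have [w [/eqP w2 w1 wE]] := eigenvalue_ratio g1 gsn two0.
move: w2; rewrite sqrf_eq1 (negPf w1) /= => /eqP w2.
apply: (fmorph_inj iota); rewrite -[g in LHS]expg1 wE w2 invrN1 rmorph0 !expr1.
by ring.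
Qed.

Theorem rep3P : symmetric_rep rep3.
Proof.
split=> [|g h|g|s g s_pr s_odd sr gs|g g2].
- have [c c0 cE] := A1_peq; rewrite /rep3 cE sym2_mxZ det_scale2 -[1]/1%:M det1 mulr1.
  by rewrite sym2_mx1 scalerA mulVf ?scale1r // expf_neq0.
- have [c c0 cE] := A_mul g h; rewrite /rep3 cE sym2_mxZ det_scale2 det_mulmx sym2_mxM.
  rewrite -[_ * _ in RHS]/(_ *m _) -scalemxAl -scalemxAr !scalerA; congr (_ *: _).
  by move: (\det (A g)) (\det (A h)) (A_det g) (A_det h) => a b a0 b0; field;
    rewrite a0 b0 c0.
- by rewrite !trace_rep3 AV_trace.
- have [S1 _] := odd_sum s_pr s_odd sr gs.
  rewrite (eq_bigr (fun i : 'I_s => adj_trace (A (g ^+ i)%g) - 2%:R + 1 ^+ i)); last first.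
    by move=> i _; rewrite trace_rep3 expr1n; ring.
  by rewrite big_split /= S1 sum_one_powers ?prime_gt0 //; ring.
by rewrite trace_rep3 involution_trace //; ring.
Qed.

Theorem rep5P : symmetric_rep rep5.
Proof.
split=> [|g h|g|s g s_pr s_odd sr gs|g g2].
- have [c c0 cE] := A1_peq; rewrite /rep5 cE sym4_mxZ det_scale2 -[1]/1%:M det1 mulr1.
  by rewrite sym4_mx1 scalerA -exprM mulVf ?scale1r // expf_neq0.
- have [c c0 cE] := A_mul g h; rewrite /rep5 cE sym4_mxZ det_scale2 det_mulmx sym4_mxM.
  rewrite -[_ * _ in RHS]/(_ *m _) -scalemxAl -scalemxAr !scalerA; congr (_ *: _).
  by move: (\det (A g)) (\det (A h)) (A_det g) (A_det h) => a b a0 b0; field;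
    rewrite a0 b0 c0.
- by rewrite !trace_rep5 AV_trace.
- have [S1 S2] := odd_sum s_pr s_odd sr gs.
  rewrite (eq_bigr (fun i : 'I_s => (adj_trace (A (g ^+ i)%g) - 2%:R) ^+ 2
             + (adj_trace (A (g ^+ i)%g) - 2%:R) - 1 ^+ i)); last first.
    by move=> i _; rewrite trace_rep5 expr1n; ring.
  rewrite sumrB big_split /= S1 S2 sum_one_powers ?prime_gt0 //; ring.
by rewrite trace_rep5 involution_trace //; ring.
Qed.

End ModularCharacters.

(** * Eigenvalues of units in modular representations *)

Section ModularSpectrum.

Local Open Scope ring_scope.

Lemma sum_powers_root (F : fieldType) (n : nat) (w : F) : (0 < n)%N -> w ^+ n = 1 ->
  \sum_(i < n) w ^+ i = (w == 1)%:R * n%:R.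
Proof.
move=> n0 wn; have [->|w1] := eqVneq w 1.
  by under eq_bigr do rewrite expr1n; rewrite sumr_const card_ord mul1r.
apply: (mulfI (_ : w - 1 != 0)); first by rewrite subr_eq0.
by rewrite -subrX1 wn subrr mul0r mulr0.
Qed.

Lemma sum_exponent0 (V : nmodType) (n : nat) (f : nat -> V) : (0 < n)%N ->
  \sum_(i < n) f i = f 0%N + \sum_(i < n | (i : nat) != 0%N) f i.
Proof.
by case: n => // n _; rewrite (bigD1 ord0).
Qed.

Variables (r : nat) (gT : finGroupType).
Hypotheses (r_pr : prime r) (r5 : (5 <= r)%N).
Local Notation F := 'F_r.
Variables (K : closedFieldType) (iota : {rmorphism F -> K}).

(** Multiplicities of eigenvalues are only obtained modulo [r]; they are at most [d]. *)
Lemma small_nat_inj (m n : nat) : (m < n + r)%N -> (n < m + r)%N ->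
  m%:R = n%:R :> K -> m = n.
Proof.
have inj i : (i < r)%N -> i%:R = 0 :> K -> i = 0%N.
  rewrite -(rmorph_nat iota) => ir /eqP; rewrite fmorph_eq0 => i0.
  by apply/eqP; apply: contraLR i0 => i0; apply: Fr_neq0; rewrite // lt0n i0.
move=> mn nm /eqP e; case: (leqP m n) => [le|/ltnW le].
  move: e; rewrite eq_sym -subr_eq0 -natrB // => /eqP/inj.
  by move=> e; apply/eqP; rewrite eqn_leq le -subn_eq0 e // ltn_subLR.
move: e; rewrite -subr_eq0 -natrB // => /eqP/inj.
by move=> e; apply/eqP; rewrite eqn_leq le -subn_eq0 e // ltn_subLR.
Qed.

Variables (d : nat) (R : gT -> 'M[F]_d).
Hypotheses (d5 : (d <= 5)%N) (R_rep : symmetric_rep R).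
Implicit Types (u v y z : integral_group_ring gT).

Let phi x := \tr (R x).

Lemma phiJ x g : phi (x ^ g)%g = phi x.
Proof.
rewrite /phi conjgE (srepM R_rep) -[_ * _]/(_ *m _) mxtrace_mulC -[_ *m _]/(_ * _).
by rewrite -(srepM R_rep) -mulgA mulgV mulg1.
Qed.

(** The family [c] lists the eigenvalues of [u], through its power sums. *)
Definition spectrum u (c : 'I_d -> K) :=
  forall m, \sum_k c k ^+ m = iota (gr_lift phi (u ^+ m)).

Lemma unit_spectrum u n : (0 < n)%N -> n%:R != 0 :> F -> u ^+ n = 1 ->
  exists2 c : 'I_d -> K, (forall k, c k ^+ n = 1) & spectrum u c.
Proof.
move=> n0 nF un; have nK : n%:R != 0 :> K by rewrite -(rmorph_nat iota) fmorph_eq0.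
have [z zP] := closed_prim_root n0 nK.
have RX m : gr_lift R (u ^+ m) = gr_lift R u ^+ m.
  by apply: gr_liftX; [apply: srep1 | apply: srepM].
have mapX m : map_mx iota (gr_lift R u ^+ m) = map_mx iota (gr_lift R u) ^+ m.
  elim: m => [|m IHm]; first exact: map_mx1.
  by rewrite !exprS -IHm; exact: map_mxM.
have [|c cn cE] := finite_order_trace (A := map_mx iota (gr_lift R u)) zP.
  rewrite -mapX -RX un gr_lift1 ?(srep1 R_rep) //; exact: map_mx1.
exists c => // m; rewrite -cE -mapX trace_map_mx -RX; congr (iota _).
exact: gr_lift_comp.
Qed.

Lemma spectrum_inv u n (c : 'I_d -> K) m : (0 < n)%N -> u ^+ n = 1 -> (forall k, c k ^+ n = 1) ->
  spectrum u c -> \sum_k (c k)^-1 ^+ m = \sum_k c k ^+ m.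
Proof.
move=> n0 un cn cE; have umn : (u ^+ m) ^+ n = 1 by rewrite exprAC un expr1n.
rewrite cE -(gr_lift_inv phiJ (srepV R_rep) umn n0) -exprM -cE; apply: eq_bigr => k _.
rewrite exprVn; apply: (mulfI (_ : c k ^+ m != 0)).
  by rewrite expf_neq0 // (unity_root_neq0 n0 (cn k)).
rewrite mulfV; last first.
  by rewrite expf_neq0 // (unity_root_neq0 n0 (cn k)).
by rewrite -exprD -mulnS prednK // mulnC exprM cn expr1n.
Qed.

(** Only elements of order [s] contribute, and on these the exponent [i] can be replaced by
    one that is prime to the order of the group. *)
Lemma phi_pow_lift y s i : prime s -> y ^+ s = 1 -> y != 1 -> aug y = 1 ->
  (0 < i < s)%N -> gr_lift phi (y ^+ i) = \sum_(x | #[x]%g == s) phi (x ^+ i)%g *~ y x.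
Proof.
move=> s_pr ys y1 augy /andP[i0 si]; have s0 := prime_gt0 s_pr.
have co : coprime i s by rewrite coprime_sym prime_coprime // gtnNdvd.
have G0 : (0 < #|gT|)%N by rewrite -cardsT cardG_gt0.
have [k ki ck] := coprime_residue co s0 G0.
have fJ x g : phi ((x ^ g) ^+ k)%g = phi (x ^+ k)%g by rewrite -conjXg phiJ.
rewrite -(expr_mod _ ys) -ki (expr_mod _ ys) (gr_lift_coprime_pow phiJ ys s0 ck).
rewrite (prime_unit_lift fJ s_pr ys y1 augy); apply: eq_bigr => x /eqP xs.
by congr (phi _ *~ _); apply/eqP; rewrite eq_expg_mod_order xs ki.
Qed.

Lemma prime_unit_trace_sum y s : prime s -> odd s -> s != r ->
    y ^+ s = 1 -> y != 1 -> aug y = 1 ->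
  \sum_(i < s) gr_lift phi (y ^+ i) = s%:R.
Proof.
move=> s_pr s_odd sr ys y1 augy; have s0 := prime_gt0 s_pr.
have one1 : forall x g : gT, (1 : int) = 1 by [].
rewrite (sum_exponent0 (fun i => gr_lift phi (y ^+ i)) s0) expr0 -gr_of1 gr_lift_of.
rewrite (eq_bigr (fun i : 'I_s => \sum_(x | #[x]%g == s) phi (x ^+ i)%g *~ y x)); last first.
  by move=> i i0; apply: phi_pow_lift; rewrite ?lt0n ?i0 ?ltn_ord.
rewrite exchange_big /= (eq_bigr (fun x => (s%:R - d%:R) *~ y x)); last first.
  by move=> x /eqP xs; rewrite -mulrz_suml (srep_odd R_rep).
rewrite -mulrz_sumr {1}/phi (srep1 R_rep) mxtrace1.
have <- : aug y = \sum_(x | #[x]%g == s) y x.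
  rewrite augE (prime_unit_lift (f := fun _ : gT => 1 : int) one1 s_pr ys y1 augy).
  by apply: eq_bigr => x _; rewrite mulrzz mul1r.
by rewrite augy mulr1z addrC subrK.
Qed.

(** The unit [u ^+ q] of order [p] has a one-dimensional fixed space, like the elements of
    order [p]: [p] times its dimension is the sum of the traces of all powers. *)
Lemma fixed_eigenvalue u (c : 'I_d -> K) p q : prime p -> odd p -> p != r -> (0 < q)%N ->
    u ^+ (q * p) = 1 -> u ^+ q != 1 -> aug u = 1 ->
    (forall k, c k ^+ (q * p) = 1) -> spectrum u c ->
  #|[set k : 'I_d | c k ^+ q == 1]| = 1%N.
Proof.
move=> p_pr p_odd pr q0 upq uq1 augu cn cE; have p0 := prime_gt0 p_pr.
have augq : aug (u ^+ q) = 1 by rewrite rmorphXn /= augu expr1n.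
have uqp : (u ^+ q) ^+ p = 1 by rewrite -exprM.
have := congr1 iota (prime_unit_trace_sum p_pr p_odd pr uqp uq1 augq).
rewrite rmorph_sum rmorph_nat.
under eq_bigr do rewrite -exprM -cE; rewrite exchange_big /=.
rewrite (eq_bigr (fun k => (c k ^+ q == 1)%:R * p%:R)); last first.
  move=> k _; rewrite -(sum_powers_root p0) -?exprM //.
  by apply: eq_bigr => i _; rewrite exprM.
rewrite -mulr_suml -natr_sum => E; apply: small_nat_inj.
- by apply: leq_ltn_trans (max_card _) _; rewrite card_ord; lia.
- by lia.
have pK : p%:R != 0 :> K by rewrite -(rmorph_nat iota) fmorph_eq0; apply: Fr_prime_neq0.
apply: (mulIf pK); rewrite mul1r -[RHS]E; congr (_%:R * _).
by rewrite -sum1dep_card big_mkcond; apply: eq_bigr => k _; case: eqP.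
Qed.

Lemma eigenvalue_multiplicity (c : 'I_d -> K) n (w : K) : (0 < n)%N -> n%:R != 0 :> F -> w ^+ n = 1 ->
    (forall k, c k ^+ n = 1) ->
  #|[set k : 'I_d | c k == w]|%:R * n%:R = \sum_(m < n) w^-1 ^+ m * \sum_k c k ^+ m.
Proof.
move=> n0 nF wn cn.
have w0 := unity_root_neq0 n0 wn.
under eq_bigr do rewrite mulr_sumr; rewrite exchange_big /=.
rewrite (eq_bigr (fun k => (c k == w)%:R * n%:R)); last first.
  move=> k _; under eq_bigr do rewrite -exprMn.
  rewrite (sum_powers_root n0) ?exprMn ?exprVn ?wn ?cn ?invr1 ?mulr1 //.
  by congr (_%:R * _); rewrite mulrC -(inj_eq (mulIf w0)) divfK // mul1r.
rewrite -mulr_suml -natr_sum; congr (_%:R * _).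
by rewrite -sum1dep_card big_mkcond; apply: eq_bigr => k _; case: eqP.
Qed.

(** The multiplicities of the eigenvalues are determined by the traces, so they are
    invariant under inversion, and under the Frobenius because the traces are in the prime
    field. *)
Lemma spectrum_closed u (c : 'I_d -> K) n k : (d < r)%N -> (0 < n)%N -> n%:R != 0 :> F ->
    u ^+ n = 1 -> (forall k, c k ^+ n = 1) -> spectrum u c ->
  (c k)^-1 \in codom c /\ c k ^+ r \in codom c.
Proof.
move=> dr n0 nF un cn cE; set w := c k.
have nK : n%:R != 0 :> K by rewrite -(rmorph_nat iota) fmorph_eq0.
have wn : w ^+ n = 1 := cn k.
pose f x := #|[set j : 'I_d | c j == x]|.
have f_ltr x : (f x < r)%N by apply: leq_ltn_trans (max_card _) _; rewrite card_ord.
have f_gt0 : (0 < f w)%N by apply/card_gt0P; exists k; rewrite inE.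
have in_codom x : f w = f x -> x \in codom c.
  move=> e; move: f_gt0; rewrite e => /card_gt0P[j]; rewrite inE => /eqP <-.
  exact: codom_f.
have eqf x : (f w)%:R * n%:R = (f x)%:R * n%:R :> K -> f w = f x.
  by move/(mulIf nK)/small_nat_inj; apply; rewrite ltn_addl.
split; apply: in_codom; apply: eqf.
  have cVn j : (c j)^-1 ^+ n = 1 by rewrite exprVn cn invr1.
  have wVn : w^-1 ^+ n = 1 by rewrite exprVn wn invr1.
  rewrite (eigenvalue_multiplicity n0 nF wVn cn).
  have := eigenvalue_multiplicity n0 nF wVn cVn.
  under eq_bigr do rewrite (spectrum_inv _ n0 un cn cE).
  by move=> <-; congr (_%:R * _); apply: eq_card => j; rewrite !inE (inj_eq invr_inj).
have pK : r \in [pchar K] by rewrite (fmorph_pchar iota) pchar_Fp.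
have wrn : (w ^+ r) ^+ n = 1 by rewrite exprAC wn expr1n.
rewrite (eigenvalue_multiplicity n0 nF wrn cn) -natrM -(rmorph_nat (pFrobenius_aut pK)).
rewrite natrM (eigenvalue_multiplicity n0 nF wn cn) rmorph_sum; apply: eq_bigr => m _.
rewrite /= pFrobenius_autE exprMn cE -rmorphXn Fr_expr //; congr (_ * _).
by rewrite exprAC; congr (_ ^+ m); apply: exprVn.
Qed.

End ModularSpectrum.

(** * Almost simple groups *)

Section ModularCases.

Local Open Scope ring_scope.

Variables (r : nat) (gT : finGroupType).
Hypotheses (r_pr : prime r) (r5 : (5 <= r)%N).
Local Notation F := 'F_r.
Variables (K : closedFieldType) (iota : {rmorphism F -> K}).

Lemma unit_power_neq1 (v w : integral_group_ring gT) p q : prime p -> prime q -> p != q ->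
    v ^+ p = 1 -> w ^+ q = 1 -> v * w = w * v -> v != 1 -> (v * w) ^+ q != 1.
Proof.
move=> p_pr q_pr pq vp wq vw v1; rewrite mixed_exp // wq mulr1.
apply: contra v1 => /eqP vq; apply/eqP.
by apply: (expr_coprime_eq1 (m := p) (n := q)); rewrite ?prime_gt0 ?prime_coprime ?dvdn_prime2.
Qed.

(** The eigenvalues of a unit of order [pq] on the three-dimensional representation: one
    of them is fixed by the [p]-part, one by the [q]-part, so one of the three has both
    parts non-trivial; but its orbit under inversion and the Frobenius has length four. *)
Theorem no_edge_opposite (R : gT -> 'M[F]_3) p q (v w : integral_group_ring gT) :
    symmetric_rep R -> prime p -> odd p -> prime q -> odd q ->
    (p %| r.-1)%N -> (q %| r.+1)%N ->
    v ^+ p = 1 -> w ^+ q = 1 -> v * w = w * v ->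
    v != 1 -> w != 1 -> aug v = 1 -> aug w = 1 ->
  False.
Proof.
have [r0 r1 r2 r3] : [/\ 0 < r, 0 < r.-1 < r, r.+1 - r.-1 = 2 & 3 < r]%N by split; lia.
move=> R_rep p_pr p_odd q_pr q_odd pr qr vp wq vw v1 w1 augv augw.
have p_ndvd : ~~ (p %| r.+1)%N.
  apply/negP=> pr1; have : (p %| r.+1 - r.-1)%N by apply: dvdn_sub.
  by rewrite r2; move=> /(dvdn_leq (isT : (0 < 2)%N)); case: (p) p_odd (prime_gt1 p_pr) => [|[|[|]]].
have q_ndvd : ~~ (q %| r.-1)%N.
  apply/negP=> qr1; have : (q %| r.+1 - r.-1)%N by apply: dvdn_sub.
  by rewrite r2; move=> /(dvdn_leq (isT : (0 < 2)%N)); case: (q) q_odd (prime_gt1 q_pr) => [|[|[|]]].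
have pq : p != q by apply: contra p_ndvd => /eqP ->.
have neq_r l : prime l -> (l %| r.-1)%N || (l %| r.+1)%N -> l != r.
  move=> l_pr; apply: contraL => /eqP ->; rewrite negb_or; apply/andP; split.
    by case/andP: r1 => *; rewrite gtnNdvd.
  by rewrite -[r.+1]addn1 dvdn_addr // dvdn1 gtn_eqF // prime_gt1.
have p_r : p != r by apply: neq_r; rewrite ?pr.
have q_r : q != r by apply: neq_r; rewrite ?qr ?orbT.
have p0 := prime_gt0 p_pr; have q0 := prime_gt0 q_pr.
set u := v * w; have upq : u ^+ (p * q) = 1 by apply: mixed_order.
have uqp : u ^+ (q * p) = 1 by rewrite mulnC.
have pq0 : (0 < p * q)%N by rewrite muln_gt0 p0.
have pqF : (p * q)%:R != 0 :> F by rewrite natrM mulf_neq0 ?Fr_prime_neq0.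
have augu : aug u = 1 by rewrite rmorphM /= augv augw mulr1.
have uq1 : u ^+ q != 1 by apply: (unit_power_neq1 p_pr q_pr pq vp wq vw v1).
have up1 : u ^+ p != 1.
  have qp : q != p by rewrite eq_sym.
  by rewrite /u vw; apply: (unit_power_neq1 q_pr p_pr qp wq vp (esym vw) w1).
have [c cn cE] := unit_spectrum iota R_rep pq0 pqF upq.
have cn' k : c k ^+ (q * p) = 1 by rewrite mulnC.
have d5 : (3 <= 5)%N by [].
have Fq := fixed_eigenvalue r_pr r5 d5 R_rep p_pr p_odd p_r q0 uqp uq1 augu cn' cE.
have Fp := fixed_eigenvalue r_pr r5 d5 R_rep q_pr q_odd q_r p0 upq up1 augu cn cE.
have [k kP] : exists k, (c k ^+ q != 1) && (c k ^+ p != 1).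
  apply/existsP; apply: contraT; rewrite negb_exists => /forallP none.
  pose X := [set k : 'I_3 | c k ^+ q == 1]; pose Y := [set k : 'I_3 | c k ^+ p == 1].
  have := leq_addr #|X :&: Y| #|X :|: Y|; rewrite cardsUI Fq Fp.
  have -> : X :|: Y = setT; last by rewrite cardsT card_ord.
  by apply/setP=> k; have := none k; rewrite negb_and !negbK !inE.
have closed x : x \in codom c -> x^-1 \in codom c /\ x ^+ r \in codom c.
  by case/codomP=> j ->; apply: (spectrum_closed r_pr R_rep j r3 pq0 pqF upq cn cE).
set x := c k in kP; have xc : x \in codom c by apply: codom_f.
have xn : x ^+ (p * q) = 1 := cn k.
have [xVc xrc] := closed x xc; have [xrVc _] := closed _ xrc.
have x0 := unity_root_neq0 pq0 xn.
case/andP: kP => xq xp.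
have pq_odd : odd (p * q) by rewrite oddM p_odd.
have x1 : x != 1 by apply: contra xq => /eqP ->; rewrite expr1n.
have not_self (y : K) : y ^+ (p * q) = 1 -> y != 1 -> y != y^-1.
  move=> yn; apply: contra => /eqP yV; apply/eqP.
  have y0 := unity_root_neq0 pq0 yn.
  apply: (expr_coprime_eq1 (m := 2) (n := p * q)); rewrite // ?coprime2n //.
  by rewrite expr2 {1}yV mulVf.
have xr_x : x ^+ r.-1 != 1.
  apply: contra xp => /eqP xr1; apply/eqP.
  apply: (expr_coprime_eq1 (m := q) (n := r.-1)) => //.
  - by rewrite prime_coprime.
  - by rewrite -exprM.
  by rewrite exprAC xr1 expr1n.
have xr_xV : x ^+ r.+1 != 1.
  apply: contra xq => /eqP xr1; apply/eqP.
  apply: (expr_coprime_eq1 (m := p) (n := r.+1)) => //.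
  - by rewrite prime_coprime.
  - by rewrite -exprM mulnC.
  by rewrite exprAC xr1 expr1n.
have n1 : x != x ^+ r.
  apply: contra xr_x => /eqP e; apply/eqP/(mulfI x0).
  by rewrite -exprS prednK // mulr1.
have n2 : x != (x ^+ r)^-1.
  apply: contra xr_xV => /eqP e; rewrite exprS {1}e mulVf // expf_neq0 //.
have n3 : x ^+ r != (x ^+ r)^-1.
  apply: not_self; first by rewrite exprAC xn expr1n.
  apply: contra x1 => /eqP e; apply/eqP.
  apply: (expr_coprime_eq1 (m := r) (n := p * q)); rewrite // coprimeMr.
  by rewrite !(coprime_sym r) !prime_coprime // !dvdn_prime2 // p_r.
have uniq4 : uniq [:: x; x^-1; x ^+ r; (x ^+ r)^-1].
  rewrite /= !inE !negb_or n1 n2 n3 not_self //= !andbT.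
  by rewrite (inj_eq invr_inj) n1 andbT; apply: contra n2 => /eqP <-; rewrite invrK.
have : (size [:: x; x^-1; x ^+ r; (x ^+ r)^-1] <= size (codom c))%N.
  apply: uniq_leq_size uniq4 _ => y; rewrite !inE.
  by case/or4P=> /eqP ->.
by rewrite size_codom card_ord.
Qed.

Section Involution.

Variables (s : nat) (z y : integral_group_ring gT).
Hypotheses (s_pr : prime s) (s_odd : odd s) (s_r : s != r).
Hypotheses (z2 : z ^+ 2 = 1) (ys : y ^+ s = 1) (zy : z * y = y * z).
Hypotheses (z1 : z != 1) (y1 : y != 1) (augz : aug z = 1) (augy : aug y = 1).
Hypothesis no_2s : forall x : gT, #[x]%g <> (2 * s)%N.

Let u := z * y.

(** Both sides compute the sum of the traces of the units [u ^+ (s + 2 * i)], that is of [z]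
    times the powers of [y ^+ 2]. On the left, through eigenvalues: only the eigenvector
    fixed by [y] contributes. On the right, through the support of [u]. *)
Lemma involution_edge_relation d (R : gT -> 'M[F]_d) : (d <= 5)%N -> symmetric_rep R ->
  s%:R = (d%:R - 4%:R)
       + (s%:R - 1) * ((d%:R - 4%:R) *~ (\sum_(x | #[x]%g == 2%N) u x))
       + (s%:R - d%:R) *~ (\sum_(x | #[x]%g == s) u x) :> F.
Proof.
have [r6 r3] : (5 < 2 + r)%N /\ (2 < r)%N by split; lia.
move=> d5 R_rep; have s0 := prime_gt0 s_pr.
have s2 : (2%N != s) by apply: contraTneq s_odd => <-.
have r2 : (2%N != r) by rewrite eq_sym gtn_eqF // ltnW // ltnW.
have n0 : (0 < 2 * s)%N by rewrite muln_gt0.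
have u2s : u ^+ (2 * s) = 1 by apply: mixed_order.
have [F2 Fs] : 2%:R != 0 :> F /\ s%:R != 0 :> F by split; apply: Fr_prime_neq0.
have nF : (2 * s)%:R != 0 :> F by rewrite natrM mulf_neq0.
have augu : aug u = 1 by rewrite rmorphM /= augz augy mulr1.
have u21 : u ^+ 2 != 1.
  rewrite /u zy; apply: (unit_power_neq1 s_pr (isT : prime 2) _ ys z2 (esym zy) y1).
  by rewrite eq_sym.
have phiJ x g : \tr (R (x ^ g)%g) = \tr (R x) by apply: phiJ.
have us : u ^+ s = z.
  by rewrite /u mixed_exp // ys mulr1 -(expr_mod _ z2) modn2 s_odd expr1.
have [c cn cE] := unit_spectrum iota R_rep n0 nF u2s.
have F1 := fixed_eigenvalue r_pr r5 d5 R_rep s_pr s_odd s_r (ltn0Sn 1) u2s u21 augu cn cE.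
have trz : gr_lift (fun x => \tr (R x)) z = d%:R - 4%:R.
  apply: (prime_unit_lift_const phiJ _ z2 z1 augz) => // x x2.
  exact: (srep_inv R_rep).
have K2 : 2 != 0 :> K by rewrite -(rmorph_nat iota) fmorph_eq0.
have cs k : (c k ^+ s == 1) || (c k ^+ s == -1).
  by rewrite -sqrf_eq1 -exprM mulnC cn.
have neg k : c k ^+ s = 1 - (c k ^+ s == -1)%:R *+ 2.
  case/orP: (cs k) => /eqP ->; last by rewrite eqxx mulr2n opprD addrA subrr add0r.
  rewrite -subr_eq0 opprK (negPf K2).
  by rewrite mul0rn subr0.
pose N := [set k : 'I_d | c k ^+ s == -1].
have N2 : #|N| = 2%N.
  have := cE s; rewrite us trz (eq_bigr _ (fun k _ => neg k)) sumrB sumr_const card_ord.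
  rewrite sumrMnl -natr_sum rmorphB !rmorph_nat => /eqP; rewrite (inj_eq (addrI _)).
  rewrite eqr_opp => /eqP E; apply: (small_nat_inj r_pr iota).
  - by apply: leq_ltn_trans (max_card _) _; rewrite card_ord; apply: leq_ltn_trans d5 r6.
  - exact: ltn_addl.
  apply: (mulIf K2); transitivity (4%:R : K); last by rewrite -natrM.
  rewrite -E -[RHS]mulr_natr; congr (_%:R * _).
  by rewrite -sum1dep_card big_mkcond; apply: eq_bigr => k _; case: eqP.
have [k1 /setP k1P] : exists k1, [set k : 'I_d | c k ^+ 2 == 1] = [set k1].
  by apply/cards1P/eqP.
have k1_2 : c k1 ^+ 2 = 1 by have := k1P k1; rewrite !inE eqxx => /eqP.
(* The eigenvalue fixed by the odd part is [1], not [-1]: otherwise the second negative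
   eigenvalue would be its own inverse. *)
have k1_s : c k1 ^+ s = 1.
  case/orP: (cs k1) => /eqP // k1_neg.
  have k1N : k1 \in N by rewrite inE k1_neg.
  have /cards1P[k2 k2P] : #|N :\ k1| == 1%N.
    by have := cardsD1 k1 N; rewrite N2 k1N => /eqP; rewrite eqSS eq_sym.
  have : k2 \in N :\ k1 by rewrite k2P inE.
  rewrite !inE => /andP[k21 /eqP k2_neg].
  have inv m := spectrum_inv R_rep m n0 u2s cn cE.
  have sV k : (c k)^-1 ^+ s = c k ^+ s.
    by case/orP: (cs k) => /eqP e; rewrite exprVn e ?invr1 ?invrN1.
  have E : \sum_k (1 - c k ^+ s) * c k ^+ 2 = \sum_k (1 - c k ^+ s) * (c k)^-1 ^+ 2.
    under eq_bigr do rewrite mulrBl mul1r -exprD.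
    under [RHS]eq_bigr => k _ do rewrite -sV mulrBl mul1r -exprD.
    by rewrite !sumrB !inv.
  have sumE (f : 'I_d -> K) : \sum_k (1 - c k ^+ s) * f k = 2 * (f k1 + f k2).
    rewrite (bigD1 k1) //= (bigD1 k2) //= big1 => [|k /andP[kk1 kk2]].
      by rewrite addr0 k1_neg k2_neg opprK mulrDr.
    have : k \notin N :\ k1 by rewrite k2P inE.
    rewrite !inE kk1 /= => kN; case/orP: (cs k) kN => /eqP ->; last by rewrite eqxx.
    by rewrite subrr mul0r.
  move: E; rewrite !sumE => /(mulfI K2); rewrite k1_2 exprVn k1_2 invr1 => /addrI E.
  have k2_0 := unity_root_neq0 n0 (cn k2).
  have k24 : (c k2 ^+ 2) ^+ 2 = 1.
    by rewrite expr2 {1}E exprVn mulVf // expf_neq0.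
  have : c k2 ^+ 2 = 1.
    apply: (expr_coprime_eq1 (m := 2) (n := s)); rewrite ?coprime2n //.
    by rewrite -exprM.
  by move=> e; have := k1P k2; rewrite !inE e eqxx (negPf k21).
have total : \sum_(i < s) gr_lift (fun x => \tr (R x)) (u ^+ (s + 2 * i)) = s%:R.
  apply: (fmorph_inj iota); rewrite rmorph_sum rmorph_nat.
  under eq_bigr do rewrite -cE; rewrite exchange_big /=.
  rewrite (eq_bigr (fun k => c k ^+ s * ((c k ^+ 2 == 1)%:R * s%:R))); last first.
    move=> k _; rewrite -(sum_powers_root s0) -?exprM ?cn // mulr_sumr.
    by apply: eq_bigr => i _; rewrite exprD exprM.
  rewrite (bigD1 k1) //= k1_s k1_2 eqxx !mul1r big1 ?addr0 // => k kk1.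
  by have := k1P k; rewrite !inE (negPf kk1) => ->; rewrite mul0r mulr0.
have rest i : (0 < i < s)%N -> gr_lift (fun x => \tr (R x)) (u ^+ (s + 2 * i)) =
    \sum_(x | #[x]%g == 2%N) (d%:R - 4%:R) *~ u x
    + \sum_(x | #[x]%g == s) \tr (R ((x ^+ 2) ^+ i)%g) *~ u x.
  move=> /andP[i0 si]; set k := (s + 2 * i)%N.
  have kodd : odd k by rewrite /k oddD oddM addbF.
  have ks : (k = 2 * i %[mod s])%N by rewrite /k modnDl.
  have co : coprime k (2 * s).
    rewrite coprimeMr coprimen2 kodd -coprime_modl ks coprime_modl coprime_sym.
    by rewrite prime_coprime // Euclid_dvdM // (gtnNdvd _ si) // orbF dvdn_prime2 // eq_sym.
  have G0 : (0 < #|gT|)%N by rewrite -cardsT cardG_gt0.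
  have [k' kk' ck'] := coprime_residue co n0 G0.
  rewrite -(expr_mod _ u2s) -kk' (expr_mod _ u2s).
  rewrite (gr_lift_coprime_pow phiJ u2s n0 ck').
  have fJ x g : \tr (R ((x ^ g) ^+ k')%g) = \tr (R (x ^+ k')%g) by rewrite -conjXg phiJ.
  pose D := [pred x : gT | (#[x]%g == 2%N) || (#[x]%g == s)].
  rewrite (gr_lift_support (D := D) fJ) => [|x g|x]; last 2 first.
  - by rewrite /= orderJ.
  - rewrite /= negb_or => /andP[x2 xs].
    by apply: (mixed_unit_support (p := 2) _ s_pr).
  have kx x : (#[x]%g %| 2 * s)%N -> (x ^+ k' = x ^+ k)%g.
    by move=> xd; apply/eqP; rewrite eq_expg_mod_order -(modn_dvdm _ xd) kk' modn_dvdm.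
  rewrite (bigID (fun x => #[x]%g == 2%N)) /=; congr (_ + _); apply: eq_big => x.
  - by case: eqP; rewrite ?andbF.
  - case/andP=> _ /eqP x2; rewrite kx ?x2 ?dvdn_mulr // -(srep_inv R_rep x2).
    congr (\tr (R _) *~ _); rewrite -[RHS]expg1; apply/eqP.
    by rewrite eq_expg_mod_order x2 modn2 kodd.
  - by case: eqP => [->|_]; rewrite ?andbT ?andbF //= (negPf s2).
  case/andP=> /orP[/eqP ->|/eqP xs _]; first by rewrite eqxx.
  rewrite kx ?xs ?dvdn_mull // -expgM; congr (\tr (R _) *~ _).
  by apply/eqP; rewrite eq_expg_mod_order xs ks.
rewrite -{1}total (sum_exponent0 (fun i => gr_lift _ (u ^+ (s + 2 * i))) s0).
rewrite muln0 addn0 us trz -[RHS]addrA; congr (_ + _).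
rewrite (eq_bigr (fun i : 'I_s => \sum_(x | #[x]%g == 2%N) (d%:R - 4%:R) *~ u x
    + \sum_(x | #[x]%g == s) \tr (R ((x ^+ 2) ^+ i)%g) *~ u x)); last first.
  by move=> i i0; apply: rest; rewrite lt0n i0 ltn_ord.
rewrite big_split /= -mulrz_sumr sum_nz_const //; congr (_ + _).
rewrite exchange_big /= mulrz_sumr; apply: eq_bigr => x /eqP xs.
rewrite -mulrz_suml (srep_odd R_rep s_pr s_odd s_r) //.
by rewrite orderXgcd xs (eqP (_ : coprime s 2)) ?divn1 // coprimen2.
Qed.

(** The two relations have the same unknown [b], the sum of the coefficients of [u] at
    elements of order [s]. Modulo [r] the one for [d = 5] says that [4 b = 0], and then the one
    for [d = 3] that [2 s = 0]. *)
Theorem no_edge_involution (R3 : gT -> 'M[F]_3) (R5 : gT -> 'M[F]_5) :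
  symmetric_rep R3 -> symmetric_rep R5 -> False.
Proof.
move=> /(involution_edge_relation (isT : (3 <= 5)%N)) E3.
move=> /(involution_edge_relation (isT : (5 <= 5)%N)) E5.
have r2 : (2%N != r) by rewrite eq_sym gtn_eqF // ltnW // ltnW.
have [F2 Fs] : 2%:R != 0 :> F /\ s%:R != 0 :> F by split; apply: Fr_prime_neq0.
have total : \sum_(x | #[x]%g == 2%N) u x + \sum_(x | #[x]%g == s) u x = 1.
  have augu : aug u = 1 by rewrite rmorphM /= augz augy mulr1.
  pose D := [pred x : gT | (#[x]%g == 2%N) || (#[x]%g == s)].
  have s2 : (2%N != s) by apply: contraTneq s_odd => <-.
  have one1 : forall x g : gT, (1 : int) = 1 by [].
  rewrite -[RHS]augu augE (gr_lift_support (f := fun _ : gT => 1 : int) (D := D) one1); last 2 first.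
  - by move=> x g; rewrite /= orderJ.
  - move=> x; rewrite /= negb_or => /andP[x2 xs].
    by apply: (mixed_unit_support (p := 2) _ s_pr).
  rewrite [RHS](bigID (fun x => #[x]%g == 2%N)) /=; congr (_ + _); apply: eq_big => x.
  - by case: eqP; rewrite ?andbF.
  - by rewrite mulrzz mul1r.
  - by case: (_ =P 2%N) => [->|_]; rewrite ?andbT ?andbF ?(negPf s2).
  by rewrite mulrzz mul1r.
move: E3 E5; rewrite -[\sum_(x | _ == 2%N) _](addrK (\sum_(x | #[x]%g == s) u x)) total.
move: (\sum_(x | _) _) => b.
have conv (a : F) : (a *~ (1 - b) = a * (1 - b%:~R)) * (a *~ b = a * b%:~R).
  by rewrite mulrzBr mulr1z mulrBr mulr1 !mulrzr.
rewrite !(conv (_ - _)); move: (b%:~R) => {conv} {}b E3 E5.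
have : 2%:R * (2%:R * s%:R) = 0 :> F.
  transitivity (- ((s%:R - 2) * (5%:R - 4%:R + (s%:R - 1) * ((5%:R - 4%:R) * (1 - b))
      + (s%:R - 5%:R) * b - s%:R) + 2 * (3%:R - 4%:R + (s%:R - 1) * ((3%:R - 4%:R) * (1 - b))
      + (s%:R - 3%:R) * b - s%:R))).
    by ring.
  by rewrite -E3 -E5 !subrr !mulr0 addr0 oppr0.
by move/eqP; rewrite !mulf_eq0 (negPf F2) (negPf Fs).
Qed.

End Involution.

End ModularCases.

Section AlmostSimpleEdges.

Local Open Scope ring_scope.

(** The almost simple case. If [p] and [q] are odd divisors of [r - 1] or of [r + 1], on
    the same side, the simple group has a cyclic torus of order divisible by [pq]; in all
    other cases there is no commuting pair of units, unless there is an element of order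
    [pq]. *)
Theorem almost_simple_edge (r : nat) (gT : finGroupType) (S : {group gT}) (p q : nat)
    (v w : integral_group_ring gT) :
    prime r -> (5 <= r)%N -> S \isog PSL 2 'F_r -> (S <| [set: gT])%g -> ('C(S) = 1)%g ->
    prime p -> prime q -> p != q -> (p %| #|S|)%N -> (q %| #|S|)%N ->
    v ^+ p = 1 -> w ^+ q = 1 -> v * w = w * v ->
    v != 1 -> w != 1 -> aug v = 1 -> aug w = 1 ->
  exists x : gT, #[x]%g = (p * q)%N.
Proof.
move=> r_pr r5 isoS nS CS p_pr q_pr pq pS qS vp wq vw v1 w1 augv augw.
have r2 : (2 < r)%N by apply: leq_trans r5.
have nSg g : g \in 'N(S)%g by rewrite (subsetP (normal_norm nS)) ?inE.
have [A [Adet Amul Ascal]] := PSL_action r_pr r2 isoS.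
have A_det g : \det (A g) != 0 by apply: Adet.
have A_mul g h : peq (A (g * h)%g) (A g *m A h) by apply: Amul.
have A_scal g : is_scalar_mx (A g) = (g == 1%g) by rewrite Ascal // CS inE.
have [x /eqP x_pq|no] := pickP (fun x : gT => #[x]%g == (p * q)%N); first by exists x.
have {}no (x : gT) : #[x]%g <> (p * q)%N by move=> e; have := no x; rewrite /= e eqxx.
have cardS : #|S| = #|PSL 2 'F_r| by apply: card_isog.
have [r_p|p_r] := eqVneq p r.
  have rq : r != q by rewrite -r_p.
  by rewrite r_p in vp; case: (no_edge_at_r r_pr r5 A_det A_mul A_scal q_pr rq
    vp v1 augv wq w1 augw vw).
have [r_q|q_r] := eqVneq q r.
  have rp : r != p by rewrite -r_q eq_sym.
  by rewrite r_q in wq; case: (no_edge_at_r r_pr r5 A_det A_mul A_scal p_pr rp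
    wq w1 augw vp v1 augv (esym vw)).
have [K [iota _]] := countable_algebraic_closure 'F_r.
have R3 := rep3P r_pr r5 A_det A_mul A_scal iota.
have R5 := rep5P r_pr r5 A_det A_mul A_scal iota.
have sides l : prime l -> (l %| #|S|)%N -> l != r -> (l %| r.-1)%N \/ (l %| r.+1)%N.
  by move=> l_pr; rewrite cardS => /(PSL_card_dvd r_pr l_pr)[->|lr|lr]; rewrite ?eqxx; auto.
have [p2|p_odd] := even_prime p_pr.
  have q_odd : odd q by case: (even_prime q_pr) => // q2; rewrite p2 q2 in pq.
  rewrite p2 in vp no.
  by case: (no_edge_involution r_pr r5 iota q_pr q_odd q_r vp wq vw v1 w1 augv augw no R3 R5).
have [q2|q_odd] := even_prime q_pr.
  rewrite q2 in wq no.
  have no' (x : gT) : #[x]%g <> (2 * p)%N by rewrite mulnC; apply: no.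
  by case: (no_edge_involution r_pr r5 iota p_pr p_odd p_r wq vp (esym vw) w1 v1 augw augv no'
    R3 R5).
have opp := no_edge_opposite r_pr r5 iota R3.
have co : coprime p q by rewrite prime_coprime // dvdn_prime2.
have same n : (p %| n)%N -> (q %| n)%N -> (n == r.-1) || (n == r.+1) ->
    exists x : gT, #[x]%g = (p * q)%N.
  move=> pn qn nr; have [_ _ el] := PSL_elements r_pr r2 isoS.
  have pqn : (p * q %| n)%N by rewrite Gauss_dvd // pn qn.
  have pq_odd : odd (p * q) by rewrite oddM p_odd.
  have pq1 : (1 < p * q)%N by rewrite (leq_trans (prime_gt1 p_pr)) // leq_pmulr // prime_gt0.
  have pqr : (p * q %| r.-1)%N || (p * q %| r.+1)%N.
    by case/orP: nr pqn => /eqP -> ->; rewrite ?orbT.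
  by have [x _ xE] := el _ pq_odd pq1 pqr; exists x.
case: (sides p p_pr pS p_r) (sides q q_pr qS q_r) => pr [] qr.
- by apply: (same r.-1); rewrite ?eqxx.
- by case: (opp _ _ _ _ p_pr p_odd q_pr q_odd pr qr vp wq vw v1 w1 augv augw).
- by case: (opp _ _ _ _ q_pr q_odd p_pr p_odd qr pr wq vp (esym vw) w1 v1 augw augv).
by apply: (same r.+1); rewrite ?eqxx ?orbT.
Qed.

End AlmostSimpleEdges.

(** * Composition factors and simple subnormal subgroups *)

Section CompositionFactors.

Local Open Scope group_scope.

(** The hypothesis on composition factors in a form that is inherited by quotients. *)
Definition PSL_type (gT : finGroupType) := forall A B : {group gT},
  A <|<| [set: gT] -> B <| A -> simple (A / B) ->
  prime #|A / B| \/ exists r : nat, [/\ prime r, (5 <= r)%N & A / B \isog PSL 2 'F_r].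

Variable gT : finGroupType.
Implicit Types (A B K L N : {group gT}) (s t : seq {group gT}).

(** Insert a maximal normal subgroup of [G] above [K], and iterate. *)
Lemma normal_comps (G K : {group gT}) t : K <| G -> comps K t ->
  exists2 s, comps G s & {subset mkfactors K t <= mkfactors G s}.
Proof.
have [n] := ubnP #|G|; elim: n G => // n IHn G Gn nKG Kt.
have [eKG | neKG] := eqVneq K G.
  by exists t; [rewrite -eKG | move=> X; rewrite eKG].
have pKG : K \proper G.
  by rewrite properEneq (normal_sub nKG) andbT; apply: contra neKG => /eqP/val_inj ->.
have [M maxM sKM] : {M : {group gT} | maxnormal M G G & K \subset M}.
  by apply: maxgroup_exists; rewrite pKG normal_norm.
have Mn : (#|M| < n)%N.
  by apply: leq_trans (proper_card (maxnormal_proper maxM)) _.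
have nKM : K <| M := normalS sKM (maxnormal_sub maxM) nKG.
have [s /compsP[sl sp] sub] := IHn M Mn nKM Kt.
exists (M :: s); last by move=> X /sub XM; rewrite inE XM orbT.
by apply/compsP; split; rewrite //= maxM.
Qed.

Lemma subnormal_comps (G A : {group gT}) t : A <|<| G -> comps A t ->
  exists2 s, comps G s & {subset mkfactors A t <= mkfactors G s}.
Proof.
case/subnormalP=> ch; elim: ch A t => [|K ch IH] A t /=.
  by move=> _ <- At; exists t.
case/andP=> nAK pK lastG At; have [s Ks sub] := normal_comps nAK At.
have [s' Gs' sub'] := IH K s pK lastG Ks; exists s' => // X /sub.
exact: sub'.
Qed.

Lemma PSL_type_comps :
    (forall X : section gT, composition_factor [set: gT]%G X ->
       prime #|X| \/ exists r : nat, [/\ prime r, (5 <= r)%N & X \isog PSL 2 'F_r]) ->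
  PSL_type gT.
Proof.
move=> hG A B sA nBA simAB; have [t Bt] := exists_comps B.
have At : comps A (B :: t).
  by move: Bt => /compsP[tl tp]; apply/compsP; split; rewrite //= -quotient_simple // simAB.
have [s Gs sub] := @subnormal_comps [set: gT]%G A _ sA At.
have iso := section_reprP (A / B)%sec.
have Xs : composition_factor [set: gT]%G (section_repr (A / B)%sec).
  by exists s => //; apply: sub; rewrite inE eqxx.
have [prX|[r [r_pr r5 iso']]] := hG _ Xs.
  by left; rewrite -(card_isog iso).
right; exists r; split=> //.
by apply: isog_trans iso'; rewrite isog_sym.
Qed.

Lemma PSL_type_simple L : PSL_type gT -> L <|<| [set: gT] -> simple L ->
  prime #|L| \/ exists r : nat, [/\ prime r, (5 <= r)%N & L \isog PSL 2 'F_r].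
Proof.
move=> good sL simL; have iso : L \isog L / 1%G := quotient1_isog L.
have simL1 : simple (L / 1%G) by rewrite -(isog_simple iso).
have [prL|[r [r_pr r5 iso']]] := good L 1%G sL (normal1 L) simL1.
  by left; rewrite (card_isog iso).
by right; exists r; split=> //; apply: isog_trans iso'.
Qed.

Lemma PSL_type_quotient N : N <| [set: gT] -> PSL_type gT -> PSL_type (coset_of N).
Proof.
move=> nN good A B sA nBA simAB.
have nNx (C : {set gT}) : C \subset 'N(N) by apply: subset_trans (normal_norm nN); rewrite subsetT.
pose pre (C : {group coset_of N}) := (coset N @*^-1 C)%G.
have lift ch C : normal.-series C ch -> normal.-series (pre C) (map pre ch).
  by elim: ch C => //= D ch IH C /andP[nCD pD]; rewrite cosetpre_normal nCD IH.
pose A1 := (coset N @*^-1 A)%G; pose B1 := (coset N @*^-1 B)%G.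
have nBA1 : B1 <| A1 by rewrite cosetpre_normal.
have sNB : N \subset B1 by apply: normal_sub (normal_cosetpre _).
have nNB : N <| B1 by apply: normal_cosetpre.
have nNA : N <| A1 by apply: normal_cosetpre.
have sA1 : A1 <|<| [set: gT].
  case/subnormalP: sA => ch pch lch; apply/subnormalP.
  exists (map pre ch); first exact: lift.
  rewrite (last_map pre) lch; apply/val_inj/setP=> x; rewrite [RHS]inE.
  apply/idP/morphpreP; split; last exact: in_setT.
  exact: (subsetP (nNx setT)) (in_setT x).
have iso : A / B \isog A1 / B1.
  by have := third_isog sNB nNA nBA1; rewrite /= !cosetpreK.
have simA1 : simple (A1 / B1) by rewrite -(isog_simple iso).
have [prA|[r [r_pr r5 iso']]] := good A1 B1 sA1 nBA1 simA1.
  by left; rewrite (card_isog iso).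
by right; exists r; split=> //; apply: isog_trans iso'.
Qed.

(** Take for [N] a minimal normal subgroup: it is a direct product of isomorphic simple
    groups, and [L] is one of them. *)
Lemma simple_direct_factor : [set: gT] != 1 ->
  exists N L : {group gT}, [/\ N <| [set: gT], L <| N, simple L
    & forall p, prime p -> p %| #|N| -> p %| #|L|].
Proof.
move=> ntG; have [N minN _] := @minnormal_exists gT [set: gT]%G [set: gT]%G ntG (normG _).
have [ntN nN] := andP (mingroupp minN).
have [H [sHN simH [I AutI defN]]] := charsimple_dprod (minnormal_charsimple minN).
have imH f : f \in I -> exists2 L : {group gT}, L :=: f @: H & L \isog H.
  move=> fI; have Af := subsetP AutI f fI.
  exists (autm Af @* H)%G; first by rewrite /= morphimEsub.
  by rewrite isog_sym sub_isog ?injm_autm.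
have [f fI] : exists f, f \in I.
  apply/set0Pn; apply: contra ntN => /eqP I0; rewrite -defN I0 big_set0.
  exact: eqxx.
have [L LE isoL] := imH f fI; exists N, L; split.
- by rewrite /normal subsetT.
- by move: defN; rewrite (big_setD1 f) //= -LE => /dprod_normal2[].
- by rewrite (isog_simple isoL).
move=> p p_pr; have := bigdprod_card defN; rewrite -[#|N|]/(#|gval N|) => <-.
rewrite Euclid_dvd_prod // big_orE => /existsP[f' /andP[f'I]].
have [L' <- isoL'] := imH f' f'I.
by rewrite (card_isog isoL') (card_isog isoL).
Qed.

(** The simple normal subgroups [L] and [L :^ x] of [N] are distinct, hence intersect
    trivially and commute. *)
Lemma conj_factor_cent N L x : N <| [set: gT] -> L <| N -> simple L -> x \notin 'N(L) ->
  L :^ x \subset 'C(L).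
Proof.
move=> nN nLN simL xL; have [_ simLP] := simpleP _ simL.
have nLxN : L :^ x <| N.
  have <- : N :^ x = N by apply: (normsP (normal_norm nN)); rewrite inE.
  by rewrite normalJ.
have TI : L :&: L :^ x = 1.
  case: (simLP (L :&: L :^ x)%G) => //= [|LLx].
    apply: normalS (subsetIl _ _) (normal_sub nLN) _; exact: normalI.
  case/negP: xL; apply/normP/esym/eqP; rewrite eqEcard cardJg leqnn andbT.
  by rewrite -{1}LLx subsetIr.
rewrite centsC; apply/commG1P/trivgP; rewrite -TI subsetI commg_subl commg_subr.
rewrite (subset_trans (normal_sub nLxN) (normal_norm nLN)).
by rewrite (subset_trans (normal_sub nLN) (normal_norm nLxN)).
Qed.

(** If [x] moves the direct factor [L] and [h] in [L] has order [p], the conjugates of [h]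
    under the powers of [x] commute, and their product commutes with [x]. *)
Lemma diagonal_edge N L x p q : N <| [set: gT] -> L <| N -> simple L ->
    L :&: 'C(L) = 1 -> prime p -> prime q -> p != q -> p %| #|L| ->
    #[x] = q -> x \notin 'N(L) ->
  exists z : gT, #[z] = (p * q)%N.
Proof.
move=> nN nLN simL TI p_pr q_pr pq pL xq xL.
have [h hL hp] := Cauchy p_pr pL; have q0 := prime_gt0 q_pr.
pose T := \prod_(i < q.-1) h ^ (x ^+ i.+1).
have TC : T \in 'C(L).
  apply: group_prod => i _; apply: (subsetP (conj_factor_cent nN nLN simL (x := x ^+ i.+1) _)).
    apply: contra xL => xiL.
    have iq : (i.+1 < q)%N by have := ltn_ord i; lia.
    have /eqP genx : <[x]> == <[x ^+ i.+1]>.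
      by rewrite -[_ == _]/(generator _ _) generator_coprime xq prime_coprime // gtnNdvd.
    have /cycleP[k ->] : x \in <[x ^+ i.+1]> by rewrite -genx cycle_id.
    by rewrite groupX.
  by rewrite memJ_conjg.
have Th : commute T h by move/centP: TC; apply.
pose y := h * T.
have yx : y ^ x = y.
  have yE : y = \prod_(i < q.-1.+1) h ^ (x ^+ i).
    by rewrite big_ord_recl expg0 conjg1.
  rewrite {1}yE (big_morph (fun g => g ^ x) (fun a b => conjMg a b x) (conj1g x)).
  under eq_bigr do rewrite -conjgM -expgSr.
  have xq1 : x ^+ q = 1 by rewrite -xq expg_order.
  by rewrite big_ord_recr /= prednK // xq1 conjg1 /y -Th.
(* A power of [h] that is a power of [T] lies in the centre of [L]. *)
have py : p %| #[y].
  rewrite -hp order_dvdn.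
  have := expg_order y; rewrite expgMn; last exact/commute_sym.
  move=> e; rewrite -in_set1 -[[set 1]]TI inE groupX //=.
  have -> : h ^+ #[y] = (T ^+ #[y])^-1 by apply/eqP; rewrite eq_sym eq_invg_mul (commuteX2 _ _ Th) e.
  by rewrite groupV groupX.
have yp : #[y ^+ (#[y] %/ p)] = p.
  by rewrite orderXdiv ?dvdn_div // divnA // mulKn // order_gt0.
apply: (commute_order_pq p_pr q_pr pq _ yp xq); apply/commute_sym/commuteX/commute_sym.
by apply/commgP/conjg_fixP.
Qed.

End CompositionFactors.

Section OuterElements.

Local Open Scope ring_scope.

Lemma moebiusX (F : finFieldType) (B : 'M[F]_2) k :
  \det B != 0 -> iter k (moebius B) =1 moebius (B ^+ k).
Proof.
move=> dB; elim: k => [|k IHk] o; last by rewrite iterSr IHk exprSr -moebiusM.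
by rewrite expr0 moebius_scalar ?det1 ?oner_neq0 // scalar_mx_is_scalar.
Qed.

Variables (r : nat) (gT : finGroupType) (L : {group gT}).
Hypotheses (r_pr : prime r) (r5 : (5 <= r)%N) (isoL : L \isog PSL 2 'F_r).

Let r2 : (2 < r)%N.
Proof. exact: leq_trans r5. Qed.

Lemma PSL_simple_centre : simple L -> (L :&: 'C(L) = 1)%g.
Proof.
move=> simL; have [_ simLP] := simpleP _ simL.
have [//|/center_idP abL] := simLP _ (center_normal L).
have prL := simple_sol_prime (abelian_sol abL) simL.
have [[s sL sr] [t tL t2] _] := PSL_elements r_pr r2 isoL.
have ord l (y : gT) : prime l -> y \in L -> #[y]%g = l -> l = #|L|.
  by move=> l_pr yL yl; apply/eqP; rewrite -dvdn_prime2 // -yl order_dvdG.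
by move: r2; rewrite (ord r s) // -(ord 2 t).
Qed.

(** An element of prime order that normalises the simple group acts on the projective
    line, and its number of fixed points shows that its order divides [r - 1], [r] or
    [r + 1] unless it centralises. *)
Lemma PSL_outer_prime x q : x \in 'N(L)%g -> prime q -> #[x]%g = q ->
  ~~ (q %| #|L|)%N -> x \in 'C(L)%g.
Proof.
move=> xN q_pr xq; apply: contraR => xC.
have [A [Adet Amul Ascal]] := PSL_action r_pr r2 isoL.
have N1 : 1%g \in 'N(L)%g := group1 _.
have dA := Adet x xN.
have A1 : peq (A 1%g) 1.
  have /is_scalar_mxP[c cE] : is_scalar_mx (A 1%g) by rewrite Ascal // group1.
  exists c; last by rewrite cE -[1]/1%:M scale_scalar_mx mulr1.
  by apply: contraNneq (Adet _ N1) => c0; rewrite cE c0 det_scalar expr0n.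
have AX k : peq (A (x ^+ k)%g) (A x ^+ k).
  elim: k => [|k IHk]; first exact: A1.
  rewrite expgS exprS; apply: peq_trans (Amul _ _ xN (groupX k xN)) _.
  exact: peqM (peq_refl _) IHk.
have iq : iter q (moebius (A x)) =1 id.
  move=> o; rewrite moebiusX // -(moebius_peq (AX q)) -xq expg_order.
  by rewrite (moebius_peq A1) moebius_scalar ?det1 ?oner_neq0 ?scalar_mx_is_scalar.
have := card_fix_mod q_pr iq; rewrite card_option card_Fp //.
have /moebius_fix_le2 : ~~ is_scalar_mx (A x) by rewrite Ascal.
move: #|_| => f f2 fr.
have [[s sL sr] [t tL t2] el] := PSL_elements r_pr r2 isoL.
have ordL l (y : gT) : y \in L -> #[y]%g = l -> (l %| #|L|)%N.
  by move=> yL <-; apply: order_dvdG.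
have [q2|q_odd] := even_prime q_pr; first by rewrite q2; apply: ordL tL t2.
have [/eqP qr|q_r] := boolP (q == r); first by rewrite qr; apply: ordL sL sr.
have side : (q %| r.-1)%N || (q %| r.+1)%N.
  have r1 : (1 < r.+1)%N by rewrite ltnS; apply: ltnW (ltnW r2).
  case: f f2 fr => [|[|[|f]]] // _ fr.
  - by apply/orP; right; rewrite /dvdn -fr mod0n.
  - have : (q %| r.+1 - 1)%N by rewrite -eqn_mod_dvd // -fr.
    by rewrite subn1 dvdn_prime2 // (negPf q_r).
  have : (q %| r.+1 - 2)%N by rewrite -eqn_mod_dvd // -fr.
  by rewrite subn2 => ->.
have [y yL yq] := el q q_odd (prime_gt1 q_pr) side.
exact: ordL yL yq.
Qed.

End OuterElements.

(** * Reduction to almost simple groups *)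

Section Reduction.

Local Open Scope ring_scope.

Record unit_pair (gT : finGroupType) (p q : nat) (v w : integral_group_ring gT) : Prop :=
  UnitPair {
    up_expl : v ^+ p = 1; up_expr : w ^+ q = 1; up_comm : v * w = w * v;
    up_neql : v != 1; up_neqr : w != 1; up_augl : aug v = 1; up_augr : aug w = 1
  }.

Lemma unit_pair_sym (gT : finGroupType) p q (v w : integral_group_ring gT) :
  unit_pair p q v w -> unit_pair q p w v.
Proof. by case=> *; split. Qed.

(** Modulo the whole group every unit of augmentation one is trivial. *)
Lemma unit_prime_dvd (gT : finGroupType) p (v : integral_group_ring gT) :
  prime p -> v ^+ p = 1 -> v != 1 -> aug v = 1 -> (p %| #|gT|)%N.
Proof.
move=> p_pr vp v1 augv; rewrite -cardsT.
have nT : ([set: gT] <| [set: gT])%g := normal_refl _.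
apply: (@torsion_kernel gT [set: gT]%G nT v p) => //.
apply/ffunP=> X; have -> : X = 1%g.
  by case: (cosetP X) => x _ ->; apply: coset_id; rewrite inE.
rewrite gr_quo_at1 // ffunE eqxx -augv /aug.
by apply: eq_bigl => x; rewrite inE.
Qed.

Variables (p q : nat).
Hypotheses (p_pr : prime p) (q_pr : prime q) (pq : p != q).

Lemma quotient_lift (gT : finGroupType) (N : {group gT}) n :
  (exists X : coset_of N, #[X]%g = n) -> exists x : gT, #[x]%g = n.
Proof.
case=> X; case: (cosetP X) => x xN -> <-; apply: order_dvd_exists.
exact: morph_order.
Qed.

Lemma quotient_step (gT : finGroupType) (N : {group gT}) (v w : integral_group_ring gT) :
    (forall hT : finGroupType, (#|hT| < #|gT|)%N -> PSL_type hT ->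
       forall v w : integral_group_ring hT, unit_pair p q v w ->
       exists x : hT, #[x]%g = (p * q)%N) ->
    PSL_type gT -> (N <| [set: gT])%g -> (N :!=: 1)%g -> unit_pair p q v w ->
  [\/ exists x : gT, #[x]%g = (p * q)%N, gr_quo N v = 1 | gr_quo N w = 1].
Proof.
move=> IH good nN N1 [vp wq vw v1 w1 augv augw].
have [v0|v0] := eqVneq (gr_quo N v) 1; first by constructor 2.
have [w0|w0] := eqVneq (gr_quo N w) 1; first by constructor 3.
constructor 1; apply: (@quotient_lift _ N); apply: (IH _ _ _ (gr_quo N v) (gr_quo N w)).
- rewrite -!cardsT -quotientT; apply: ltn_quotient => //; exact: subsetT.
- exact: PSL_type_quotient.
split; rewrite ?aug_quo //; last by rewrite -!gr_quoM // vw.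
  by rewrite -gr_quoX // vp gr_quo1.
by rewrite -gr_quoX // wq gr_quo1.
Qed.

Lemma commuting_subgroups (gT : finGroupType) (A B : {group gT}) :
  (p %| #|A|)%N -> (q %| #|B|)%N -> B \subset 'C(A)%g -> exists x : gT, #[x]%g = (p * q)%N.
Proof.
move=> pA qB sBC; have [a aA ap] := Cauchy p_pr pA; have [b bB bq] := Cauchy q_pr qB.
apply: (commute_order_pq p_pr q_pr pq _ ap bq).
by apply/commute_sym; move/centP: (subsetP sBC b bB); apply.
Qed.

End Reduction.

Section MainInduction.

Local Open Scope ring_scope.

Lemma abelian_case (gT : finGroupType) (N : {group gT}) (l p q : nat)
    (v w : integral_group_ring gT) :
    prime p -> prime q -> p != q -> (N <| [set: gT])%g -> (l.-group N)%g ->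
    unit_pair p q v w -> gr_quo N v = 1 ->
  exists x : gT, #[x]%g = (p * q)%N.
Proof.
move=> p_pr q_pr pq nN lN [vp wq vw v1 w1 augv augw] v0.
have pN := torsion_kernel nN p_pr vp v1 augv v0.
have pl : p = l by have := pgroupP lN p p_pr pN; rewrite inE => /eqP.
apply: (normal_pgroup_edge nN p_pr q_pr pq _ vp v1 augv wq augw vw v0).
  by rewrite pl.
apply/eqP=> w0; have qN := torsion_kernel nN q_pr wq w1 augw w0.
by have := pgroupP lN q q_pr qN; rewrite inE -pl eq_sym (negPf pq).
Qed.

(** A conjugate of [L] other than [L] commutes with it, which suffices if [q] divides the
    order of [L]. Otherwise an element of order [q] centralises [L] or moves it. *)
Lemma moved_factor_case (gT : finGroupType) (N L : {group gT}) r p q :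
    prime r -> (5 <= r)%N -> L \isog PSL 2 'F_r -> simple L ->
    (N <| [set: gT])%g -> (L <| N)%g -> ~~ (L <| [set: gT])%g ->
    prime p -> prime q -> p != q -> (p %| #|L|)%N -> (q %| #|gT|)%N ->
  exists x : gT, #[x]%g = (p * q)%N.
Proof.
move=> r_pr r5 isoL simL nN nLN nL p_pr q_pr pq pL qG.
have [x xL] : exists x, x \notin 'N(L)%g.
  apply/existsP; apply: contraR nL; rewrite negb_exists => /forallP nL.
  by rewrite /normal subsetT; apply/subsetP=> x _; have := nL x; rewrite negbK.
have [qL|qL] := boolP (q %| #|L|)%N.
  apply: (commuting_subgroups p_pr q_pr pq pL (B := (L :^ x)%G)); first by rewrite cardJg.
  exact: conj_factor_cent nN nLN simL xL.
rewrite -cardsT in qG; have [y _ yq] := Cauchy q_pr qG.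
have [yN|yN] := boolP (y \in 'N(L)%g); last first.
  exact: (diagonal_edge nN nLN simL (PSL_simple_centre r_pr r5 isoL simL) p_pr q_pr pq pL yq yN).
have yC := PSL_outer_prime r_pr r5 isoL yN q_pr yq qL.
apply: (commuting_subgroups p_pr q_pr pq pL (B := <[y]>%G)); first by rewrite -orderE yq.
by rewrite cycle_subG.
Qed.

(** If [p] or [q] divides the order of the centraliser of [L], there are commuting elements
    of orders [p] and [q]; otherwise neither unit becomes trivial modulo the
    centraliser. *)
Lemma normal_factor_case (gT : finGroupType) (L : {group gT}) r p q
    (v w : integral_group_ring gT) :
    (forall hT : finGroupType, (#|hT| < #|gT|)%N -> PSL_type hT ->
       forall v w : integral_group_ring hT, unit_pair p q v w ->
       exists x : hT, #[x]%g = (p * q)%N) ->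
    PSL_type gT ->
    prime r -> (5 <= r)%N -> L \isog PSL 2 'F_r -> (L <| [set: gT])%g ->
    prime p -> prime q -> p != q -> unit_pair p q v w -> (p %| #|L|)%N ->
  exists x : gT, #[x]%g = (p * q)%N.
Proof.
move=> IH good r_pr r5 isoL nL p_pr q_pr pq vw_pair pL.
have [vp wq vw v1 w1 augv augw] := vw_pair.
have qG := unit_prime_dvd q_pr wq w1 augw.
have nC : ('C(L) <| [set: gT])%g.
  by rewrite /normal subsetT; apply: norms_cent; apply: normal_norm.
have [qC|qC] := boolP (q %| #|'C(L)%g|)%N.
  exact: (commuting_subgroups p_pr q_pr pq pL (B := 'C(L)%G) qC).
have [qL|qL] := boolP (q %| #|L|)%N; last first.
  rewrite -cardsT in qG; have [y _ yq] := Cauchy q_pr qG.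
  have yN : y \in 'N(L)%g by rewrite (subsetP (normal_norm nL)) ?inE.
  have yC := PSL_outer_prime r_pr r5 isoL yN q_pr yq qL.
  by case/negP: qC; rewrite -yq order_dvdG.
have [pC|pC] := boolP (p %| #|'C(L)%g|)%N.
  have qp : q != p by rewrite eq_sym.
  by rewrite mulnC; apply: (commuting_subgroups q_pr p_pr qp qL (B := 'C(L)%G) pC).
have [C1|C1] := eqVneq ('C(L)%g) 1%g.
  exact: (almost_simple_edge r_pr r5 isoL nL C1 p_pr q_pr pq pL qL vp wq vw v1 w1 augv augw).
have [//|v0|w0] := quotient_step (N := 'C(L)%G) IH good nC C1 vw_pair.
  by case/negP: pC; apply: (torsion_kernel nC p_pr vp v1 augv v0).
by case/negP: qC; apply: (torsion_kernel nC q_pr wq w1 augw w0).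
Qed.

(** The normal subgroup to factor out depends on a simple direct factor [L] of a minimal
    normal subgroup [N]: the largest normal [l]-subgroup of [N] if [L] has prime order [l],
    else [L] itself if it is normal, else [N]. *)
Theorem unit_edge (gT : finGroupType) p q (v w : integral_group_ring gT) :
    PSL_type gT -> prime p -> prime q -> p != q -> unit_pair p q v w ->
  exists x : gT, #[x]%g = (p * q)%N.
Proof.
move=> + p_pr q_pr pq; have [n] := ubnP #|gT|; elim: n gT v w => // n IHn gT v w.
rewrite ltnS => gTn good vw_pair.
have qp : q != p by rewrite eq_sym.
have IH (hT : finGroupType) : (#|hT| < #|gT|)%N -> PSL_type hT ->
    forall v w : integral_group_ring hT, unit_pair p q v w ->
    exists x : hT, #[x]%g = (p * q)%N.
  by move=> hTg good' v' w'; apply: IHn => //; apply: leq_trans gTn.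
have IH' (hT : finGroupType) : (#|hT| < #|gT|)%N -> PSL_type hT ->
    forall v w : integral_group_ring hT, unit_pair q p v w ->
    exists x : hT, #[x]%g = (q * p)%N.
  by move=> hTg good' v' w' /unit_pair_sym; rewrite mulnC; apply: IH.
have wv_pair := unit_pair_sym vw_pair.
have [vp wq vw v1 w1 augv augw] := vw_pair.
have pG := unit_prime_dvd p_pr vp v1 augv; have qG := unit_prime_dvd q_pr wq w1 augw.
have ntG : ([set: gT] != 1)%g.
  apply: contraTneq pG => G1; rewrite -cardsT G1 cards1 dvdn1.
  by rewrite gtn_eqF ?prime_gt1.
have [N [L [nN nLN simL dvdL]]] := simple_direct_factor ntG.
have [ntL simLP] := simpleP _ simL.
have sL : (L <|<| [set: gT])%g.
  by apply: subnormal_trans (normal_subnormal nLN) (normal_subnormal nN).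
have [prL|[r [r_pr r5 isoL]]] := PSL_type_simple good sL simL.
  pose M := ('O_#|L|(N))%G; have nM : (M <| [set: gT])%g.
    exact: char_normal_trans (pcore_char _ _) nN.
  have sLM : L \subset M by apply: pcore_max => //; rewrite /pgroup pnat_id.
  have ntM : (M :!=: 1)%g by apply: subG1_contra ntL.
  have lM : (#|L|.-group M)%g by apply: pcore_pgroup.
  have [//|v0|w0] := quotient_step IH good nM ntM vw_pair.
    exact: (abelian_case p_pr q_pr pq nM lM vw_pair v0).
  by rewrite mulnC; apply: (abelian_case q_pr p_pr qp nM lM wv_pair w0).
have [nL|nL] := boolP (L <| [set: gT])%g.
  have [//|v0|w0] := quotient_step IH good nL ntL vw_pair.
    have pL := torsion_kernel nL p_pr vp v1 augv v0.
    exact: (normal_factor_case IH good r_pr r5 isoL nL p_pr q_pr pq vw_pair pL).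
  have qL := torsion_kernel nL q_pr wq w1 augw w0.
  by rewrite mulnC; apply: (normal_factor_case IH' good r_pr r5 isoL nL q_pr p_pr qp wv_pair qL).
have ntN : (N :!=: 1)%g by apply: subG1_contra ntL; apply: normal_sub.
have [//|v0|w0] := quotient_step IH good nN ntN vw_pair.
  have pL := dvdL p p_pr (torsion_kernel nN p_pr vp v1 augv v0).
  exact: (moved_factor_case r_pr r5 isoL simL nN nLN nL p_pr q_pr pq pL qG).
have qL := dvdL q q_pr (torsion_kernel nN q_pr wq w1 augw w0).
by rewrite mulnC; apply: (moved_factor_case r_pr r5 isoL simL nN nLN nL q_pr p_pr qp qL pG).
Qed.

End MainInduction.

(** * Prime graphs *)

Section NormalisedUnitOrders.

Local Open Scope group_scope.

Variable gT : finGroupType.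
Implicit Types (g h : gT) (u : normalised_units gT).

Lemma has_orderE (x : gT) n : has_order x n <-> #[x] = n.
Proof.
split=> [[n0 xn min_n]|<-].
  apply/eqP; rewrite eqn_dvd order_dvdn xn eqxx /=; apply/idPn=> ndvd.
  have lt_n : 0 < #[x] < n.
    rewrite order_gt0 ltn_neqAle dvdn_leq ?order_dvdn ?xn ?andbT //.
    by apply: contra ndvd => /eqP ->.
  by case: (min_n _ lt_n); apply: expg_order.
split=> [||m /andP[m0 mx] xm]; [exact: order_gt0 | exact: expg_order |].
by have := dvdn_leq m0 (_ : #[x] %| m); rewrite order_dvdn xm eqxx leqNgt mx => /(_ isT).
Qed.

Definition unit_elt (u : normalised_units gT) : integral_group_ring gT :=
  unit_val (normalised_val u).

Lemma unit_elt_inj : injective unit_elt.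
Proof. by move=> u v /unit_val_inj/val_inj. Qed.

Lemma unit_eltX u n : unit_elt (u ^+ n) = (unit_elt u ^+ n)%R.
Proof.
elim: n => [|n IHn]; first by rewrite expg0 expr0.
by rewrite expgS exprS -IHn.
Qed.

Lemma aug_unit_elt u : aug (unit_elt u) = 1%R.
Proof. by case: u => u uP; apply: (eqP uP). Qed.

Fact group_unitP (g : gT) : inverse_pair (gr_of g, gr_of g^-1).
Proof. by rewrite /inverse_pair /= -!gr_ofM mulgV mulVg gr_of1 eqxx. Qed.

Fact group_unit_aug g : aug_one (UnitGroup (group_unitP g)).
Proof. by apply/eqP; rewrite augE gr_lift_of. Qed.

Definition group_unit g : normalised_units gT := NormalisedUnit (group_unit_aug g).

Lemma group_unitX g n : group_unit (g ^+ n) = group_unit g ^+ n.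
Proof.
apply: unit_elt_inj; elim: n => [|n IHn]; first exact: gr_of1.
by rewrite !expgS [LHS]gr_ofM [X in (_ * X)%R]IHn.
Qed.

Lemma gr_of_inj : injective (@gr_of gT).
Proof.
move=> g h /ffunP/(_ g); rewrite !ffunE eqxx.
by case: (g =P h).
Qed.

Lemma group_unit_order g n : has_order g n -> has_order (group_unit g) n.
Proof.
case=> n0 gn min_n; split=> // [|m mn]; rewrite -group_unitX ?gn.
  by apply: unit_elt_inj; apply: gr_of1.
move=> /(congr1 unit_elt) e; apply: (min_n m mn); apply: gr_of_inj.
by rewrite gr_of1; apply: e.
Qed.

Lemma unit_elt_neq1 u n m : has_order u n -> 0 < m < n -> (unit_elt u ^+ m)%R != 1%R.
Proof.
case=> _ _ min_n mn; rewrite -unit_eltX; apply/eqP=> e.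
by apply: (min_n m mn); apply: unit_elt_inj.
Qed.

Lemma vertex_iff p : pg_vertex (normalised_units gT) p <-> pg_vertex gT p.
Proof.
split=> -[p_pr [x xp]]; split=> //; last by exists (group_unit x); apply: group_unit_order.
have p1 := prime_gt1 p_pr; have [_ xp1 _] := xp.
have x1 : unit_elt x != 1%R by rewrite -[unit_elt x]expr1 (unit_elt_neq1 xp) ?p1.
have xp_1 : (unit_elt x ^+ p = 1)%R by rewrite -unit_eltX xp1.
have pG := unit_prime_dvd p_pr xp_1 x1 (aug_unit_elt x).
rewrite -cardsT in pG; have [y _ yp] := Cauchy p_pr pG.
by exists y; apply/has_orderE.
Qed.

Lemma edge_iff p q : PSL_type gT ->
  pg_edge (normalised_units gT) p q <-> pg_edge gT p q.
Proof.
move=> good; split=> -[/vertex_iff vp /vertex_iff vq pq [x xpq]]; split=> //.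
  have [p_pr _] := vp; have [q_pr _] := vq.
  have [p1 q1] := (prime_gt1 p_pr, prime_gt1 q_pr).
  have [_ x_pq _] := xpq; pose a := unit_elt x.
  have a_pq : (a ^+ (p * q) = 1)%R by rewrite -unit_eltX x_pq.
  have augX n : aug (a ^+ n)%R = 1%R by rewrite rmorphXn /= aug_unit_elt expr1n.
  have [y ypq] : exists y : gT, #[y] = (p * q)%N.
    have pq' : p != q by apply/eqP.
    apply: (@unit_edge gT p q (a ^+ q)%R (a ^+ p)%R good p_pr q_pr pq').
    split; rewrite -?exprM ?[(q * p)%N]mulnC //.
    - by rewrite -!exprD addnC.
    - by apply: (unit_elt_neq1 xpq); rewrite (ltnW q1) ltn_Pmull // ltnW.
    by apply: (unit_elt_neq1 xpq); rewrite (ltnW p1) ltn_Pmulr // ltnW.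
  by exists y; apply/has_orderE.
by exists (group_unit x); apply: group_unit_order.
Qed.

End NormalisedUnitOrders.

Local Open Scope group_scope.

Theorem corollary3p2 (G : finGroupType)
    (hG : forall X : section G, composition_factor [set: G]%G X ->
      prime #|X| \/
      exists p : nat, [/\ prime p, 5 <= p & X \isog PSL 2 'F_p]) :
  same_graph (prime_graph (normalised_units G)) (prime_graph G).
Proof.
split=> [p|p q]; first exact: vertex_iff.
exact: edge_iff (PSL_type_comps hG).
Qed.
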